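(* Let $\nu\ge 1$, $\rho_1>\rho>0$, and let $F$ be a $\mathbb{C}^\nu$-valued function of $(\varepsilon,z,f)$, holomorphic in (a neighbourhood of) the closed polydisc $\bar D_\rho\times\bar D_{\rho_1}\times\bar D_\rho^{\,\nu}$, with $F(\varepsilon,0,0)=0$ for all $\varepsilon\in\bar D_\rho$. Assume that the matrix $A_{0,1}(0)=F_f(0,0,0)$ is invertible and that, for some $\gamma_0>0$, its eigenvalues $\lambda_1,\dots,\lambda_\nu$ satisfy $|\arg\lambda_j|>\gamma_0/2$ for $j=1,\dots,\nu$ (with $\arg\lambda_j\in(-\pi,\pi]$). Then there exist $\gamma>0$, $E>0$ and $\sigma>0$ such that the system $$\varepsilon z f'(\varepsilon,z)=F(\varepsilon,z,f(\varepsilon,z)),\qquad f'=\partial f/\partial z,$$ has a solution $f(\varepsilon,z)$ holomorphic in $S(0,\gamma;E)\times D_\sigma$. Moreover, as $\varepsilon\to0$ in the sector $S(0,\gamma;E)$, the solution $f(\varepsilon,z)$ converges (for each $z\in D_\sigma$) to $f^*(z)$, where $f^*$ is the unique (holomorphic) solution in $D_\sigma$ of $F(0,z,f^*(z))=0$ satisfying $f^*(0)=0$.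
   Context: Notation: $D_r=\{z\in\mathbb{C}:|z|<r\}$, $\bar D_r$ is its closure, and $F_f$ is the Jacobian matrix of $F$ with respect to $f\in\mathbb{C}^\nu$. For $\gamma,E>0$, $S(0,\gamma;E)=\{\varepsilon\in\mathbb{C}:0<|\varepsilon|<E,\ |\arg\varepsilon|<\gamma/2\}$ is the open sector bisected by the positive real axis, of opening $\gamma$ and radius $E$. *)

(* Defs.v *)
(* MathComp world (MathComp-Analysis); the complex numbers are [R[i]] for an
   arbitrary [R : realType], and C^nu is the row-vector space ['rV[R[i]]_nu]. *)
From HB Require Import structures.
From mathcomp Require Export all_boot all_order all_algebra.
From mathcomp Require Export complex.
From mathcomp Require Export all_classical all_reals all_analysis.
Export numFieldNormedType.Exports.

Set Implicit Arguments.
Unset Strict Implicit.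
Unset Printing Implicit Defensive.

Import Order.TTheory GRing.Theory Num.Theory.

Local Open Scope classical_set_scope.
Local Open Scope ring_scope.
Local Open Scope complex_scope.

(* MathComp-Analysis puts the norm topology on an abstract [K : numFieldType]
   but not on the concrete type [R[i]]. *)
HB.instance Definition _ (R : rcfType) := NormedModule.copy R[i] (R[i]^o).

(* For [K = R[i]], [differentiable] is Frechet differentiability with a
   C-linear differential, i.e. joint complex differentiability. *)
Definition holomorphic (K : numFieldType) (V W : normedModType K)
    (U : set V) (f : V -> W) : Prop :=
  open U /\ forall x, U x -> differentiable f x.

(* The principal argument, in ]-pi, pi]; unspecified at [z = 0]. *)
Definition Arg (R : realType) (z : R[i]) : R :=
  xget 0 [set t : R | - pi < t <= pi /\ z = `|z| * (cos t +i* sin t)].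

(* The order of [R[i]] is partial, but [`|z|] is a nonnegative real, so that
   [`|z| < r%:C] is the usual strict comparison of real numbers. *)
Definition disc (R : realType) (r : R) : set R[i] :=
  [set z | `|z| < r%:C].

Definition closed_disc (R : realType) (r : R) : set R[i] :=
  [set z | `|z| <= r%:C].

Definition sector (R : realType) (gamma E : R) : set R[i] :=
  [set e | 0 < `|e| < E%:C /\ `|Arg e| < gamma / 2].

Definition closed_polydisc (R : realType) (nu : nat) (rho rho1 : R) :
    set (R[i] * R[i] * 'rV[R[i]]_nu) :=
  [set p : R[i] * R[i] * 'rV[R[i]]_nu |
    [/\ closed_disc rho p.1.1, closed_disc rho1 p.1.2 &
       forall j, closed_disc rho (p.2 ord0 j)]].

(* The matrix (dF_i / df_j)_(i, j) at the point (e, z, v). The library's ['J]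
   acts on row vectors on the right, hence the transposition. *)
Definition Jacobian_f (R : realType) (nu : nat)
    (F : R[i] * R[i] * 'rV[R[i]]_nu -> 'rV[R[i]]_nu)
    (e z : R[i]) (v : 'rV[R[i]]_nu) : 'M[R[i]]_nu :=
  ('J (fun f : 'rV[R[i]]_nu => F (e, z, f)) v)^T.

(* [f] is holomorphic on S x D, its graph stays in the domain [U] of [F], and
   it satisfies e z (df/dz)(e, z) = F (e, z, f (e, z)) on S x D. *)
Definition solves_system (R : realType) (nu : nat)
    (U : set (R[i] * R[i] * 'rV[R[i]]_nu))
    (F : R[i] * R[i] * 'rV[R[i]]_nu -> 'rV[R[i]]_nu)
    (S D : set R[i]) (f : R[i] -> R[i] -> 'rV[R[i]]_nu) : Prop :=
  holomorphic (S `*` D) (fun p : R[i] * R[i] => f p.1 p.2) /\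
  forall e z, S e -> D z ->
    U (e, z, f e z) /\ (e * z) *: derive1 (f e) z = F (e, z, f e z).

Definition solves_reduced (R : realType) (nu : nat)
    (U : set (R[i] * R[i] * 'rV[R[i]]_nu))
    (F : R[i] * R[i] * 'rV[R[i]]_nu -> 'rV[R[i]]_nu)
    (D : set R[i]) (g : R[i] -> 'rV[R[i]]_nu) : Prop :=
  [/\ holomorphic D g, g 0 = 0 &
      forall z, D z -> U (0, z, g z) /\ F (0, z, g z) = 0].

(* Main.v *)
(* Write [F(e, z, w) = w J(e) + N(e, z, w)] with [J(e) = F_w(e, 0, 0)] and look for
   [f = sum_k b_k(e) z^k] with [b_0 = 0]; the system says that
   [b_k (k e - J(e)) = [z^k] N(e, z, sum_(l < k) b_l z^l)]. A cone around the positive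
   axis is separated from the eigenvalues of [J(0)], so the inverses of [k e - J(e)]
   are bounded uniformly in [k] and in [e], the vertex [e = 0] included, and the
   recursion makes sense on the closed sector. As no power of [k] is gained,
   convergence comes from an a priori bound for [sum_k |k b_k|^2 s^(2k)]: by Bessel
   and Parseval it is controlled by the mean square over circles of [z d/dz] of
   [N(e, z, f)], which is small when [z] and [f] are. Each [b_k] is holomorphic in the
   sector and continuous at its vertex, and the tails of the series are uniformly
   small; hence [f] is holomorphic, and it tends to [f(0, .)], which solves the reduced
   equation. The Lipschitz and second order estimates for [F] near [0] come from
   Cauchy's estimates on complex lines. *)

From HB Require Import structures.
Require Import Defs.
From mathcomp Require Import all_boot all_order all_algebra complex.
From mathcomp Require Import all_classical all_reals all_analysis.
From mathcomp Require Import ring lra.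
Import Order.TTheory GRing.Theory Num.Theory.
Import numFieldNormedType.Exports.

Set Implicit Arguments.
Unset Strict Implicit.
Unset Printing Implicit Defensive.

Local Open Scope classical_set_scope.
Local Open Scope ring_scope.
Local Open Scope complex_scope.

(** * Real-variable calculus of complex functions and Goursat's theorem *)

(** The a priori bound is an induction over truncations. For the polynomial p_m with coefficients
    b_l, l < m, the function z d/dz N(e, z, p_m) splits into z N_z and (F_w(e, z, p_m) - J(e)) z
    p_m', where the factor in front of z p_m' is of size |z| + |p_m|. The weights k let the estimate
    close: since the series of 1/k^2 converges, the square sum of k |b_k| s^k dominates the sum of
    |b_k| s^k, so the same quantity bounds p_m uniformly and keeps the next step inside the domain
    of F. Truncation costs nothing: N has no linear part in w at z = 0, so changing w at order z^k
    alters N only from order k + 1 on. Solving at e = 0 by the same recursion replaces the implicit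
    function theorem; uniqueness on the whole disc combines a contraction estimate for small values
    with an intermediate value argument. *)

Section Modulus.
Variable R : realType.
Local Notation C := R[i].
Implicit Types x y z : C.

(* The modulus as an element of [R]; [`|z|] is its image in [R[i]]. *)
Definition nc z : R := Normc.normc z.

Lemma normE z : `|z| = (nc z)%:C.
Proof. by []. Qed.

Lemma nc0 : nc 0 = 0.
Proof. exact: Normc.normc0. Qed.

Lemma nc1 : nc 1 = 1.
Proof. exact: Normc.normc1. Qed.

Lemma nc_ge0 z : 0 <= nc z.
Proof. by case: z => a b; rewrite /nc /= sqrtr_ge0. Qed.

Lemma ncM x y : nc (x * y) = nc x * nc y.
Proof. exact: Normc.normcM. Qed.

Lemma ncV x : nc x^-1 = (nc x)^-1.
Proof. exact: Normc.normcV. Qed.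

Lemma ncN x : nc (- x) = nc x.
Proof. exact: normcN. Qed.

Lemma ncD x y : nc (x + y) <= nc x + nc y.
Proof. exact: le_normcD. Qed.

Lemma ncB x y : nc (x - y) <= nc x + nc y.
Proof. by rewrite -(ncN y) ncD. Qed.

Lemma ncX x n : nc (x ^+ n) = nc x ^+ n.
Proof. by elim: n => [|n IH]; rewrite ?expr0 ?nc1 // !exprS ncM IH. Qed.

Lemma ncC x y : nc (x - y) = nc (y - x).
Proof. by rewrite -ncN opprB. Qed.

Lemma ncD3 x y z : nc (x - z) <= nc (x - y) + nc (y - z).
Proof. by rewrite -(subrKA y) ncD. Qed.

Lemma ncBl x y : nc x - nc y <= nc (x - y).
Proof. by rewrite lerBlDr -{1}(subrK y x) ncD. Qed.

Lemma nc_eq0 x : (nc x == 0) = (x == 0).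
Proof. by apply/eqP/eqP => [/Normc.eq0_normc|->] //; exact: nc0. Qed.

Lemma nc_gt0 x : (0 < nc x) = (x != 0).
Proof. by rewrite lt_neqAle nc_ge0 andbT eq_sym nc_eq0. Qed.

Lemma nc_real (a : R) : nc a%:C = `|a|.
Proof. by rewrite /nc /= expr0n addr0 sqrtr_sqr. Qed.

Lemma nc_nat n : nc n%:R = n%:R.
Proof. by rewrite -(rmorph_nat (real_complex R)) nc_real ger0_norm. Qed.

Lemma ncMr (a : R) x : nc (a%:C * x) = `|a| * nc x.
Proof. by rewrite ncM nc_real. Qed.

Lemma nc_sum (I : Type) (r : seq I) (P : pred I) (u : I -> C) :
  nc (\sum_(i <- r | P i) u i) <= \sum_(i <- r | P i) nc (u i).
Proof.
elim/big_rec2: _ => [|i a b _ h]; first by rewrite nc0.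
by apply: le_trans (ncD _ _) _; rewrite lerD2l.
Qed.

Lemma nc_sqr z : nc z ^+ 2 = complex.Re z ^+ 2 + complex.Im z ^+ 2.
Proof. by case: z => a b; rewrite /nc /= sqr_sqrtr // addr_ge0 ?sqr_ge0. Qed.

Lemma Re_le z : `|complex.Re z| <= nc z.
Proof.
rewrite -(ler_pXn2r (_ : (0 < 2)%N)) ?nnegrE ?nc_ge0 //.
by rewrite nc_sqr real_normK ?num_real // lerDl sqr_ge0.
Qed.

Lemma Im_le z : `|complex.Im z| <= nc z.
Proof.
rewrite -(ler_pXn2r (_ : (0 < 2)%N)) ?nnegrE ?nc_ge0 //.
by rewrite nc_sqr real_normK ?num_real // lerDr sqr_ge0.
Qed.

Lemma nc_le z : nc z <= `|complex.Re z| + `|complex.Im z|.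
Proof.
rewrite -(ler_pXn2r (_ : (0 < 2)%N)) ?nnegrE ?nc_ge0 ?addr_ge0 //.
rewrite nc_sqr sqrrD !real_normK ?num_real // addrAC lerDl.
by rewrite mulrn_wge0 // mulr_ge0.
Qed.

Lemma nc_conj z : nc z^*%C = nc z.
Proof. by case: z => a b; rewrite /nc /= sqrrN. Qed.

Lemma mul_conj z : z^*%C * z = (nc z ^+ 2)%:C.
Proof.
rewrite nc_sqr; case: z => a b; apply/eqP.
by rewrite eq_complex /=; apply/andP; split; apply/eqP; ring.
Qed.

Lemma ReM z w : complex.Re (z * w) =
  complex.Re z * complex.Re w - complex.Im z * complex.Im w.
Proof. by case: z w => a b [c d]. Qed.

Lemma ImM z w : complex.Im (z * w) =
  complex.Re z * complex.Im w + complex.Im z * complex.Re w.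
Proof. by case: z w => a b [c d]. Qed.

Lemma ReB z w : complex.Re (z - w) = complex.Re z - complex.Re w.
Proof. by case: z w => a b [c d]. Qed.

Lemma ImB z w : complex.Im (z - w) = complex.Im z - complex.Im w.
Proof. by case: z w => a b [c d]. Qed.

Lemma le0_nc_eq z : (forall e, 0 < e -> nc z <= e) -> z = 0.
Proof.
move=> h; apply/eqP; rewrite -nc_eq0 eq_le nc_ge0 andbT.
by apply/ler_addgt0Pl => e /h; rewrite addr0.
Qed.

Lemma realcD (a b : R) : (a + b)%:C = a%:C + b%:C :> C.
Proof. exact: rmorphD. Qed.

Lemma realcB (a b : R) : (a - b)%:C = a%:C - b%:C :> C.
Proof. exact: rmorphB. Qed.

Lemma realcM (a b : R) : (a * b)%:C = a%:C * b%:C :> C.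
Proof. exact: rmorphM. Qed.

End Modulus.

(** * Differentiation and integration along the real line *)

Section Primitive.
Variable R : realType.
Local Notation C := R[i].
Implicit Types (f g F G : R -> C) (a b x : R).

Definition rcont f := forall x (e : R), 0 < e ->
  exists2 d : R, 0 < d & forall y, `|y - x| < d -> nc (f y - f x) <= e.

(** The difference quotient is multiplied out by [h], so that [h = 0] needs no exclusion and
    remainders can be added directly. *)
Definition rder F x (l : C) := forall e : R, 0 < e ->
  exists2 d : R, 0 < d &
  forall h : R, `|h| < d -> nc (F (x + h) - F x - h%:C * l) <= e * `|h|.

Lemma is_deriveP (f : R -> R) x l : is_derive x 1 f l <->
  (forall e : R, 0 < e -> exists2 d : R, 0 < d &
    forall h : R, `|h| < d -> `|f (x + h) - f x - h * l| <= e * `|h|).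
Proof.
split=> [[df dl] e e0|H].
- have : h^-1 *: (f (h *: 1 + x) - f x) @[h --> 0^'] --> l.
    by rewrite -dl; exact: df.
  move/cvgrPdist_le => /(_ e e0).
  rewrite /dnbhs/= near_withinE => /nbhs_ballP[d /= d0 Hd].
  exists d => // h hd; have [->|h0] := eqVneq h 0.
    by rewrite addr0 subrr mul0r subrr normr0 mulr0.
  have := Hd h; rewrite /ball/= sub0r normrN => /(_ hd h0).
  rewrite [h *: 1]mulr1 [h^-1 *: _]/GRing.scale/= => H.
  have -> : f (x + h) - f x - h * l = - h * (l - h^-1 * (f (h + x) - f x)).
    by rewrite (addrC x); field.
  by rewrite normrM normrN mulrC ler_wpM2r.
- have : h^-1 *: (f (h *: 1 + x) - f x) @[h --> 0^'] --> l.
    apply/cvgrPdist_le => e e0; have [d d0 Hd] := H e e0.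
    rewrite /dnbhs/= near_withinE; apply/nbhs_ballP; exists d => //= h.
    rewrite /ball/= sub0r normrN => hd h0.
    rewrite [h *: 1]mulr1 [h^-1 *: _]/GRing.scale/=.
    have -> : l - h^-1 * (f (h + x) - f x) = - h^-1 * (f (x + h) - f x - h * l).
      by rewrite (addrC x); field.
    rewrite normrM normrN normfV mulrC ler_pdivrMr ?normr_gt0 //.
    exact: Hd.
  move=> Hl; apply: DeriveDef; first by apply/cvg_ex; exists l.
  exact/cvg_lim.
Qed.

Lemma rder_Re F x l c : rder F x l ->
  is_derive x 1 (fun t => complex.Re (c * F t)) (complex.Re (c * l)).
Proof.
move=> H; apply/is_deriveP => e e0.
have c1 : 0 < nc c + 1 by have := nc_ge0 c; lra.
have [d d0 Hd] := H (e / (nc c + 1)) (divr_gt0 e0 c1).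
exists d => // h hd.
have -> : complex.Re (c * F (x + h)) - complex.Re (c * F x) -
    h * complex.Re (c * l) = complex.Re (c * (F (x + h) - F x - h%:C * l)).
  rewrite !mulrBr !ReB; congr (_ - _).
  by rewrite mulrCA [RHS]ReM /= mul0r subr0.
apply: le_trans (Re_le _) _; rewrite ncM.
apply: le_trans (ler_wpM2l (nc_ge0 c) (Hd h hd)) _.
rewrite mulrA ler_wpM2r // mulrCA -{2}(mulr1 e) ler_wpM2l ?(ltW e0) //.
by rewrite ler_pdivrMr // mul1r lerDl.
Qed.

Lemma rder_of_real F x l :
  is_derive x 1 (fun t => complex.Re (F t)) (complex.Re l) ->
  is_derive x 1 (fun t => complex.Im (F t)) (complex.Im l) -> rder F x l.
Proof.
move=> /is_deriveP H1 /is_deriveP H2 e e0.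
have e2 : 0 < e / 2 by lra.
have [d1 d10 Hd1] := H1 _ e2; have [d2 d20 Hd2] := H2 _ e2.
exists (Num.min d1 d2); first by rewrite lt_min d10.
move=> h; rewrite lt_min => /andP[/Hd1 k1 /Hd2 k2].
apply: le_trans (nc_le _) _.
rewrite !ReB !ImB ReM ImM /= !mul0r subr0 addr0.
have -> : e * `|h| = e / 2 * `|h| + e / 2 * `|h| by field.
exact: lerD.
Qed.

Lemma rder_cont F (l : R -> C) : (forall x, rder F x (l x)) -> rcont F.
Proof.
move=> H x e e0; have [d d0 Hd] := H x 1 ltr01.
have k0 : 0 < 1 + nc (l x) by have := nc_ge0 (l x); lra.
exists (Num.min d (e / (1 + nc (l x)))); first by rewrite lt_min d0 divr_gt0.
move=> y; rewrite lt_min => /andP[/Hd]; rewrite (addrC x) subrK => h1 h2.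
have -> : F y - F x = (F y - F x - (y - x)%:C * l x) + (y - x)%:C * l x by ring.
apply: le_trans (ncD _ _) _; rewrite ncMr.
rewrite ltr_pdivlMr // in h2; nra.
Qed.

(** Multiplying [F] by the conjugate of [F b - F a] and taking real parts gives a real function
    whose increment is |F b - F a|^2; the real mean value theorem applies, and one factor
    cancels. *)
Lemma rder_meanvalue F (l : R -> C) a b (M : R) : a <= b ->
  (forall x, rder F x (l x)) ->
  (forall x, a <= x <= b -> nc (l x) <= M) -> nc (F b - F a) <= M * (b - a).
Proof.
move=> ab H HM.
have [->|z0] := eqVneq (F b - F a) 0.
  rewrite nc0 mulr_ge0 ?subr_ge0 //.
  by apply: le_trans (nc_ge0 (l a)) (HM a _); rewrite lexx ab.
set c := (F b - F a)^*%C.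
have dP x : is_derive x 1 (fun t => complex.Re (c * F t)) (complex.Re (c * l x)).
  exact: rder_Re.
have [|x /=] := @MVT_segment R (fun t => complex.Re (c * F t))
   (fun x => complex.Re (c * l x)) a b ab.
  have cf x : {for x, continuous (fun t => complex.Re (c * F t))}.
    by apply: differentiable_continuous; apply/derivable1_diffP; case: (dP x).
  exact: continuous_subspaceT.
rewrite in_itv /= => xab.
rewrite -ReB -mulrBr mul_conj /=.
have zp : 0 < nc (F b - F a) by rewrite nc_gt0.
rewrite expr2 => E.
have : complex.Re (c * l x) <= nc (F b - F a) * M.
  apply: le_trans (ler_norm _) (le_trans (Re_le _) _).
  by rewrite ncM nc_conj ler_wpM2l ?nc_ge0 // HM.
move=> /(ler_wpM2r (_ : 0 <= b - a)) -/(_ _); rewrite subr_ge0 => /(_ ab).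
by rewrite -E -mulrA ler_pM2l.
Qed.

Lemma rder_eq_cst F (l : R -> C) a b : (forall x, rder F x (l x)) ->
  (forall x, l x = 0) -> F a = F b.
Proof.
move=> H l0; wlog ab : a b / a <= b => [hw|].
  by case/orP: (le_total a b) => /hw.
apply/esym/eqP; rewrite -subr_eq0 -nc_eq0 eq_le nc_ge0 andbT.
have := rder_meanvalue (M := 0) ab H; rewrite mul0r; apply => x _.
by rewrite l0 nc0.
Qed.

Lemma primitive_gt (f : R -> R) a : continuous f ->
  exists F : R -> R, forall x, a < x -> is_derive x 1 F (f x).
Proof.
move=> cf; exists (fun x => \int[lebesgue_measure]_(t in [set` `[a, x]]) f t)%R.
move=> x ax.
have xu : x < x + 1 by rewrite ltrDl.
have fi : lebesgue_measure.-integrable `[a, x + 1] (EFin \o f).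
  apply: continuous_compact_integrable; first exact: segment_compact.
  exact: continuous_subspaceT.
have [d <-] := continuous_FTC1_closed xu fi ax (cf x).
by rewrite derive1E; exact: DeriveDef.
Qed.

(** Primitives on the half-lines t > -n differ by constants where two of them are defined;
    normalised at 0 they glue to a primitive on the whole line. *)
Lemma primitive_real (f : R -> R) : continuous f ->
  exists F : R -> R, forall x, is_derive x 1 F (f x).
Proof.
move=> cf.
have /choice[G HG] : forall n : nat, exists F : R -> R,
    forall x, - n%:R < x -> is_derive x 1 F (f x).
  by move=> n; exact: primitive_gt.
have key n m y : `|y| < n%:R -> `|y| < m%:R -> G n y - G n 0 = G m y - G m 0.
  move=> yn ym.
  suff E a b : - n%:R < a -> - m%:R < a -> a <= b ->
      G n b - G m b = G n a - G m a.
    have := ltr_normlP _ _ yn; have := ltr_normlP _ _ ym => -[m1 m2] [n1 n2].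
    have n0 : 0 < n%:R :> R by apply: le_lt_trans yn.
    have m0 : 0 < m%:R :> R by apply: le_lt_trans ym.
    case/orP: (le_total 0 y) => y0.
      by have := E 0 y; rewrite !oppr_lt0 => /(_ n0 m0 y0); lra.
    by have := E y 0; rewrite ltrNl (ltrNl m%:R) => /(_ n1 m1 y0); lra.
  move=> na ma ab.
  have dP x : a <= x -> is_derive x 1 (fun t => G n t - G m t) 0.
    move=> ax; rewrite -(subrr (f x)); apply: is_deriveB; apply: HG.
      exact: lt_le_trans ax.
    exact: lt_le_trans ax.
  have := @MVT_segment R (fun t => G n t - G m t) (fun=> 0) a b ab.
  case.
  - by move=> x; rewrite in_itv/= => /andP[/ltW/dP].
  - apply: continuous_in_subspaceT => x; rewrite inE/= in_itv/= => /andP[/dP[d _] _].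
    by apply: differentiable_continuous; apply/derivable1_diffP.
  - by move=> c _ /eqP; rewrite mul0r subr_eq0 => /eqP.
pose k (x : R) : nat := (Num.truncn `|x|).+1.
have kP x : `|x| < (k x)%:R by rewrite truncnS_gt.
exists (fun x => G (k x) x - G (k x) 0) => x.
(* One more than [k x], so that a single primitive serves on the whole interval of radius 1 around
   [x]. *)
pose m := (k x).+1.
have mP y : `|y - x| < 1 -> `|y| < m%:R.
  move=> yx; rewrite /m -addn1 natrD.
  apply: le_lt_trans (_ : `|y - x| + `|x| < _).
    by rewrite -{1}(subrK x y) ler_normD.
  by rewrite addrC ltrD.
apply: (@near_eq_is_derive _ _ _ (fun y => G m y - G m 0)).
  apply/nbhs_ballP; exists 1 => //= y; rewrite /ball/= distrC => yx.
  exact/key/kP/mP.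
rewrite -[f x]subr0; apply: is_deriveB.
apply: HG; have := mP x; rewrite subrr normr0 => /(_ ltr01)/ltr_normlP[].
by rewrite ltrNl.
Qed.

Lemma primitive_ex f : rcont f -> exists F, forall x, rder F x (f x).
Proof.
move=> cf.
have [F1 H1] : exists F : R -> R, forall x, is_derive x 1 F (complex.Re (f x)).
  apply: primitive_real => x; apply/cvgrPdist_le => e e0.
  have [d d0 Hd] := cf x e e0; apply/nbhs_ballP; exists d => // y.
  rewrite /ball/= distrC => /Hd h; rewrite distrC -ReB.
  exact: le_trans (Re_le _) h.
have [F2 H2] : exists F : R -> R, forall x, is_derive x 1 F (complex.Im (f x)).
  apply: primitive_real => x; apply/cvgrPdist_le => e e0.
  have [d d0 Hd] := cf x e e0; apply/nbhs_ballP; exists d => // y.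
  rewrite /ball/= distrC => /Hd h; rewrite distrC -ImB.
  exact: le_trans (Im_le _) h.
by exists (fun x => F1 x +i* F2 x) => x; apply: rder_of_real; rewrite /=.
Qed.

(* Meaningful only if [f] has a primitive, which [primitive_ex] provides for
   continuous [f]. *)
Definition rint f a b : C :=
  let F := xget (fun=> 0) [set F | forall x, rder F x (f x)] in F b - F a.

Lemma rderD F G x l m : rder F x l -> rder G x m ->
  rder (fun t => F t + G t) x (l + m).
Proof.
move=> H1 H2 e e0; have e2 : 0 < e / 2 by lra.
have [d1 d10 Hd1] := H1 _ e2; have [d2 d20 Hd2] := H2 _ e2.
exists (Num.min d1 d2); first by rewrite lt_min d10.
move=> h; rewrite lt_min => /andP[/Hd1 k1 /Hd2 k2].
have -> : F (x + h) + G (x + h) - (F x + G x) - h%:C * (l + m) =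
  (F (x + h) - F x - h%:C * l) + (G (x + h) - G x - h%:C * m) by ring.
apply: le_trans (ncD _ _) _.
have -> : e * `|h| = e / 2 * `|h| + e / 2 * `|h| by field.
exact: lerD.
Qed.

Lemma rderZ c F x l : rder F x l -> rder (fun t => c * F t) x (c * l).
Proof.
move=> H e e0; have c1 : 0 < nc c + 1 by have := nc_ge0 c; lra.
have [d d0 Hd] := H (e / (nc c + 1)) (divr_gt0 e0 c1).
exists d => // h hd.
have -> : c * F (x + h) - c * F x - h%:C * (c * l) =
  c * (F (x + h) - F x - h%:C * l) by ring.
rewrite ncM; apply: le_trans (ler_wpM2l (nc_ge0 c) (Hd h hd)) _.
rewrite mulrA ler_wpM2r // mulrCA -{2}(mulr1 e) ler_wpM2l ?(ltW e0) //.
by rewrite ler_pdivrMr // mul1r lerDl.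
Qed.

Lemma rint_prim F f a b : (forall x, rder F x (f x)) -> rint f a b = F b - F a.
Proof.
move=> HF; rewrite /rint; set G := xget _ _.
have HG x : rder G x (f x).
  by rewrite /G; case: xgetP => [y _ //|/(_ F)] /(_ HF).
have H x : rder (fun t => G t + (-1) * F t) x 0.
  have -> : 0 = f x + (-1) * f x by ring.
  by apply: rderD => //; apply: rderZ.
have := rder_eq_cst a b H (fun=> erefl _).
rewrite !mulN1r => E.
have -> : G b = G a - F a + F b by rewrite E; ring.
ring.
Qed.

Lemma rint_cat f a b c : rint f a c = rint f a b + rint f b c.
Proof. by rewrite /rint; ring. Qed.

Lemma rintD f g a b : rcont f -> rcont g ->
  rint (fun t => f t + g t) a b = rint f a b + rint g a b.
Proof.
move=> /primitive_ex[F HF] /primitive_ex[G HG].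
rewrite (rint_prim a b HF) (rint_prim a b HG).
by rewrite (@rint_prim (fun t => F t + G t)) => [|x]; [ring | exact: rderD].
Qed.

Lemma rintZ c f a b : rcont f -> rint (fun t => c * f t) a b = c * rint f a b.
Proof.
move=> /primitive_ex[F HF]; rewrite (rint_prim a b HF).
by rewrite (@rint_prim (fun t => c * F t)) => [|x]; [ring | exact: rderZ].
Qed.

Lemma rint_le f a b (M : R) : rcont f -> a <= b ->
  (forall x, a <= x <= b -> nc (f x) <= M) -> nc (rint f a b) <= M * (b - a).
Proof.
move=> /primitive_ex[F HF] ab HM; rewrite (rint_prim a b HF).
exact: rder_meanvalue ab HF HM.
Qed.

Lemma rcont_cst c : rcont (fun=> c).
Proof. by move=> x e e0; exists 1 => // y _; rewrite subrr nc0 ltW. Qed.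

Lemma rcontD f g : rcont f -> rcont g -> rcont (fun t => f t + g t).
Proof.
move=> H1 H2 x e e0; have e2 : 0 < e / 2 by lra.
have [d1 d10 Hd1] := H1 x _ e2; have [d2 d20 Hd2] := H2 x _ e2.
exists (Num.min d1 d2); first by rewrite lt_min d10.
move=> y; rewrite lt_min => /andP[/Hd1 k1 /Hd2 k2].
rewrite opprD addrACA; apply: le_trans (ncD _ _) _; lra.
Qed.

Lemma rcontM f g : rcont f -> rcont g -> rcont (fun t => f t * g t).
Proof.
move=> H1 H2 x e e0.
have pf := nc_ge0 (f x); have pg := nc_ge0 (g x).
pose k := nc (f x) + nc (g x) + 1; have k0 : 0 < k by rewrite /k; lra.
pose e1 := Num.min 1 (e / k).
have e10 : 0 < e1 by rewrite lt_min ltr01 divr_gt0.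
have [d1 d10 Hd1] := H1 x _ e10; have [d2 d20 Hd2] := H2 x _ e10.
exists (Num.min d1 d2); first by rewrite lt_min d10.
move=> y; rewrite lt_min => /andP[/Hd1 k1 /Hd2 k2].
have -> : f y * g y - f x * g x = (f y - f x) * (g y - g x) +
  ((f y - f x) * g x + f x * (g y - g x)) by ring.
apply: le_trans (ncD _ _) _; rewrite ncM.
have : e1 * k <= e.
  by rewrite -ler_pdivlMr // /e1 ge_min lexx orbT.
have h1 : e1 <= 1 by rewrite /e1 ge_min lexx.
have := ncD ((f y - f x) * g x) (f x * (g y - g x)); rewrite !ncM /k.
have p1 := nc_ge0 (f y - f x); have p2 := nc_ge0 (g y - g x).
have q1 : nc (f y - f x) * nc (g y - g x) <= e1 * 1.
  apply: ler_pM => //; exact: le_trans h1.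
have q2 : nc (f y - f x) * nc (g x) <= e1 * nc (g x) by apply: ler_wpM2r.
have q3 : nc (f x) * nc (g y - g x) <= nc (f x) * e1 by apply: ler_wpM2l.
lra.
Qed.

Lemma rcont_sum I (r : seq I) (u : I -> R -> C) :
  (forall i, rcont (u i)) -> rcont (fun t => \sum_(i <- r) u i t).
Proof.
move=> H; elim: r => [|i r IH].
  by under eq_fun do rewrite big_nil; exact: rcont_cst.
by under eq_fun do rewrite big_cons; apply: rcontD.
Qed.

Lemma rint_cst c a b : rint (fun=> c) a b = (b - a)%:C * c.
Proof.
rewrite (@rint_prim (fun t : R => t%:C * c)); first by rewrite rmorphB /=; ring.
move=> x e e0; exists 1 => // h _.
rewrite rmorphD /=.
have -> : (x%:C + h%:C) * c - x%:C * c - h%:C * c = 0 by ring.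
by rewrite nc0 mulr_ge0 // ltW.
Qed.

Lemma rintB f g a b : rcont f -> rcont g ->
  rint (fun t => f t - g t) a b = rint f a b - rint g a b.
Proof.
move=> cf cg; rewrite (_ : (fun t => _) = (fun t => f t + (-1) * g t)).
  rewrite rintD // ?rintZ ?mulN1r //.
  by apply: rcontM => //; exact: rcont_cst.
by apply/funext => z; rewrite mulN1r.
Qed.

Lemma rcontB f g : rcont f -> rcont g -> rcont (fun t => f t - g t).
Proof.
move=> cf cg; rewrite (_ : (fun t => _) = (fun t => f t + (-1) * g t)).
  by apply: rcontD => //; apply: rcontM => //; exact: rcont_cst.
by apply/funext => z; rewrite mulN1r.
Qed.

Lemma rint_sum I (r : seq I) (u : I -> R -> C) a b :
  (forall i, rcont (u i)) ->
  rint (fun t => \sum_(i <- r) u i t) a b = \sum_(i <- r) rint (u i) a b.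
Proof.
move=> H; elim: r => [|i r IH].
  rewrite big_nil; under eq_fun do rewrite big_nil.
  by rewrite rint_cst mulr0.
rewrite big_cons; under eq_fun do rewrite big_cons.
by rewrite rintD ?IH //; exact: rcont_sum.
Qed.

End Primitive.

(** * Goursat's theorem on rectangles *)

Section Goursat.
Variable R : realType.
Local Notation C := R[i].
Implicit Types (a b c d : R) (H : R -> R -> C).

Lemma rint_affine (p q : C) a b :
  rint (fun t => p + t%:C * q) a b = (b - a)%:C * p + ((b ^+ 2 - a ^+ 2) / 2)%:C * q.
Proof.
rewrite (@rint_prim _ (fun t : R => t%:C * p + (t ^+ 2 / 2)%:C * q)).
  by rewrite mulrBl !rmorphB /=; ring.
move=> x e e0; have k0 : 0 < nc q + 1 by have := nc_ge0 q; lra.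
exists (e / (nc q + 1)); first exact: divr_gt0.
move=> h hd.
have -> : (x + h)%:C * p + ((x + h) ^+ 2 / 2)%:C * q -
    (x%:C * p + (x ^+ 2 / 2)%:C * q) - h%:C * (p + x%:C * q) =
    (h ^+ 2 / 2)%:C * q.
  have -> : (x + h) ^+ 2 / 2 = x ^+ 2 / 2 + x * h + h ^+ 2 / 2 by field.
  by rewrite !rmorphD rmorphM /=; ring.
rewrite ncMr normrM [`|2^-1|]ger0_norm ?invr_ge0 // normrX expr2.
move: hd; rewrite ltr_pdivlMr // => hd.
have := nc_ge0 q; have := normr_ge0 h => p1 p2.
have : `|h| * nc q <= e by apply: le_trans (ltW hd); rewrite ler_wpM2l // lerDl.
move=> /(ler_wpM2l p1); nra.
Qed.

(** The integral of [H u t] against du + i dt along the boundary of [a, b] x [c, d],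
    counterclockwise. *)
Definition boundary H a b c d : C :=
  rint (H^~ c) a b + 'i%C * rint (H b) c d - rint (H^~ d) a b - 'i%C * rint (H a) c d.

Lemma boundary_splitl H m a b c d :
  boundary H a b c d = boundary H a m c d + boundary H m b c d.
Proof.
rewrite /boundary (rint_cat _ a m b) (rint_cat (H^~ d) a m b); ring.
Qed.

Lemma boundary_splitr H m a b c d :
  boundary H a b c d = boundary H a b c m + boundary H a b m d.
Proof.
rewrite /boundary (rint_cat (H b) c m d) (rint_cat (H a) c m d); ring.
Qed.

Lemma rcont_affine (p q : C) : rcont (fun t : R => p + t%:C * q).
Proof.
apply: rcontD; first exact: rcont_cst.
apply: rcontM; last exact: rcont_cst.
move=> x e e0; exists e => // y yx.
by rewrite -rmorphB nc_real ltW.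
Qed.

Lemma boundary_affine (p q : C) a b c d :
  boundary (fun u t => p + (u +i* t) * q) a b c d = 0.
Proof.
have E (u t : R) : u +i* t = u%:C + 'i%C * t%:C by rewrite (complexE (u +i* t)).
have E1 (t : R) : (fun u => p + (u +i* t) * q) =
    (fun u => (p + 'i%C * t%:C * q) + u%:C * q).
  by apply/funext => u; rewrite E; ring.
have E2 (u : R) : (fun t => p + (u +i* t) * q) =
    (fun t => (p + u%:C * q) + t%:C * ('i%C * q)).
  by apply/funext => t; rewrite E; ring.
rewrite /boundary !E1 !E2 !rint_affine.
rewrite (rmorphB _ b a) (rmorphB _ d c) /=; ring.
Qed.

(** The bound is [e] times the perimeter. In [goursat], [G] is the affine approximation of [H],
    whose boundary integral vanishes. *)
Lemma boundary_ext_le H G a b c d (e : R) :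
  (forall t, rcont (H^~ t)) -> (forall u, rcont (H u)) ->
  (forall t, rcont (G^~ t)) -> (forall u, rcont (G u)) ->
  a <= b -> c <= d ->
  (forall u t, a <= u <= b -> c <= t <= d -> nc (H u t - G u t) <= e) ->
  nc (boundary H a b c d - boundary G a b c d) <=
  2 * e * ((b - a) + (d - c)).
Proof.
move=> h1 h2 g1 g2 ab cd E.
have lin (f g : R -> C) x y : rcont f -> rcont g ->
    rint f x y - rint g x y = rint (fun t => f t + (-1) * g t) x y.
  move=> cf cg; rewrite rintD // ?rintZ // ?mulN1r //.
  by apply: rcontM => //; exact: rcont_cst.
have bnd (f g : R -> C) x y : rcont f -> rcont g -> x <= y ->
   (forall t, x <= t <= y -> nc (f t - g t) <= e) ->
   nc (rint f x y - rint g x y) <= e * (y - x).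
  move=> cf cg xy h; rewrite lin //; apply: rint_le => //.
    by apply: rcontD => //; apply: rcontM => //; exact: rcont_cst.
  by move=> t /h; rewrite mulN1r.
have -> : boundary H a b c d - boundary G a b c d =
    (rint (H^~ c) a b - rint (G^~ c) a b) +
    ('i%C * (rint (H b) c d - rint (G b) c d) -
    (rint (H^~ d) a b - rint (G^~ d) a b)) -
    'i%C * (rint (H a) c d - rint (G a) c d) by rewrite /boundary; ring.
apply: le_trans (ncB _ _) _.
have -> : 2 * e * (b - a + (d - c)) =
   e * (b - a) + (e * (d - c) + e * (b - a)) + e * (d - c) by ring.
have B x : nc ('i%C * x) = nc x.
  rewrite ncM -[RHS]mul1r; congr (_ * _).
  by rewrite /nc /= expr0n add0r expr1n sqrtr1.
apply: lerD.
  apply: le_trans (ncD _ _) _; apply: lerD.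
    by apply: bnd => // t tab; apply: E => //; rewrite lexx cd.
  apply: le_trans (ncB _ _) _; apply: lerD.
    by rewrite B; apply: bnd => // t tab; apply: E => //; rewrite lexx ab.
  by apply: bnd => // t tab; apply: E => //; rewrite lexx cd.
by rewrite B; apply: bnd => // t tab; apply: E => //; rewrite lexx ab.
Qed.

Lemma boundary_halving H a b c d : a <= b -> c <= d ->
  exists q : (R * R) * (R * R),
  [/\ a <= q.1.1, q.1.1 <= q.1.2 & q.1.2 <= b] /\
  [/\ c <= q.2.1, q.2.1 <= q.2.2 & q.2.2 <= d] /\
  [/\ q.1.2 - q.1.1 = (b - a) / 2, q.2.2 - q.2.1 = (d - c) / 2 &
   nc (boundary H a b c d) <= 4 * nc (boundary H q.1.1 q.1.2 q.2.1 q.2.2)].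
Proof.
move=> ab cd; set m := (a + b) / 2; set n := (c + d) / 2.
pose B := boundary H.
have E : B a b c d = B a m c n + B a m n d + (B m b c n + B m b n d).
  by rewrite /B (boundary_splitl H m) (boundary_splitr H n a m)
    (boundary_splitr H n m b).
pose P (q : (R * R) * (R * R)) :=
  nc (B a b c d) <= 4 * nc (B q.1.1 q.1.2 q.2.1 q.2.2).
have : P ((a, m), (c, n)) \/ P ((a, m), (n, d)) \/ P ((m, b), (c, n)) \/
       P ((m, b), (n, d)).
  have := ncD (B a m c n + B a m n d) (B m b c n + B m b n d).
  rewrite -E; have := ncD (B a m c n) (B a m n d).
  have := ncD (B m b c n) (B m b n d).
  rewrite /P /=.
  have [?|h1] := leP (nc (B a b c d)) (4 * nc (B a m c n)); first by left.
  have [?|h2] := leP (nc (B a b c d)) (4 * nc (B a m n d)); first by right; left.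
  have [?|h3] := leP (nc (B a b c d)) (4 * nc (B m b c n)); first by do 2 right; left.
  have [?|h4] := leP (nc (B a b c d)) (4 * nc (B m b n d)); first by do 3 right.
  lra.
case=> [h|[h|[h|h]]].
- exists ((a, m), (c, n)); rewrite /=; split; [|split]; split => //; rewrite /m /n; lra.
- exists ((a, m), (n, d)); rewrite /=; split; [|split]; split => //; rewrite /m /n; lra.
- exists ((m, b), (c, n)); rewrite /=; split; [|split]; split => //; rewrite /m /n; lra.
- exists ((m, b), (n, d)); rewrite /=; split; [|split]; split => //; rewrite /m /n; lra.
Qed.

Lemma nested_intervals (u v : nat -> R) : {homo u : n m / (n <= m)%N >-> n <= m} ->
  {homo v : n m / (n <= m)%N >-> m <= n} -> (forall n, u n <= v n) ->
  exists x, forall n, u n <= x <= v n.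
Proof.
move=> hu hv uv.
have uv' n m : u n <= v m.
  case/orP: (leq_total n m) => nm; first exact: le_trans (hu _ _ nm) (uv m).
  exact: le_trans (uv n) (hv _ _ nm).
have hs : has_sup (range u).
  split; first by exists (u 0%N); exists 0%N.
  by exists (v 0%N) => _ [n _ <-].
exists (sup (range u)) => n; apply/andP; split.
  by apply: ub_le_sup; [case: hs | exists n].
by apply: ge_sup; [case: hs | move=> _ [m _ <-]].
Qed.

(** After n halvings the integral has shrunk by 4^n at most, while on a rectangle of side sum L /
    2^n the deviation from the affine approximation at the limit point contributes only o(L^2 /
    4^n). Continuity is asked on full lines, to give [rint] a meaning; differentiability is relative
    to the rectangle. *)
Lemma goursat H a b c d : a <= b -> c <= d ->
  (forall t, rcont (H^~ t)) -> (forall u, rcont (H u)) ->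
  (forall u t, a <= u <= b -> c <= t <= d -> exists l : C,
     forall e : R, 0 < e -> exists2 r : R, 0 < r &
     forall u' t', a <= u' <= b -> c <= t' <= d -> `|u' - u| < r -> `|t' - t| < r ->
     nc (H u' t' - H u t - ((u' - u) +i* (t' - t)) * l) <=
       e * (`|u' - u| + `|t' - t|)) ->
  boundary H a b c d = 0.
Proof.
move=> ab cd h1 h2 hd.
pose N (q : (R * R) * (R * R)) := nc (boundary H q.1.1 q.1.2 q.2.1 q.2.2).
pose ok (q : (R * R) * (R * R)) := q.1.1 <= q.1.2 /\ q.2.1 <= q.2.2.
have /choice[f Hf] : forall q, exists q' : (R * R) * (R * R), ok q ->
    [/\ q.1.1 <= q'.1.1, q'.1.1 <= q'.1.2 & q'.1.2 <= q.1.2] /\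
    [/\ q.2.1 <= q'.2.1, q'.2.1 <= q'.2.2 & q'.2.2 <= q.2.2] /\
    [/\ q'.1.2 - q'.1.1 = (q.1.2 - q.1.1) / 2,
        q'.2.2 - q'.2.1 = (q.2.2 - q.2.1) / 2 & N q <= 4 * N q'].
  move=> q; have [[q1 q2]|nq] := pselect (ok q); last by exists q.
  by have [q' Hq'] := boundary_halving H q1 q2; exists q'.
pose s n := iter n f ((a, b), (c, d)).
have sok n : ok (s n).
  by elim: n => [|n /Hf[[_ ? _] [[_ ? _] _]]].
have sS n := Hf _ (sok n).
have mon1 : {homo (fun n => (s n).1.1) : n m / (n <= m)%N >-> n <= m}.
  apply: (homo_leq (@lexx _ R)) => [y x z|n]; first exact: le_trans.
  by have [[]] := sS n.
have mon2 : {homo (fun n => (s n).1.2) : n m / (n <= m)%N >-> m <= n}.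
  apply: (homo_leq (@lexx _ R)) => [y x z h k|n]; first exact: le_trans k h.
  by have [[]] := sS n.
have mon3 : {homo (fun n => (s n).2.1) : n m / (n <= m)%N >-> n <= m}.
  apply: (homo_leq (@lexx _ R)) => [y x z|n]; first exact: le_trans.
  by have [_ [[]]] := sS n.
have mon4 : {homo (fun n => (s n).2.2) : n m / (n <= m)%N >-> m <= n}.
  apply: (homo_leq (@lexx _ R)) => [y x z h k|n]; first exact: le_trans k h.
  by have [_ [[]]] := sS n.
have [u Hu] := nested_intervals mon1 mon2 (fun n => (sok n).1).
have [t Ht] := nested_intervals mon3 mon4 (fun n => (sok n).2).
have W n : (s n).1.2 - (s n).1.1 = (b - a) / 2 ^+ n /\
    (s n).2.2 - (s n).2.1 = (d - c) / 2 ^+ n /\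
    nc (boundary H a b c d) <= 4 ^+ n * N (s n).
  elim: n => [|n [w1 [w2 w3]]]; first by rewrite !expr0 !divr1 mul1r.
  have [_ [_ [v1 v2 v3]]] := sS n.
  change (f (s n)) with (s n.+1) in v1, v2, v3.
  rewrite v1 v2 w1 w2 !exprS; split; [|split].
  - by rewrite invfM mulrA mulrAC.
  - by rewrite invfM mulrA mulrAC.
  - apply: le_trans w3 _; rewrite (mulrC 4) -mulrA ler_wpM2l //.
set K := nc (boundary H a b c d) in W *.
apply/eqP; rewrite -nc_eq0 -/K; apply: contraT => K0.
have {K0}Kp : 0 < K by rewrite lt_neqAle eq_sym K0 nc_ge0.
set L := (b - a) + (d - c).
have L0 : 0 <= L by rewrite /L; lra.
(* Makes 2 e L^2 strictly smaller than [K]; the summand 4 covers [L = 0]. *)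
pose e := K / (4 * L ^+ 2 + 4).
have L2 := sqr_ge0 L.
have e0 : 0 < e by rewrite /e divr_gt0 //; lra.
have [l Hl] := hd u t (Hu 0%N) (Ht 0%N).
have [r r0 Hr] := Hl e e0.
have [n Hn] : exists n, L / 2 ^+ n < r.
  exists (Num.truncn (L / r)).+1.
  rewrite ltr_pdivrMr ?exprn_gt0 // mulrC -ltr_pdivrMr //.
  apply: lt_trans (truncnS_gt _) _.
  by rewrite -natrX ltr_nat ltn_expl.
have [w1 [w2 w3]] := W n.
have [a1 a2] := andP (Hu n); have [c1 c2] := andP (Ht n).
have A := mon1 0%N n (leq0n n); have B := mon2 0%N n (leq0n n).
have Cc := mon3 0%N n (leq0n n); have D := mon4 0%N n (leq0n n).
rewrite /= in A B Cc D.
have [s1 s2] := sok n.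
pose p := H u t - (u +i* t) * l.
have := @boundary_ext_le H (fun x y => p + (x +i* y) * l) (s n).1.1 (s n).1.2
  (s n).2.1 (s n).2.2 (e * (L / 2 ^+ n)) h1 h2 _ _ s1 s2 _.
rewrite boundary_affine subr0 w1 w2 -mulrDl -/L => bb.
have {bb}bb : N (s n) <= 2 * (e * (L / 2 ^+ n)) * (L / 2 ^+ n).
  have E (x y : R) : x +i* y = x%:C + 'i%C * y%:C by rewrite (complexE (x +i* y)).
  apply: bb => [y|x|x y /andP[x1 x2] /andP[y1 y2]].
  - rewrite (_ : (fun x => _) = (fun x => (p + 'i%C * y%:C * l) + x%:C * l)).
      exact: rcont_affine.
    by apply/funext => x; rewrite E; ring.
  - rewrite (_ : (fun y => _) = (fun y => (p + x%:C * l) + y%:C * ('i%C * l))).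
      exact: rcont_affine.
    by apply/funext => y; rewrite E; ring.
  have S : `|x - u| + `|y - t| <= L / 2 ^+ n.
    rewrite /L mulrDl -w1 -w2.
    by clear -a1 a2 c1 c2 x1 x2 y1 y2; apply: lerD; rewrite ler_norml; lra.
  have := Hr x y; rewrite (_ : H x y - H u t - _ = H x y - (p + (x +i* y) * l)).
    move=> h; apply: le_trans (ler_wpM2l (ltW e0) S); apply: h.
    - by rewrite (le_trans A x1) (le_trans x2 B).
    - by rewrite (le_trans Cc y1) (le_trans y2 D).
    - by apply: le_lt_trans Hn; apply: le_trans S; rewrite lerDl.
    - by apply: le_lt_trans Hn; apply: le_trans S; rewrite lerDr.
  have -> : (x - u) +i* (y - t) = (x +i* y) - (u +i* t) by [].
  by rewrite /p; ring.
have : K <= 2 * e * L ^+ 2.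
  apply: le_trans w3 _.
  have p4 : 0 < 2 ^+ n :> R by rewrite exprn_gt0.
  have -> : 4 ^+ n = 2 ^+ n * 2 ^+ n :> R by rewrite -exprMn; congr (_ ^+ _); ring.
  apply: le_trans (ler_wpM2l _ bb) _; first by rewrite mulr_ge0 // ltW.
  rewrite le_eqVlt; apply/orP; left; apply/eqP; field.
  by rewrite gt_eqF.
have -> : 2 * e * L ^+ 2 = K * (2 * L ^+ 2 / (4 * L ^+ 2 + 4)).
  by rewrite /e; field; rewrite gt_eqF //; clear -L2; lra.
have M0 : 0 < 4 * L ^+ 2 + 4 by clear -L2; lra.
rewrite ler_pMr // ler_pdivlMr // mul1r; clear -L2; lra.
Qed.

End Goursat.

(** * Complex derivatives *)

Section ComplexDerivative.
Variable R : realType.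
Local Notation C := R[i].
Implicit Types (f g : C -> C) (z w h l m : C).

Definition ccont g z := forall e : R, 0 < e ->
  exists2 d : R, 0 < d & forall w, nc (w - z) < d -> nc (g w - g z) <= e.

Definition cder g z l := forall e : R, 0 < e ->
  exists2 d : R, 0 < d &
  forall h, nc h < d -> nc (g (z + h) - g z - h * l) <= e * nc h.

Definition cdiff g z := exists l, cder g z l.

Lemma cder_ext f g z l (r : R) : 0 < r ->
  (forall w, nc (w - z) < r -> f w = g w) -> cder f z l -> cder g z l.
Proof.
move=> r0 E H e e0; have [d d0 Hd] := H e e0.
exists (Num.min d r); first by rewrite lt_min d0.
move=> h; rewrite lt_min => /andP[hd hr].
rewrite -(E (z + h)); last by rewrite (addrC z) addrK.
by rewrite -(E z) ?subrr ?nc0 //; apply: Hd.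
Qed.

Lemma cder_cont g z l : cder g z l -> ccont g z.
Proof.
move=> H e e0; have [d d0 Hd] := H 1 ltr01.
have k0 : 0 < 1 + nc l by have := nc_ge0 l; lra.
exists (Num.min d (e / (1 + nc l))); first by rewrite lt_min d0 divr_gt0.
move=> w; rewrite lt_min => /andP[/Hd]; rewrite (addrC z) subrK => h1 h2.
have -> : g w - g z = (g w - g z - (w - z) * l) + (w - z) * l by ring.
apply: le_trans (ncD _ _) _; rewrite ncM.
rewrite ltr_pdivlMr // in h2; nra.
Qed.

Lemma cdiff_cont g z : cdiff g z -> ccont g z.
Proof. by case=> l /cder_cont. Qed.

Lemma cder_cst c z : cder (fun=> c) z 0.
Proof.
move=> e e0; exists 1 => // h _.
by rewrite mulr0 subr0 subrr nc0 mulr_ge0 ?nc_ge0 // ltW.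
Qed.

Lemma cder_id z : cder id z 1.
Proof.
move=> e e0; exists 1 => // h _.
have -> : z + h - z - h * 1 = 0 by ring.
by rewrite nc0 mulr_ge0 ?nc_ge0 // ltW.
Qed.

Lemma cderD f g z l m : cder f z l -> cder g z m ->
  cder (fun t => f t + g t) z (l + m).
Proof.
move=> H1 H2 e e0; have e2 : 0 < e / 2 by lra.
have [d1 d10 Hd1] := H1 _ e2; have [d2 d20 Hd2] := H2 _ e2.
exists (Num.min d1 d2); first by rewrite lt_min d10.
move=> h; rewrite lt_min => /andP[/Hd1 k1 /Hd2 k2].
have -> : f (z + h) + g (z + h) - (f z + g z) - h * (l + m) =
  (f (z + h) - f z - h * l) + (g (z + h) - g z - h * m) by ring.
apply: le_trans (ncD _ _) _.
have -> : e * nc h = e / 2 * nc h + e / 2 * nc h by field.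
exact: lerD.
Qed.

Lemma cderM f g z l m : cder f z l -> cder g z m ->
  cder (fun t => f t * g t) z (l * g z + f z * m).
Proof.
move=> H1 H2 e e0.
have pf := nc_ge0 (f z); have pg := nc_ge0 (g z); have pl := nc_ge0 l.
pose k := nc (f z) + nc (g z) + nc l + 1; have k0 : 0 < k by rewrite /k; lra.
pose e1 := Num.min 1 (e / k).
have e10 : 0 < e1 by rewrite lt_min ltr01 divr_gt0.
have e1k : e1 * k <= e.
  by rewrite -ler_pdivlMr // /e1 ge_min lexx orbT.
have [d1 d10 Hd1] := H1 _ e10; have [d2 d20 Hd2] := H2 _ e10.
have [d3 d30 Hd3] := cder_cont H2 e10.
exists (Num.min (Num.min d1 d2) d3); first by rewrite !lt_min d10 d20.
move=> h; rewrite !lt_min => /andP[/andP[/Hd1 k1 /Hd2 k2] hd].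
have {Hd3 hd}k3 : nc (g (z + h) - g z) <= e1 by apply: Hd3; rewrite addrAC subrr add0r.
have -> : f (z + h) * g (z + h) - f z * g z - h * (l * g z + f z * m) =
  (f (z + h) - f z - h * l) * (g (z + h) - g z) +
  ((f (z + h) - f z - h * l) * g z + h * l * (g (z + h) - g z) +
  f z * (g (z + h) - g z - h * m)) by ring.
have ph := nc_ge0 h.
have h1 : e1 <= 1 by rewrite /e1 ge_min lexx.
apply: le_trans (ncD _ _) _; apply: le_trans (lerD (lexx _) (ncD _ _)) _.
apply: le_trans (lerD (lexx _) (lerD (ncD _ _) (lexx _))) _; rewrite !ncM.
set x := nc (f _ - f z - _) in k1 *; set y := nc (g _ - g z) in k3 *.
set y' := nc (g _ - g z - _) in k2 *.
have px : 0 <= x by exact: nc_ge0.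
have py : 0 <= y by exact: nc_ge0.
have q1 : x * y <= e1 * nc h * 1 by apply: ler_pM => //; exact: le_trans h1.
have q2 : x * nc (g z) <= e1 * nc h * nc (g z) by apply: ler_wpM2r.
have q3 : nc h * nc l * y <= nc h * nc l * e1.
  by apply: ler_wpM2l => //; apply: mulr_ge0.
have q4 : nc (f z) * y' <= nc (f z) * (e1 * nc h) by apply: ler_wpM2l.
have := ler_wpM2r ph e1k; rewrite /k.
clear -q1 q2 q3 q4; lra.
Qed.

Lemma cder_comp f g z l m : cder f z l -> cder g (f z) m ->
  cder (fun t => g (f t)) z (l * m).
Proof.
move=> H1 H2 e e0.
have pl := nc_ge0 l; have pm := nc_ge0 m.
pose e1 := e / (2 * (nc l + 1)); pose e2 := Num.min 1 (e / (2 * (nc m + 1))).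
have e10 : 0 < e1 by rewrite divr_gt0 //; lra.
have e20 : 0 < e2 by rewrite lt_min ltr01 divr_gt0 //; lra.
have [d1 d10 Hd1] := H2 _ e10; have [d2 d20 Hd2] := H1 _ e20.
exists (Num.min d2 (d1 / (nc l + 1))); first by rewrite lt_min d20 divr_gt0 //; lra.
move=> h; rewrite lt_min ltr_pdivlMr; last by lra.
move=> /andP[/Hd2 k1 k2]; have ph := nc_ge0 h.
pose k := f (z + h) - f z.
have e21 : e2 <= 1 by rewrite /e2 ge_min lexx.
have kb : nc k <= nc h * (nc l + 1).
  have -> : k = (f (z + h) - f z - h * l) + h * l by rewrite /k; ring.
  apply: le_trans (ncD _ _) _; rewrite ncM mulrDr mulr1 addrC lerD2l.
  by apply: le_trans k1 _; rewrite ler_piMl.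
have -> : g (f (z + h)) - g (f z) - h * (l * m) =
  (g (f z + k) - g (f z) - k * m) + (f (z + h) - f z - h * l) * m.
  by rewrite /k (addrC (f z)) subrK; ring.
apply: le_trans (ncD _ _) _; rewrite ncM.
have q1 := Hd1 k (le_lt_trans kb k2).
have q2 : e1 * nc k <= e / 2 * nc h.
  apply: le_trans (ler_wpM2l (ltW e10) kb) _.
  rewrite le_eqVlt; apply/orP; left; apply/eqP; rewrite /e1; field.
  by rewrite gt_eqF //; lra.
have q3 : e2 * nc m <= e / 2.
  apply: le_trans (_ : e / (2 * (nc m + 1)) * nc m <= _).
    by apply: ler_wpM2r => //; rewrite /e2 ge_min lexx orbT.
  rewrite mulrAC ler_pdivrMr; last by lra.
  clear -pm e0; nra.
have q4 := ler_wpM2r pm k1; have := ler_wpM2r ph q3.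
clear -q1 q2 q4; lra.
Qed.

Lemma cderV z : z != 0 -> cder (fun t => t^-1) z (- z ^- 2).
Proof.
move=> z0 e e0; have pz : 0 < nc z by rewrite nc_gt0.
exists (Num.min (nc z / 2) (e * nc z ^+ 3 / 2)).
  by rewrite lt_min !divr_gt0 // mulr_gt0 // exprn_gt0.
move=> h; rewrite lt_min => /andP[h1 h2].
have zh : nc z / 2 <= nc (z + h).
  have := ncBl z (- h); rewrite opprK ncN; clear -h1; lra.
have zh0 : z + h != 0 by rewrite -nc_gt0; apply: lt_le_trans zh; lra.
have -> : (z + h)^-1 - z^-1 - h * - z ^- 2 = h * (h / (z ^+ 2 * (z + h))).
  by field; rewrite z0 zh0.
rewrite ncM mulrC ler_wpM2r ?nc_ge0 // ncM ncV ncM ncX.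
rewrite ler_pdivrMr; last by rewrite mulr_gt0 ?exprn_gt0 ?nc_gt0.
apply: le_trans (ltW h2) _.
have -> : e * nc z ^+ 3 / 2 = e * (nc z ^+ 2 * (nc z / 2)) by field.
by rewrite !ler_wpM2l ?exprn_ge0 ?nc_ge0 // ltW.
Qed.

Lemma cder_uniq f z l m : cder f z l -> cder f z m -> l = m.
Proof.
move=> H1 H2; apply/eqP; rewrite -subr_eq0; apply/eqP/le0_nc_eq => e e0.
have e2 : 0 < e / 2 by lra.
have [d1 d10 Hd1] := H1 _ e2; have [d2 d20 Hd2] := H2 _ e2.
pose t := Num.min d1 d2 / 2.
have t0 : 0 < t by rewrite divr_gt0 // lt_min d10.
have nt : nc t%:C = t by rewrite nc_real gtr0_norm.
have tm : t < Num.min d1 d2 by rewrite /t ltr_pdivrMr // ltr_pMr ?ltr1n // lt_min d10.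
have := Hd1 t%:C; have := Hd2 t%:C; move: tm; rewrite nt lt_min => /andP[t1 t2].
move=> /(_ t2) k2 /(_ t1) k1; rewrite -(ler_pM2l t0) -{1}nt -ncM.
have -> : t%:C * (l - m) = (f (z + t%:C) - f z - t%:C * m) -
  (f (z + t%:C) - f z - t%:C * l) by ring.
apply: le_trans (ncB _ _) _; clear -k1 k2; lra.
Qed.

Lemma cderZ c f z l : cder f z l -> cder (fun t => c * f t) z (c * l).
Proof.
move=> H; have := cderM (cder_cst c z) H.
by rewrite mul0r add0r.
Qed.

Lemma cder_sum I (r : seq I) (u : I -> C -> C) (l : I -> C) z :
  (forall i, cder (u i) z (l i)) ->
  cder (fun t => \sum_(i <- r) u i t) z (\sum_(i <- r) l i).
Proof.
move=> H; elim: r => [|i r IH].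
  by rewrite big_nil; under eq_fun do rewrite big_nil; exact: cder_cst.
by rewrite big_cons; under eq_fun do rewrite big_cons; exact: cderD (H i) IH.
Qed.

Lemma cderX z n : cder (fun t => t ^+ n) z (n%:R * z ^+ n.-1).
Proof.
elim: n => [|n IH].
  rewrite mul0r; under eq_fun do rewrite expr0; exact: cder_cst.
have := cderM (cder_id z) IH.
rewrite [X in cder _ _ X](_ : _ = n.+1%:R * z ^+ n).
  by under eq_fun do rewrite -exprS.
rewrite mul1r -[in RHS]addn1 natrD mulrDl mul1r addrC; congr (_ + _).
by case: n {IH} => [|n]; rewrite ?mul0r ?mulr0 // exprS; ring.
Qed.

Lemma cdiff_cst c z : cdiff (fun=> c) z.
Proof. by exists 0; exact: cder_cst. Qed.

Lemma cdiff_id z : cdiff id z.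
Proof. by exists 1; exact: cder_id. Qed.

Lemma cdiffD f g z : cdiff f z -> cdiff g z -> cdiff (fun t => f t + g t) z.
Proof. by case=> l H [m K]; exists (l + m); exact: cderD. Qed.

Lemma cdiffM f g z : cdiff f z -> cdiff g z -> cdiff (fun t => f t * g t) z.
Proof. by case=> l H [m K]; eexists; exact: cderM H K. Qed.

Lemma cdiffB f g z : cdiff f z -> cdiff g z -> cdiff (fun t => f t - g t) z.
Proof.
move=> H K; have := cdiffD H (cdiffM (cdiff_cst (-1) z) K).
by under eq_fun do rewrite mulN1r.
Qed.

Lemma cdiffX g z n : cdiff g z -> cdiff (fun t => g t ^+ n) z.
Proof.
by case=> l H; eexists; exact: cder_comp H (cderX (g z) n).
Qed.

Lemma cdiffV g z : g z != 0 -> cdiff g z -> cdiff (fun t => (g t)^-1) z.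
Proof. by move=> gz [l H]; eexists; exact: cder_comp H (cderV gz). Qed.

Lemma cdiff_sum I (r : seq I) (u : I -> C -> C) z :
  (forall i, cdiff (u i) z) -> cdiff (fun t => \sum_(i <- r) u i t) z.
Proof.
move=> H; elim: r => [|i r IH].
  by under eq_fun do rewrite big_nil; exact: cdiff_cst.
by under eq_fun do rewrite big_cons; exact: cdiffD (H i) IH.
Qed.

Lemma cdiff_ext f g z (r : R) : 0 < r ->
  (forall w, nc (w - z) < r -> f w = g w) -> cdiff f z -> cdiff g z.
Proof. by move=> r0 E [l /(cder_ext r0 E)]; exists l. Qed.

End ComplexDerivative.

(** * Circle means, Cauchy's formula and power series *)

Section CircleMean.
Variable R : realType.
Local Notation C := R[i].
Implicit Types (f g : C -> C) (z w : C) (r t u : R).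

Definition cis t : C := cos t +i* sin t.

Lemma nc_cis t : nc (cis t) = 1.
Proof. by rewrite /nc /= cos2Dsin2 sqrtr1. Qed.

Lemma cis0 : cis 0 = 1.
Proof. by rewrite /cis cos0 sin0. Qed.

Lemma cis2pi : cis (2 * pi) = 1.
Proof. by rewrite /cis mulr_natl cos2pi sin2pi. Qed.

Lemma rder_cis t : rder cis t ('i%C * cis t).
Proof.
apply: rder_of_real; rewrite /=.
  by have := is_derive_cos t; rewrite mul0r mul1r sub0r.
by have := is_derive_sin t; rewrite mul0r mul1r add0r.
Qed.

Lemma nc_imul z : nc ('i%C * z) = nc z.
Proof.
rewrite ncM -[RHS]mul1r; congr (_ * _).
by rewrite /nc /= expr0n add0r expr1n sqrtr1.
Qed.

Lemma cis_lip t t' : nc (cis t' - cis t) <= `|t' - t|.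
Proof.
wlog tt : t t' / t <= t' => [hw|].
  by case/orP: (le_total t t') => /hw // h; rewrite ncC distrC.
have := rder_meanvalue (M := 1) tt rder_cis _.
rewrite mul1r ger0_norm ?subr_ge0 //; apply => x _.
by rewrite nc_imul nc_cis.
Qed.

Lemma rcont_cis : rcont cis.
Proof. exact: rder_cont rder_cis. Qed.

Lemma rcont_comp (p : R -> C) g : rcont p -> (forall x, ccont g (p x)) ->
  rcont (fun x => g (p x)).
Proof.
move=> cp cg x e e0; have [d d0 Hd] := cg x e e0.
have d2 : 0 < d / 2 by lra.
have [d' d'0 Hd'] := cp x _ d2; exists d' => // y /Hd' h.
by apply: Hd; apply: le_lt_trans h _; lra.
Qed.

Definition oncircle g r t := g (r%:C * cis t).

Lemma nc_circle r t : 0 <= r -> nc (r%:C * cis t) = r.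
Proof. by move=> r0; rewrite ncMr nc_cis mulr1 ger0_norm. Qed.

Lemma rcont_circle r : rcont (fun t => r%:C * cis t).
Proof. by apply: rcontM; [exact: rcont_cst | exact: rcont_cis]. Qed.

Lemma rcont_oncircle g r : 0 <= r -> (forall z, nc z = r -> ccont g z) ->
  rcont (oncircle g r).
Proof.
move=> r0 H; apply: (rcont_comp (rcont_circle r)) => t.
by apply: H; rewrite nc_circle.
Qed.

Definition cmean g r : C := (2 * pi)^-1%:C * rint (oncircle g r) 0 (2 * pi).

Lemma pi2_gt0 : 0 < 2 * pi :> R.
Proof. by rewrite mulr_gt0 // pi_gt0. Qed.

Lemma cmean_le g r (M : R) : rcont (oncircle g r) ->
  (forall t, nc (oncircle g r t) <= M) -> nc (cmean g r) <= M.
Proof.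
move=> cg H; rewrite ncMr ger0_norm ?invr_ge0 ?(ltW pi2_gt0) //.
rewrite mulrC ler_pdivrMr ?pi2_gt0 //.
have := rint_le (M := M) cg (ltW pi2_gt0); rewrite subr0; apply => x _; exact: H.
Qed.

Lemma cmean_cst c r : cmean (fun=> c) r = c.
Proof.
rewrite /cmean /oncircle rint_cst subr0 mulrA -rmorphM /= mulVf ?mul1r //.
by rewrite gt_eqF // pi2_gt0.
Qed.

Lemma cmeanD f g r : rcont (oncircle f r) -> rcont (oncircle g r) ->
  cmean (fun z => f z + g z) r = cmean f r + cmean g r.
Proof. by move=> cf cg; rewrite /cmean rintD // mulrDr. Qed.

Lemma cmeanZ c g r : rcont (oncircle g r) ->
  cmean (fun z => c * g z) r = c * cmean g r.
Proof. by move=> cg; rewrite /cmean rintZ // mulrCA. Qed.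

Lemma cmeanB f g r : rcont (oncircle f r) -> rcont (oncircle g r) ->
  cmean (fun z => f z - g z) r = cmean f r - cmean g r.
Proof.
move=> cf cg; rewrite (_ : (fun z => _) = (fun z => f z + (-1) * g z)).
  rewrite cmeanD // ?cmeanZ ?mulN1r //.
  by apply: rcontM => //; exact: rcont_cst.
by apply/funext => z; rewrite mulN1r.
Qed.

Lemma cmean_sum I (s : seq I) (u : I -> C -> C) r :
  (forall i, rcont (oncircle (u i) r)) ->
  cmean (fun z => \sum_(i <- s) u i z) r = \sum_(i <- s) cmean (u i) r.
Proof. by move=> H; rewrite /cmean rint_sum // mulr_sumr. Qed.

Lemma cmean_ext f g r : 0 <= r -> (forall z, nc z = r -> f z = g z) ->
  cmean f r = cmean g r.
Proof.
move=> r0 H; rewrite /cmean; congr (_ * rint _ _ _).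
by apply/funext => t; rewrite /oncircle H // nc_circle.
Qed.

(** exp (u + i t) is its own complex derivative. The remainder splits into a radial part (derivative
    of [expR]), an angular part (derivative of [cis]) and a mixed term, controlled by the Lipschitz
    bound for [cis]. *)
Lemma exp_polar_local u t (e : R) : 0 < e -> exists2 r : R, 0 < r &
  forall u' t', `|u' - u| < r -> `|t' - t| < r ->
  nc ((expR u')%:C * cis t' - (expR u)%:C * cis t -
     ((u' - u) +i* (t' - t)) * ((expR u)%:C * cis t)) <=
  e * (`|u' - u| + `|t' - t|).
Proof.
move=> e0; set k := expR u; have k0 : 0 < k by exact: expR_gt0.
pose e1 := e / 2; pose e2 := e / (2 * k).
have e10 : 0 < e1 by rewrite /e1; lra.
have e20 : 0 < e2 by rewrite /e2 divr_gt0 // mulr_gt0.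
have [r1 r10 H1] := (is_deriveP _ _ _).1 (is_derive_expR u) _ e10.
have [r2 r20 H2] := @rder_cis t _ e20.
exists (Num.min (Num.min r1 r2) e2); first by rewrite !lt_min r10 r20.
move=> u' t'; rewrite !lt_min => /andP[/andP[a1 _] _] /andP[/andP[_ b1] b2].
have -> : (u' - u) +i* (t' - t) = (u' - u)%:C + 'i%C * (t' - t)%:C.
  by rewrite (complexE (_ +i* _)).
set a := u' - u in a1 *; set b := t' - t in b1 b2 *.
have := H1 _ a1; have := H2 _ b1; rewrite (addrC u) (addrC t) !subrK -/k.
set E := _%:C * cis t'; move=> h2 h1.
have -> : E - k%:C * cis t - (a%:C + 'i%C * b%:C) * (k%:C * cis t) =
  (expR u' - k - a * k)%:C * cis t' +
  ((a * k)%:C * (cis t' - cis t) +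
   k%:C * (cis t' - cis t - b%:C * ('i%C * cis t))).
  by rewrite /E; clearbody a b k; rewrite !realcB !realcM; ring.
apply: le_trans (ncD _ _) _; apply: le_trans (lerD (lexx _) (ncD _ _)) _.
rewrite !ncMr nc_cis mulr1 normrM (gtr0_norm k0).
have q1 : `|a| * k * nc (cis t' - cis t) <= `|a| * k * e2.
  apply: ler_wpM2l; first by rewrite mulr_ge0 // ltW.
  by apply: le_trans (cis_lip _ _) (ltW b2).
have q2 : k * nc (cis t' - cis t - b%:C * ('i%C * cis t)) <= k * (e2 * `|b|).
  by apply: ler_wpM2l => //; exact: ltW.
have E2 : k * e2 = e / 2 by rewrite /e2; field; rewrite gt_eqF.
have E3 : `|a| * k * e2 = e / 2 * `|a| by rewrite -mulrA E2 mulrC.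
have E4 : k * (e2 * `|b|) = e / 2 * `|b| by rewrite mulrA E2.
rewrite E3 in q1; rewrite E4 in q2.
have p1 := normr_ge0 b; rewrite /e1 in h1.
have : 0 <= e / 2 * `|b| by rewrite mulr_ge0 // ltW.
clear -h1 q1 q2; lra.
Qed.

Lemma clamp_lip (a b x y : R) :
  `|Num.max a (Num.min b y) - Num.max a (Num.min b x)| <= `|y - x|.
Proof.
have norm_lip (s t : R) : s - t <= `|s - t| /\ t - s <= `|s - t|.
  by split; [exact: ler_norm | rewrite distrC ler_norm].
have max_lip s t : `|Num.max a s - Num.max a t| <= `|s - t|.
  have [h1 h2] := norm_lip s t; rewrite ler_norml.
  by case: (leP a s) => ?; case: (leP a t) => ?; apply/andP; split; lra.
apply: le_trans (max_lip _ _) _; have [h1 h2] := norm_lip y x; rewrite ler_norml.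
by case: (leP b y) => ?; case: (leP b x) => ?; apply/andP; split; lra.
Qed.

(* Goursat for [(u, t) |-> g (exp (u + i t))] on a rectangle of height [2 pi]: the
   two horizontal sides cancel by periodicity. *)
Lemma cmean_annulus g r1 r2 : 0 < r1 -> r1 <= r2 ->
  (forall z, r1 <= nc z <= r2 -> cdiff g z) -> cmean g r1 = cmean g r2.
Proof.
move=> r10 r12 H.
have r20 : 0 < r2 by exact: lt_le_trans r12.
have l12 : ln r1 <= ln r2 by rewrite ler_ln.
(* Clamping the logarithm of the radius extends the integrand continuously to all real [u], as
   [goursat] requires, without leaving the annulus. *)
pose cl u := Num.max (ln r1) (Num.min (ln r2) u).
pose G u t := (expR (cl u))%:C * cis t.
have Gb u t : r1 <= nc (G u t) <= r2.
  rewrite ncMr nc_cis mulr1 gtr0_norm ?expR_gt0 //.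
  rewrite -{1}(lnK r10) -{1}(lnK r20) !ler_expR /cl le_max lexx /=.
  by rewrite ge_max l12 ge_min lexx.
have Gc u t : ccont g (G u t) by apply/cdiff_cont/H.
have clE u : ln r1 <= u <= ln r2 -> cl u = u.
  by case/andP => h1 h2; rewrite /cl (min_idPr h2) (max_idPr h1).
have h2 u : rcont (fun t => g (G u t)).
  by apply: rcont_comp => //; apply: rcontM; [exact: rcont_cst | exact: rcont_cis].
have h1 t : rcont (fun u => g (G u t)).
  apply: rcont_comp => //; apply: rcontM; last exact: rcont_cst.
  have cle x y : `|cl y - cl x| <= `|y - x| by exact: clamp_lip.
  move=> x e e0.
  have [d d0 Hd] := (is_deriveP _ _ _).1 (is_derive_expR (cl x)) 1 ltr01.
  set k := expR (cl x); have k0 : 0 < k by exact: expR_gt0.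
  exists (Num.min d (e / (1 + k))).
    by rewrite lt_min d0 divr_gt0 // addr_gt0.
  move=> y; rewrite lt_min ltr_pdivlMr; last by rewrite addr_gt0.
  move=> /andP[y1 y2]; rewrite -realcB nc_real.
  have := Hd (cl y - cl x) (le_lt_trans (cle _ _) y1).
  rewrite (addrC (cl x)) subrK -/k mul1r => h.
  have -> : expR (cl y) - k =
    (expR (cl y) - k - (cl y - cl x) * k) + (cl y - cl x) * k by ring.
  apply: le_trans (ler_normD _ _) _; rewrite normrM (gtr0_norm k0).
  have := cle x y => h3.
  have := ler_wpM2r (ltW k0) h3; clear -y2 h h3; lra.
have E : boundary (fun u t => g (G u t)) (ln r1) (ln r2) 0 (2 * pi) = 0.
  apply: goursat => //; first exact: ltW pi2_gt0.
  move=> u t hu ht.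
  have [l Hl] : cdiff g (G u t) by apply: H.
  pose z := G u t.
  exists (z * l) => e e0.
  have pz := nc_ge0 z; have pl := nc_ge0 l.
  pose e2 := Num.min 1 (e / (2 * (nc l + 1))); pose e1 := e / (2 * (nc z + 1 + 1)).
  have e10 : 0 < e1 by rewrite divr_gt0 //; lra.
  have e20 : 0 < e2 by rewrite lt_min ltr01 divr_gt0 //; lra.
  have [d d0 Hd] := Hl _ e10.
  have [r r0 Hr] := exp_polar_local u t e20.
  exists (Num.min r (d / (2 * (nc z + 1 + 1)))); first by rewrite lt_min r0 divr_gt0 //; lra.
  move=> u' t' hu' ht'; rewrite !lt_min => /andP[a1 a2] /andP[b1 b2].
  have zE : z = (expR u)%:C * cis t by rewrite /z /G clE.
  have := Hr _ _ a1 b1; rewrite -zE.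
  have wE : G u' t' = (expR u')%:C * cis t' by rewrite /G clE.
  rewrite -wE; set w := G u' t'; set S := `|_| + _; set D := _ +i* _ => k1.
  have S0 : 0 <= S by rewrite addr_ge0.
  have DS : nc D <= S by exact: nc_le.
  have e21 : e2 <= 1 by rewrite /e2 ge_min lexx.
  have wz : nc (w - z) <= (nc z + 1) * S.
    have -> : w - z = (w - z - D * z) + D * z by ring.
    apply: le_trans (ncD _ _) _; rewrite ncM.
    have := ler_wpM2r pz DS; have := ler_wpM2r S0 e21; clear -k1; lra.
  have Sd : (nc z + 1) * S < d.
      have pz2 : 0 < 2 * (nc z + 1 + 1) by clear -pz; lra.
    move: a2 b2; rewrite !ltr_pdivlMr //.
    rewrite /S; have p1 := normr_ge0 (u' - u); have p2 := normr_ge0 (t' - t).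
    clear -pz p1 p2; nra.
  have := Hd (w - z) (le_lt_trans wz Sd); rewrite -/z (addrC z) subrK => k2.
  have -> : g w - g z - D * (z * l) = (g w - g z - (w - z) * l) + (w - z - D * z) * l.
    by ring.
  apply: le_trans (ncD _ _) _; rewrite ncM.
  have q1 : e1 * nc (w - z) <= e / 2 * S.
    apply: le_trans (ler_wpM2l (ltW e10) wz) _.
    rewrite mulrA ler_wpM2r // /e1 mulrAC ler_pdivrMr; last by clear -pz; lra.
    clear -e0 pz; nra.
  have q2 : e2 * nc l <= e / 2.
    apply: le_trans (_ : e / (2 * (nc l + 1)) * nc l <= _).
      by apply: ler_wpM2r => //; rewrite /e2 ge_min lexx orbT.
    rewrite mulrAC ler_pdivrMr; last by clear -pl; lra.
    clear -pl e0; nra.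
  have := ler_wpM2r pl k1; have := ler_wpM2r S0 q2.
  clear -q1 k2; lra.
have GE r : r1 <= r <= r2 -> (fun t => g (G (ln r) t)) = oncircle g r.
  move=> /andP[ra rb]; have r0 : 0 < r by exact: lt_le_trans ra.
  apply/funext => t; rewrite /oncircle /G clE; first by rewrite (lnK r0).
  by apply/andP; split; rewrite ler_ln.
have GP : (fun u => g (G u (2 * pi))) = (fun u => g (G u 0)).
  by apply/funext => u; rewrite /G cis0 cis2pi.
have F1 := congr1 (fun p => rint p 0 (2 * pi)) (GE r1 _).
have F2 := congr1 (fun p => rint p 0 (2 * pi)) (GE r2 _).
have F3 := congr1 (fun p => rint p (ln r1) (ln r2)) GP.
rewrite lexx r12 in F1; rewrite lexx r12 in F2.
move: E (F1 isT) (F2 isT) F3; rewrite /boundary /cmean.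
set X := rint _ _ _; set X' := rint _ 0 _; set Y := rint _ (ln r1) _.
set Y' := rint _ 0 _; set Y1 := rint (oncircle g r1) _ _.
set Y2 := rint (oncircle g r2) _ _ => E f1 f2 f3; congr (_ * _).
rewrite -f1 -f2; apply/eqP; rewrite eq_sym -subr_eq0 -nc_eq0 -nc_imul.
by apply/eqP; rewrite -[RHS](nc0 R) -E; congr nc; rewrite f3; ring.
Qed.

Lemma cmean_eq f g r : f =1 g -> cmean f r = cmean g r.
Proof. by move=> /funext ->. Qed.

(** The mean does not depend on the radius, so the circle may be shrunk to where [g] is close to
    [g 0]. Asking for continuity only at the centre makes this applicable to difference quotients
    filled in at their singular point. *)
Lemma cmean_center g r : 0 < r -> ccont g 0 ->
  (forall z, 0 < nc z <= r -> cdiff g z) -> cmean g r = g 0.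
Proof.
move=> r0 c0 H; apply/eqP; rewrite -subr_eq0; apply/eqP/le0_nc_eq => e e0.
have [d d0 Hd] := c0 e e0.
pose s := Num.min (d / 2) r.
have s0 : 0 < s by rewrite lt_min r0 divr_gt0.
have sr : s <= r by rewrite /s ge_min lexx orbT.
have sd : s < d by rewrite /s gt_min ltr_pdivrMr // ltr_pMr // ltr1n.
rewrite -(@cmean_annulus g s r) //; last first.
  by move=> z /andP[z1 z2]; apply: H; rewrite z2 andbT (lt_le_trans s0).
rewrite -(cmean_cst (g 0) s) -cmeanB; last exact: rcont_cst.
  apply: cmean_le.
    apply: rcontD; last exact: rcont_cst.
    apply: rcont_oncircle => [|z zs]; first exact: ltW.
    by apply/cdiff_cont/H; rewrite zs s0.
  by move=> t; apply: Hd; rewrite subr0 nc_circle // ltW.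
apply: rcont_oncircle => [|z zs]; first exact: ltW.
by apply/cdiff_cont/H; rewrite zs s0.
Qed.

(** Compactness of [0, 2 pi] makes continuity of [g] along the circle uniform in the angle, so the
    mean is continuous in the radius. It serves for the one circle through the singular point in
    [cauchy]. *)
Lemma cmean_lip g r (e : R) : 0 < r -> 0 < e ->
  (forall z, nc z = r -> ccont g z) -> rcont (oncircle g r) ->
  exists2 d : R, 0 < d & forall s, `|s - r| < d -> rcont (oncircle g s) ->
    nc (cmean g s - cmean g r) <= e.
Proof.
move=> r0 e0 Hc cg.
have cpt : compact `[0 : R, 2 * pi]%classic by exact: segment_compact.
have := cpt; rewrite compact_near_coveringP => /(_ R (nbhs r)
  (fun s t => nc (oncircle g s t - oncircle g r t) <= e) _) [].
  move=> t _; have e2 : 0 < e / 2 by lra.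
  have [d d0 Hd] := Hc (r%:C * cis t) (nc_circle t (ltW r0)) _ e2.
  pose d' := d / (2 * (r + 1)).
  have r1 : 0 < 2 * (r + 1) by lra.
  have d'0 : 0 < d' by rewrite divr_gt0.
  exists (ball t d', ball r d').
    by split; apply/nbhs_ballP; exists d'.
  case=> t' s /= [] /=; rewrite /ball /= => ht hs.
  rewrite distrC in ht; rewrite distrC in hs.
  have b1 : nc (s%:C * cis t' - r%:C * cis t) < d.
    have -> : s%:C * cis t' - r%:C * cis t =
      (s - r)%:C * cis t' + r%:C * (cis t' - cis t) by rewrite realcB; ring.
    apply: le_lt_trans (ncD _ _) _; rewrite !ncMr nc_cis mulr1 (gtr0_norm r0).
    apply: le_lt_trans (lerD (ltW hs) (ler_wpM2l (ltW r0) (le_trans (cis_lip _ _) (ltW ht)))) _.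
    have -> : d' + r * d' = d / 2 by rewrite /d'; field; rewrite gt_eqF //; lra.
    by lra.
  have b2 : nc (r%:C * cis t' - r%:C * cis t) < d.
    rewrite -mulrBr ncMr (gtr0_norm r0).
    apply: le_lt_trans (ler_wpM2l (ltW r0) (le_trans (cis_lip _ _) (ltW ht))) _.
    rewrite /d' mulrA ltr_pdivrMr //; clear -r0 d0; nra.
  apply: le_trans (ncD3 _ (oncircle g r t) _) _.
  have := Hd _ b1; have := Hd _ b2; rewrite /oncircle (ncC (g (r%:C * cis t'))).
  by clear; lra.
move=> d /= d0 Hd; exists d => // s sr cs.
rewrite /cmean -mulrBr -rintB // ncMr ger0_norm ?invr_ge0 ?(ltW pi2_gt0) //.
rewrite mulrC ler_pdivrMr ?pi2_gt0 //.
have := rint_le (M := e) (rcontB cs cg) (ltW pi2_gt0); rewrite subr0; apply => t ht.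
by apply: (Hd s _ t); rewrite /= ?in_itv //= distrC.
Qed.

(** Beyond the pole the mean does not depend on the radius, and the integrand tends to 0 as the
    radius grows. *)
Lemma cmean_invn z0 n r : nc z0 < r ->
  cmean (fun z => ((z - z0) ^+ n.+1)^-1) r = 0.
Proof.
move=> zr; have pz := nc_ge0 z0; have r0 : 0 < r by lra.
have dz z : r <= nc z -> z - z0 != 0.
  by move=> rz; rewrite -nc_gt0; have := ncBl z z0; lra.
have df z : r <= nc z -> cdiff (fun z => ((z - z0) ^+ n.+1)^-1) z.
  move=> rz; apply: cdiffV; first by rewrite expf_neq0 // dz.
  by apply: cdiffX; apply: cdiffB; [exact: cdiff_id | exact: cdiff_cst].
apply: le0_nc_eq => e e0.
(* On the circle of radius [s], |z - z0| is at least 1 + 1/e, so all its positive powers are at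
   least 1/e. *)
pose s := r + 1 + e^-1.
have ei : 0 < e^-1 by rewrite invr_gt0.
have rs : r <= s by rewrite /s; lra.
rewrite (@cmean_annulus _ r s) //; last by move=> z /andP[/df].
apply: cmean_le.
  apply: rcont_oncircle => [|z zs]; first by rewrite (le_trans (ltW r0)).
  by apply/cdiff_cont/df; rewrite zs.
move=> t; rewrite /oncircle ncV ncX.
set w := _ * cis t; have ws : nc w = s by rewrite nc_circle // (le_trans (ltW r0)).
have : 1 + e^-1 <= nc (w - z0) by have := ncBl w z0; rewrite ws /s; lra.
set x := nc _ => hx.
have x1 : 1 <= x by lra.
have xe : e^-1 <= x ^+ n.+1.
  apply: le_trans (_ : x <= _); first by lra.
  by rewrite exprS ler_peMr ?exprn_ege1 //; lra.
by rewrite -[leRHS]invrK lef_pV2 ?posrE // (lt_le_trans ei).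
Qed.

(** With [h] the continuous extension of z (g z - g a) / (z - a), the integrand is h + g(a) (1 + a /
    (z - a)). The second term has mean [g a] by [cmean_invn]. The mean of [h] is 0: on circles
    inside |a| it is h(0) = 0, and the value is carried across |a| by continuity in the radius. *)
Lemma cauchy g (T : R) a r : nc a < r -> r < T ->
  (forall z, nc z < T -> cdiff g z) ->
  cmean (fun z => z * g z / (z - a)) r = g a.
Proof.
move=> ar rT H.
have pa := nc_ge0 a; have r0 : 0 < r by lra.
have [l Hl] : cdiff g a by apply: H; apply: lt_trans rT.
have za z : nc z = r -> z - a != 0.
  by move=> zr; rewrite -nc_gt0; have := ncBl z a; lra.
pose h z := if z == a then a * l else z * (g z - g a) / (z - a).
have hd z : z != a -> nc z < T -> cdiff h z.
  move=> zna zT; have z0 : 0 < nc (z - a) by rewrite nc_gt0 subr_eq0.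
  apply: (@cdiff_ext _ (fun w => w * (g w - g a) / (w - a)) h z (nc (z - a))) => //.
    move=> w wz; rewrite /h; case: eqP => // E.
    by move: wz; rewrite E ncC ltxx.
  apply: cdiffM; last first.
    by apply: cdiffV; rewrite ?subr_eq0 //; apply: cdiffB; [exact: cdiff_id | exact: cdiff_cst].
  apply: cdiffM; first exact: cdiff_id.
  by apply: cdiffB; [exact: H | exact: cdiff_cst].
have ha : ccont h a.
  move=> e e0.
  pose e1 := e / (2 * (nc a + 1)); have e10 : 0 < e1 by rewrite divr_gt0 //; lra.
  have [d d0 Hd] := Hl _ e10.
  have pl := nc_ge0 l.
  exists (Num.min (Num.min d 1) (e / (2 * (nc l + 1)))).
    by rewrite !lt_min d0 ltr01 divr_gt0 //; lra.
  move=> w; rewrite !lt_min => /andP[/andP[w1 w2] w3].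
  have [->|wa] := eqVneq w a; first by rewrite subrr nc0 ltW.
  rewrite /h eqxx (negbTE wa).
  have wa0 : w - a != 0 by rewrite subr_eq0.
  have -> : w * (g w - g a) / (w - a) - a * l =
    w * ((g w - g a - (w - a) * l) / (w - a)) + (w - a) * l by field.
  apply: le_trans (ncD _ _) _; rewrite !ncM ncV.
  have := Hd _ w1; rewrite (addrC a) subrK => k.
  have p0 : 0 < nc (w - a) by rewrite nc_gt0.
  rewrite -ler_pdivrMr // in k.
  have wb : nc w <= nc a + 1 by have := ncBl w a; lra.
  have q1 : nc w * (nc (g w - g a - (w - a) * l) / nc (w - a)) <= (nc a + 1) * e1.
    by apply: ler_pM => //; rewrite ?nc_ge0 // divr_ge0 ?nc_ge0.
  have q2 : (nc a + 1) * e1 = e / 2 by rewrite /e1; field; rewrite gt_eqF //; lra.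
  have l2 : 0 < 2 * (nc l + 1) by lra.
  have q3 : nc (w - a) * nc l <= e / 2.
    move: w3; rewrite ltr_pdivlMr // => w3.
    by clear -w3 pl p0; nra.
  rewrite q2 in q1; clear -q1 q3; lra.
have hc z : nc z < T -> ccont h z.
  by move=> zT; have [->//|zna] := eqVneq z a; apply/cdiff_cont/hd.
have hcirc (s : R) : 0 <= s -> s < T -> rcont (oncircle h s).
  by move=> s0 sT; apply: rcont_oncircle => // z zs; apply: hc; rewrite zs.
have hin (s : R) : 0 < s -> s < nc a -> cmean h s = 0.
  move=> s0 sa; rewrite cmean_center //.
  - have a0 : a != 0 by rewrite -nc_gt0; exact: lt_trans sa.
    by rewrite /h eq_sym (negbTE a0) !mul0r.
  - by apply: hc; rewrite nc0; lra.
  - move=> z /andP[z0 zs]; apply: hd; last by lra.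
    by apply/eqP => E; rewrite E in zs; lra.
have h0 : cmean h r = 0.
  have [a0|a0] := eqVneq a 0.
    rewrite cmean_center //; first by rewrite /h a0 eqxx mul0r.
      by apply: hc; rewrite nc0; lra.
    move=> z /andP[z0 zs]; apply: hd; last by lra.
    by rewrite a0 -nc_gt0.
  have a1 : 0 < nc a by rewrite nc_gt0.
  have ca z : nc z = nc a -> ccont h z by move=> E; apply: hc; rewrite E; lra.
  have hca := hcirc (nc a) pa (lt_trans ar rT).
  (* The circle of radius |a| meets [a], where [h] is only known to be continuous; it is approached
     from both sides, each side being covered by [cmean_annulus] or by the value at the centre. *)
  have near (e : R) : 0 < e -> nc (cmean h r - cmean h (nc a)) <= e /\
      nc (cmean h (nc a)) <= e.
    move=> e0; have [d d0 Hd] := cmean_lip a1 e0 ca hca.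
    split.
      pose s := Num.min (nc a + d / 2) r.
      have sa : nc a < s by rewrite /s lt_min ar ltrDl divr_gt0.
      have sr : s <= r by rewrite /s ge_min lexx orbT.
      have sd : s <= nc a + d / 2 by rewrite /s ge_min lexx.
      have s0 : 0 < s by lra.
      rewrite -(@cmean_annulus h s r) //.
        apply: Hd; last by apply: hcirc; lra.
        by rewrite ger0_norm; lra.
      move=> z /andP[z1 z2]; apply: hd; last by lra.
      by apply/eqP => E; rewrite E in z1; lra.
    pose s := Num.max (nc a - d / 2) (nc a / 2).
    have sa : s < nc a by rewrite /s gt_max; apply/andP; split; lra.
    have s0 : 0 < s by rewrite /s lt_max (_ : 0 < nc a / 2) ?orbT //; lra.
    have sd : nc a - d / 2 <= s by rewrite /s le_max lexx.
    have := Hd s; rewrite hin // sub0r ncN; apply; last by apply: hcirc; lra.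
    by rewrite ler0_norm; lra.
  have E1 : cmean h (nc a) = 0 by apply: le0_nc_eq => e /near[].
  by apply: le0_nc_eq => e /near[+ _]; rewrite E1 subr0.
have cg z : nc z = r -> ccont g z by move=> zr; apply/cdiff_cont/H; rewrite zr.
have cinv : rcont (oncircle (fun z => (z - a)^-1) r).
  apply: rcont_oncircle => [|z zr]; first exact: ltW.
  apply/cdiff_cont/cdiffV; first exact: za.
  by apply: cdiffB; [exact: cdiff_id | exact: cdiff_cst].
have cz : rcont (oncircle id r) by exact: rcont_circle.
have cgr : rcont (oncircle g r) by apply: rcont_oncircle => //; exact: ltW.
have c1 : rcont (oncircle (fun z => z * g z / (z - a)) r).
  exact: rcontM (rcontM cz cgr) cinv.
have c2 : rcont (oncircle (fun z => 1 + a * (z - a)^-1) r).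
  by apply: rcontD; [exact: rcont_cst | apply: rcontM => //; exact: rcont_cst].
have : cmean h r = cmean (fun z => z * g z / (z - a)) r - g a * cmean (fun z => 1 + a * (z - a)^-1) r.
  rewrite -cmeanZ // -cmeanB //; last by apply: rcontM => //; exact: rcont_cst.
  apply: cmean_ext => [|z zr]; first exact: ltW.
  rewrite /h; have := za _ zr; rewrite subr_eq0 => zna; rewrite (negbTE zna).
  by field; rewrite subr_eq0.
rewrite h0 => /esym/eqP; rewrite subr_eq0 => /eqP ->.
rewrite cmeanD ?cmean_cst; [|exact: rcont_cst|by apply: rcontM => //; exact: rcont_cst].
rewrite cmeanZ // -[X in a * X](_ : cmean (fun z => ((z - a) ^+ 1)^-1) r = _).
  by rewrite cmean_invn // mulr0 addr0 mulr1.
by apply: cmean_eq => z; rewrite expr1.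
Qed.

(** * Taylor coefficients and Cauchy's estimates *)

Definition coef g r n : C := cmean (fun z => g z * (z ^+ n)^-1) r.

Lemma rcont_circ_inv r n : 0 < r -> rcont (oncircle (fun z => (z ^+ n)^-1) r).
Proof.
move=> r0; apply: rcont_oncircle => [|z zr]; first exact: ltW.
apply/cdiff_cont/cdiffV; first by rewrite expf_neq0 // -nc_gt0 zr.
by apply: cdiffX; exact: cdiff_id.
Qed.

Lemma rcont_circ_diff g T r : 0 <= r -> r < T ->
  (forall z, nc z < T -> cdiff g z) -> rcont (oncircle g r).
Proof.
by move=> r0 rT H; apply: rcont_oncircle => // z zr; apply/cdiff_cont/H; rewrite zr.
Qed.

Lemma coef_indep g T r1 r2 n : (forall z, nc z < T -> cdiff g z) ->
  0 < r1 -> 0 < r2 -> r1 < T -> r2 < T -> coef g r1 n = coef g r2 n.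
Proof.
move=> H; wlog r12 : r1 r2 / r1 <= r2 => [hw|].
  by case/orP: (le_total r1 r2) => /hw h *; [apply: h | apply/esym/h].
move=> r10 r20 _ r2T; apply: cmean_annulus => // z /andP[z1 z2].
have z0 : 0 < nc z by exact: lt_le_trans z1.
apply: cdiffM; first by apply: H; exact: le_lt_trans r2T.
apply: cdiffV; first by rewrite expf_neq0 // -nc_gt0.
by apply: cdiffX; exact: cdiff_id.
Qed.

Lemma coef_le g r n (M : R) : 0 < r -> rcont (oncircle g r) ->
  (forall z, nc z = r -> nc (g z) <= M) -> nc (coef g r n) * r ^+ n <= M.
Proof.
move=> r0 cg HM; have rn : 0 < r ^+ n by rewrite exprn_gt0.
rewrite -ler_pdivlMr //; apply: cmean_le.
  exact: rcontM cg (rcont_circ_inv n r0).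
move=> t; rewrite /oncircle; set z := _ * cis t.
have zr : nc z = r by rewrite nc_circle // ltW.
by rewrite ncM ncV ncX zr ler_wpM2r ?invr_ge0 ?(ltW rn) // HM.
Qed.

Lemma coefB f g r n : 0 < r -> rcont (oncircle f r) -> rcont (oncircle g r) ->
  coef (fun z => f z - g z) r n = coef f r n - coef g r n.
Proof.
move=> r0 cf cg; rewrite /coef -cmeanB.
- by apply: cmean_eq => z; rewrite mulrBl.
- exact: rcontM cf (rcont_circ_inv n r0).
- exact: rcontM cg (rcont_circ_inv n r0).
Qed.

(** Subtracting [N] terms of the geometric series from the Cauchy kernel leaves (a/z)^N z / (z - a),
    which is estimated on the circle. *)
Lemma taylor_rem g T a r (M : R) N : nc a < r -> r < T ->
  (forall z, nc z < T -> cdiff g z) -> (forall z, nc z = r -> nc (g z) <= M) ->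
  nc (g a - \sum_(k < N) coef g r k * a ^+ k) <=
    M * (nc a / r) ^+ N * (r / (r - nc a)).
Proof.
move=> ar rT H HM; have pa := nc_ge0 a; have r0 : 0 < r by lra.
have cgr := rcont_circ_diff (ltW r0) rT H.
have za z : nc z = r -> z - a != 0.
  by move=> zr; rewrite -nc_gt0; have := ncBl z a; lra.
have c1 : rcont (oncircle (fun z => z * g z / (z - a)) r).
  apply: rcont_oncircle => [|z zr]; first exact: ltW.
  apply/cdiff_cont; apply: cdiffM.
    by apply: cdiffM; [exact: cdiff_id | apply: H; rewrite zr].
  apply: cdiffV; first exact: za.
  by apply: cdiffB; [exact: cdiff_id | exact: cdiff_cst].
have c2 k : rcont (oncircle (fun z => a ^+ k * (g z * (z ^+ k)^-1)) r).
  apply: rcontM; first exact: rcont_cst.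
  exact: rcontM cgr (rcont_circ_inv k r0).
have -> : \sum_(k < N) coef g r k * a ^+ k =
    cmean (fun z => \sum_(k < N) a ^+ k * (g z * (z ^+ k)^-1)) r.
  rewrite cmean_sum //; apply: eq_bigr => k _.
  rewrite cmeanZ; last exact: rcontM cgr (rcont_circ_inv k r0).
  exact: mulrC.
have c3 : rcont (oncircle (fun z => \sum_(k < N) a ^+ k * (g z * (z ^+ k)^-1)) r).
  exact: (rcont_sum _ (fun k : 'I_N => c2 k)).
rewrite -(cauchy ar rT H) -cmeanB //.
apply: cmean_le; first exact: (rcontB c1 c3).
move=> t; rewrite /oncircle; set z := _ * cis t.
have zr : nc z = r by rewrite nc_circle // ltW.
clearbody z; have z0 : z != 0 by rewrite -nc_gt0 zr.
have zna := za _ zr.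
have -> : z * g z / (z - a) - \sum_(k < N) a ^+ k * (g z * (z ^+ k)^-1) =
    g z * (a / z) ^+ N * (z / (z - a)).
  have -> : \sum_(k < N) a ^+ k * (g z * (z ^+ k)^-1) =
      g z * \sum_(k < N) (a / z) ^+ k.
    by rewrite mulr_sumr; apply: eq_bigr => k _; rewrite exprMn exprVn; ring.
  have h1 : a / z - 1 != 0.
    by rewrite -[1](divff z0) -mulrBl mulf_neq0 ?invr_eq0 // -opprB oppr_eq0.
  have -> : \sum_(k < N) (a / z) ^+ k = ((a / z) ^+ N - 1) / (a / z - 1).
    by rewrite subrX1 mulrAC divff // mul1r.
  have -> : a / z - 1 = - ((z - a) / z) by field.
  by move: (_ ^+ N) => X; field; rewrite z0 zna.
rewrite !ncM ncV ncX ncM ncV zr.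
have q0 : 0 < r - nc a by rewrite subr_gt0.
have M0 : 0 <= M by apply: le_trans (HM z zr); exact: nc_ge0.
apply: ler_pM.
- by rewrite mulr_ge0 ?nc_ge0 // exprn_ge0 // divr_ge0 // ltW.
- by rewrite divr_ge0 ?nc_ge0 // ltW.
- by rewrite ler_wpM2r ?HM // exprn_ge0 // divr_ge0 // ltW.
- rewrite ler_wpM2l ?(ltW r0) // lef_pV2 ?posrE ?nc_gt0 //.
  by rewrite -zr ncBl.
Qed.

(** Taylor remainders of orders 1 and 2 on the circle of radius [T / 2]; for |a| <= T/4 the factor r
    / (r - |a|) is at most 2. This is the device that turns a bound on a disc into uniform first and
    second order estimates, here and in several variables. *)
Lemma schwarz g (T M : R) : 0 < T -> (forall z, nc z < T -> cdiff g z) ->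
  (forall z, nc z < T -> nc (g z) <= M) ->
  let l := coef g (T / 2) 1 in [/\ cder g 0 l, nc l <= 2 * M / T,
    forall a, nc a <= T / 4 -> nc (g a - g 0) <= 4 * M / T * nc a &
    forall a, nc a <= T / 4 -> nc (g a - g 0 - a * l) <= 8 * M / T ^+ 2 * nc a ^+ 2].
Proof.
move=> T0 H HM; pose r := T / 2; rewrite -/r.
have r0 : 0 < r by rewrite /r; lra.
have rT : r < T by rewrite /r; lra.
have Hr z : nc z = r -> nc (g z) <= M by move=> zr; apply: HM; rewrite zr.
have M0 : 0 <= M by apply: le_trans (HM 0 _); rewrite ?nc_ge0 // nc0.
have cgr := rcont_circ_diff (ltW r0) rT H.
have c0 : coef g r 0 = g 0.
  rewrite -(@cmean_center g r) //.
  - by apply: cmean_eq => z; rewrite expr0 invr1 mulr1.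
  - by apply/cdiff_cont/H; rewrite nc0.
  - by move=> z /andP[_ zr]; apply: H; exact: le_lt_trans rT.
have rem N a : nc a <= T / 4 ->
    nc (g a - \sum_(k < N) coef g r k * a ^+ k) <= M * (nc a / r) ^+ N * 2.
  move=> aT; have ar : nc a < r by rewrite /r; lra.
  apply: le_trans (taylor_rem N ar rT H Hr) _.
  rewrite ler_wpM2l //.
    by rewrite mulr_ge0 // exprn_ge0 // divr_ge0 ?nc_ge0 // ltW.
  by rewrite ler_pdivrMr ?subr_gt0 // /r; lra.
have E2 a : nc a <= T / 4 ->
    nc (g a - g 0 - a * coef g r 1) <= 8 * M / T ^+ 2 * nc a ^+ 2.
  move=> aT; have := rem 2 a aT.
  rewrite !big_ord_recl big_ord0 /= expr0 mulr1 expr1 addr0 c0 opprD addrA.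
  rewrite (mulrC a) => h; apply: le_trans h _.
  rewrite le_eqVlt; apply/orP; left; apply/eqP; rewrite /r; field.
  by rewrite gt_eqF.
split => //.
- move=> e e0; pose d := Num.min (T / 4) (e / (8 * M / T ^+ 2 + 1)).
  have K0 : 0 <= 8 * M / T ^+ 2.
    by rewrite divr_ge0 ?sqr_ge0 // mulr_ge0.
  exists d; first by rewrite /d lt_min !divr_gt0 //; lra.
  move=> h; rewrite lt_min => /andP[/ltW h1].
  rewrite ltr_pdivlMr => [h2|]; last by lra.
  rewrite add0r; apply: le_trans (E2 h h1) _.
  rewrite expr2 mulrA ler_wpM2r ?nc_ge0 //.
  by apply: le_trans (ltW h2); rewrite mulrC ler_wpM2l ?nc_ge0 // lerDl.
- have := coef_le 1 r0 cgr Hr; rewrite expr1 => h.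
  by rewrite ler_pdivlMr //; move: h; rewrite /r; lra.
- move=> a aT; have := rem 1%N a aT.
  rewrite big_ord1 /= expr0 mulr1 c0 expr1 => h; apply: le_trans h _.
  rewrite le_eqVlt; apply/orP; left; apply/eqP; rewrite /r; field.
  by rewrite gt_eqF.
Qed.

(** * Orthogonality of the monomials, Parseval and Bessel *)

Lemma cmean_pow j r : 0 < r -> cmean (fun z => z ^+ j.+1) r = 0.
Proof.
move=> r0; rewrite cmean_center //; first by rewrite expr0n.
  by apply/cdiff_cont/cdiffX; exact: cdiff_id.
by move=> z _; apply: cdiffX; exact: cdiff_id.
Qed.

Lemma coef_pow j n r : 0 < r -> coef (fun z => z ^+ j) r n = (j == n)%:R.
Proof.
move=> r0; have [jn|nj|->] := ltngtP j n.
- apply: etrans (@cmean_invn 0 (n - j.+1) r _); last by rewrite nc0.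
  apply: cmean_ext => [|z zr]; first exact: ltW.
  have z0 : z != 0 by rewrite -nc_gt0 zr.
  rewrite subr0 subnSK // -{1}(subnKC (ltnW jn)) exprD invfM mulrA divff ?mul1r //.
  by rewrite expf_neq0.
- apply: etrans (@cmean_pow (j - n.+1) r r0).
  apply: cmean_ext => [|z zr]; first exact: ltW.
  have z0 : z != 0 by rewrite -nc_gt0 zr.
  by rewrite subnSK // -{1}(subnK (ltnW nj)) exprD mulfK // expf_neq0.
- apply: etrans (cmean_cst 1 r); apply: cmean_ext => [|z zr]; first exact: ltW.
  by rewrite divff // expf_neq0 // -nc_gt0 zr.
Qed.

Lemma rcont_pow j r : rcont (oncircle (fun z => z ^+ j) r).
Proof.
rewrite /oncircle; elim: j => [|j IH].
  by under eq_fun do rewrite expr0; exact: rcont_cst.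
under eq_fun do rewrite exprS; exact: rcontM (rcont_circle r) IH.
Qed.

Definition cpoly (c : nat -> C) n z := \sum_(k < n) c k * z ^+ k.

Lemma rcont_cpoly c n r : rcont (oncircle (cpoly c n) r).
Proof.
have h (k : 'I_n) : rcont (oncircle (fun z => c k * z ^+ k) r).
  exact: rcontM (rcont_cst _) (rcont_pow k r).
exact: rcont_sum h.
Qed.

Lemma cdiff_cpoly c n z : cdiff (cpoly c n) z.
Proof.
apply: cdiff_sum => k; apply: cdiffM; first exact: cdiff_cst.
by apply: cdiffX; exact: cdiff_id.
Qed.

Lemma coef_cpoly c n r k : 0 < r -> coef (cpoly c n) r k = if (k < n)%N then c k else 0.
Proof.
move=> r0.
have -> : coef (cpoly c n) r k = \sum_(j < n) c j * coef (fun z => z ^+ j) r k.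
  have h j : rcont (oncircle (fun z => z ^+ j / z ^+ k) r).
    exact: rcontM (rcont_pow j r) (rcont_circ_inv k r0).
  transitivity (\sum_(j < n) cmean (fun z => c j * (z ^+ j / z ^+ k)) r).
    rewrite -cmean_sum => [|j]; last exact: rcontM (rcont_cst (c j)) (h j).
    apply: cmean_eq => z; rewrite /cpoly mulr_suml.
    by apply: eq_bigr => j _; rewrite mulrA.
  by apply: eq_bigr => j _; exact: cmeanZ.
under eq_bigr do rewrite coef_pow //.
case: ltnP => kn.
  rewrite (bigD1 (Ordinal kn)) //= eqxx mulr1 big1 ?addr0 // => j /negbTE h.
  by rewrite -val_eqE /= in h; rewrite h mulr0.
rewrite big1 // => j _; rewrite (_ : (j == k :> nat) = false) ?mulr0 //.
by apply/negbTE; rewrite neq_ltn (leq_trans (ltn_ord j) kn).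
Qed.

Lemma conjcD z w : conjc (z + w) = conjc z + conjc w.
Proof. exact: rmorphD. Qed.

Lemma conjcM z w : conjc (z * w) = conjc z * conjc w.
Proof. exact: rmorphM. Qed.

Lemma conjcB z w : conjc (z - w) = conjc z - conjc w.
Proof. exact: rmorphB. Qed.

Lemma conjc_realc (a : R) : conjc a%:C = a%:C.
Proof. exact: conjc_real. Qed.

Lemma rcont_conj (p : R -> C) : rcont p -> rcont (fun x => conjc (p x)).
Proof.
move=> cp x e e0; have [d d0 Hd] := cp x e e0; exists d => // y /Hd.
by rewrite -conjcB nc_conj.
Qed.

Lemma rder_conj (F : R -> C) x l : rder F x l -> rder (fun t => conjc (F t)) x (conjc l).
Proof.
move=> H e e0; have [d d0 Hd] := H e e0; exists d => // h /Hd.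
by rewrite -(nc_conj (_ - _ - _)) !conjcB conjcM conjc_realc.
Qed.

Lemma cmean_conj g r : rcont (oncircle g r) ->
  cmean (fun z => conjc (g z)) r = conjc (cmean g r).
Proof.
move=> cg; rewrite /cmean conjcM conjc_realc; congr (_ * _).
have [F HF] := primitive_ex cg.
rewrite (rint_prim _ _ HF) conjcB (@rint_prim _ (fun t => conjc (F t))) // => x.
exact: rder_conj.
Qed.

Lemma cmean_ge0 g r : rcont (oncircle g r) ->
  (forall t, 0 <= complex.Re (oncircle g r t)) -> 0 <= complex.Re (cmean g r).
Proof.
move=> cg H; rewrite /cmean ReM /= mul0r subr0.
rewrite mulr_ge0 ?invr_ge0 ?(ltW pi2_gt0) //.
have [F HF] := primitive_ex cg.
rewrite (rint_prim _ _ HF) ReB.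
have dP (x : R) : is_derive x 1 (fun t => complex.Re (F t)) (complex.Re (oncircle g r x)).
  have := rder_Re 1 (HF x); rewrite mul1r.
  by under eq_fun do rewrite mul1r.
have [|x /=] := @MVT_segment R (fun t => complex.Re (F t))
   (fun x => complex.Re (oncircle g r x)) 0 (2 * pi) (ltW pi2_gt0).
  have cf (x : R) : {for x, continuous (fun t => complex.Re (F t))}.
    by apply: differentiable_continuous; apply/derivable1_diffP; case: (dP x).
  exact: continuous_subspaceT.
by move=> _ ->; rewrite subr0 mulr_ge0 ?(ltW pi2_gt0).
Qed.

Definition msq g r : R := complex.Re (cmean (fun z => conjc (g z) * g z) r).

Lemma rcont_msq g r : rcont (oncircle g r) ->
  rcont (oncircle (fun z => conjc (g z) * g z) r).
Proof. by move=> cg; exact: rcontM (rcont_conj cg) cg. Qed.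

(** On |z| = r the conjugate of z^k is r^(2k) / z^k, so pairing with a monomial reads off a
    coefficient. *)
Lemma cmean_inner c n h r : 0 < r -> rcont (oncircle h r) ->
  cmean (fun z => conjc (cpoly c n z) * h z) r =
  \sum_(k < n) conjc (c k) * ((r ^+ k) ^+ 2)%:C * coef h r k.
Proof.
move=> r0 ch.
have ck k : rcont (oncircle (fun z => h z * (z ^+ k)^-1) r).
  exact: rcontM ch (rcont_circ_inv k r0).
transitivity (cmean (fun z => \sum_(k < n)
    conjc (c k) * ((r ^+ k) ^+ 2)%:C * (h z * (z ^+ k)^-1)) r).
  apply: cmean_ext => [|z zr]; first exact: ltW.
  have z0 : z != 0 by rewrite -nc_gt0 zr.
  rewrite /cpoly (big_morph _ conjcD (conjc_realc 0)) mulr_suml.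
  apply: eq_bigr => k _; rewrite conjcM.
  have -> : ((r ^+ k) ^+ 2)%:C = conjc (z ^+ k) * z ^+ k.
    by rewrite mul_conj ncX zr.
  have zk : z ^+ k != 0 by rewrite expf_neq0.
  move: (conjc (z ^+ k)) (z ^+ k) zk => Y X X0; field; exact: X0.
have ck' (k : 'I_n) : rcont (oncircle
    (fun z => conjc (c k) * ((r ^+ k) ^+ 2)%:C * (h z * (z ^+ k)^-1)) r).
  exact: rcontM (rcont_cst _) (ck k).
by rewrite cmean_sum //; apply: eq_bigr => k _; exact: cmeanZ.
Qed.

Lemma cmean_inner_self c n r : 0 < r ->
  cmean (fun z => conjc (cpoly c n z) * cpoly c n z) r =
  (\sum_(k < n) (nc (c k) * r ^+ k) ^+ 2)%:C.
Proof.
move=> r0; rewrite cmean_inner //; last exact: rcont_cpoly.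
rewrite (big_morph _ (@realcD R) (erefl _)).
apply: eq_bigr => k _; rewrite coef_cpoly // ltn_ord mulrAC mul_conj -realcM.
by rewrite -exprMn.
Qed.

Lemma parseval c n r : 0 < r ->
  msq (cpoly c n) r = \sum_(k < n) (nc (c k) * r ^+ k) ^+ 2.
Proof. by move=> r0; rewrite /msq cmean_inner_self. Qed.

(** Expansion of the nonnegative mean of |h - s|^2, where [s] is the polynomial with the first [n]
    coefficients of [h]. *)
Lemma bessel h n r : 0 < r -> rcont (oncircle h r) ->
  \sum_(k < n) (nc (coef h r k) * r ^+ k) ^+ 2 <= msq h r.
Proof.
move=> r0 ch; pose c k := coef h r k; pose s := cpoly c n.
have cs : rcont (oncircle s r) by exact: rcont_cpoly.
have c1 : rcont (oncircle (fun z => conjc (s z) * h z) r).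
  exact: rcontM (rcont_conj cs) ch.
have c2 := rcont_conj c1.
have c3 := rcont_msq cs; have c4 := rcont_msq ch.
set S := \sum_(k < n) _.
have E1 : cmean (fun z => conjc (s z) * h z) r = S%:C.
  rewrite cmean_inner // /S (big_morph _ (@realcD R) (erefl _)).
  apply: eq_bigr => k _; rewrite mulrAC mul_conj -realcM.
  by rewrite -exprMn.
have E2 : cmean (fun z => conjc (conjc (s z) * h z)) r = S%:C.
  by rewrite cmean_conj // E1 conjc_realc.
have E3 : cmean (fun z => conjc (s z) * s z) r = S%:C by exact: cmean_inner_self.
have cd : rcont (oncircle (fun z => h z - s z) r) by exact: rcontB.
have := cmean_ge0 (rcont_msq cd).
have -> : cmean (fun z => conjc (h z - s z) * (h z - s z)) r =
    cmean (fun z => conjc (h z) * h z) r - S%:C.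
  transitivity (cmean (fun z => (conjc (h z) * h z - conjc (s z) * h z) -
      (conjc (conjc (s z) * h z) - conjc (s z) * s z)) r).
    by apply: cmean_eq => z; rewrite conjcB conjcM conjcK; ring.
  rewrite cmeanB; [|exact: rcontB|exact: rcontB].
  by rewrite !cmeanB // E1 E2 E3 subrr subr0.
rewrite ReB /= subr_ge0; apply => t; rewrite /oncircle mul_conj.
exact: sqr_ge0.
Qed.

(** Positivity of the mean, in the form needed to integrate a pointwise bound for z d/dz of the
    nonlinearity. *)
Lemma msq_le g (I : finType) (p : I -> C -> C) r (al be : R) :
  0 < r -> rcont (oncircle g r) -> (forall i, rcont (oncircle (p i) r)) ->
  (forall z, nc z = r -> nc (g z) ^+ 2 <= al + be * \sum_i nc (p i z) ^+ 2) ->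
  msq g r <= al + be * \sum_i msq (p i) r.
Proof.
move=> r0 cg cp H.
have c1 := rcont_msq cg; have c2 i := rcont_msq (cp i).
have c3 : rcont (oncircle (fun z => \sum_i conjc (p i z) * p i z) r).
  exact: rcont_sum c2.
have c4 : rcont (oncircle (fun z => be%:C * \sum_i conjc (p i z) * p i z) r).
  exact: rcontM (rcont_cst _) c3.
have c5 : rcont (oncircle (fun z => al%:C + be%:C * \sum_i conjc (p i z) * p i z) r).
  exact: rcontD (rcont_cst _) c4.
have c6 := rcontB c5 c1.
have := cmean_ge0 (g := fun z => (al%:C + be%:C * \sum_i conjc (p i z) * p i z) -
  conjc (g z) * g z) c6.
have ReS (u : I -> C) : complex.Re (\sum_i u i) = \sum_i complex.Re (u i).
  by apply: (big_morph (@complex.Re R)) => // -[a b] [c d].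
rewrite cmeanB // cmeanD //; last exact: rcont_cst.
rewrite cmean_cst cmeanZ // cmean_sum // ReB subr_ge0.
rewrite [complex.Re (_ + _)](_ : _ = al + be * \sum_i msq (p i) r).
  apply=> t; rewrite /oncircle; set z := _ * cis t.
  have zr : nc z = r by rewrite nc_circle // ltW.
  rewrite mul_conj; under eq_bigr do rewrite mul_conj.
  rewrite -(big_morph _ (@realcD R) (erefl _)) -realcM -realcD -realcB /=.
  by rewrite subr_ge0 H.
by rewrite -ReS; case: (\sum_i _) => a b; rewrite /= mul0r subr0.
Qed.

(** * Limits of complex sequences and of holomorphic functions *)

Definition clim (u : nat -> C) l := forall e : R, 0 < e ->
  exists N : nat, forall n, (N <= n)%N -> nc (u n - l) <= e.

Lemma clim_uniq (u : nat -> C) (l m : C) : clim u l -> clim u m -> l = m.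
Proof.
move=> H1 H2; apply/eqP; rewrite -subr_eq0; apply/eqP/le0_nc_eq => e e0.
have e2 : 0 < e / 2 by lra.
have [N1 h1] := H1 _ e2; have [N2 h2] := H2 _ e2.
have := h1 _ (leq_maxl N1 N2); have := h2 _ (leq_maxr N1 N2).
set n := maxn _ _; have := ncD3 l (u n) m; rewrite (ncC l (u n)); clear; lra.
Qed.

Lemma climD (u v : nat -> C) (l m : C) : clim u l -> clim v m -> clim (fun n => u n + v n) (l + m).
Proof.
move=> H1 H2 e e0; have e2 : 0 < e / 2 by lra.
have [N1 h1] := H1 _ e2; have [N2 h2] := H2 _ e2.
exists (maxn N1 N2) => n; rewrite geq_max => /andP[/h1 k1 /h2 k2].
rewrite opprD addrACA; apply: le_trans (ncD _ _) _; clear -k1 k2; lra.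
Qed.

Lemma climZ c (u : nat -> C) (l : C) : clim u l -> clim (fun n => c * u n) (c * l).
Proof.
move=> H e e0; have pc := nc_ge0 c.
have [N h] := H _ (divr_gt0 e0 (ltr_wpDl pc ltr01)).
exists N => n /h k; rewrite -mulrBr ncM.
apply: le_trans (ler_wpM2l pc k) _.
rewrite mulrCA ger_pMr // ler_pdivrMr; lra.
Qed.

Lemma clim_cst c : clim (fun=> c) c.
Proof. by move=> e e0; exists 0%N => n _; rewrite subrr nc0 ltW. Qed.

Lemma climB (u v : nat -> C) (l m : C) : clim u l -> clim v m -> clim (fun n => u n - v n) (l - m).
Proof.
move=> H1 /(climZ (-1)) /(climD H1); rewrite mulN1r.
by under eq_fun do rewrite mulN1r.
Qed.

Lemma clim_sum (I : Type) (s : seq I) (u : I -> nat -> C) (l : I -> C) :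
  (forall i, clim (u i) (l i)) ->
  clim (fun m => \sum_(i <- s) u i m) (\sum_(i <- s) l i).
Proof.
move=> H; elim: s => [|i s IH].
  by rewrite big_nil; under eq_fun do rewrite big_nil; exact: clim_cst.
by rewrite big_cons; under eq_fun do rewrite big_cons; exact: climD (H i) IH.
Qed.

Lemma clim_le (u : nat -> C) (l : C) (M : R) : clim u l -> (exists N : nat, forall n, (N <= n)%N -> nc (u n) <= M) ->
  nc l <= M.
Proof.
move=> H [N0 HM]; apply/ler_addgt0Pr => e e0; have [N h] := H e e0.
have := h _ (leq_maxl N N0); have := HM _ (leq_maxr N N0).
by set n := maxn _ _; have := ncBl l (u n); rewrite ncC; clear; lra.
Qed.

Lemma real_cauchy (u : nat -> R) :
  (forall e : R, 0 < e -> exists N : nat, forall n m, (N <= n)%N -> (N <= m)%N ->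
     `|u n - u m| <= e) ->
  exists l, forall e : R, 0 < e -> exists N : nat, forall n, (N <= n)%N -> `|u n - l| <= e.
Proof.
move=> H.
have : cvg (u @ \oo).
  apply/cauchy_cvgP/cauchy_ballP => e e0.
  have e2 : 0 < e / 2 by lra.
  have [N h] := H _ e2.
  exists (u @` [set n | (N <= n)%N], u @` [set n | (N <= n)%N]) => /=.
    by split; exists N => // n /= Nn; exists n.
  by move=> [x y] /= [[n nN <-] [m mN <-]]; rewrite /ball /=; have := h _ _ nN mN; lra.
move=> /cvg_ex[l /cvgrPdist_le Hl]; exists l => e e0.
by have [N _ h] := Hl e e0; exists N => n /h; rewrite distrC.
Qed.

Lemma cauchyC (u : nat -> C) :
  (forall e : R, 0 < e -> exists N : nat, forall n m, (N <= n)%N -> (N <= m)%N ->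
     nc (u n - u m) <= e) ->
  exists l, clim u l.
Proof.
move=> H.
have [|a Ha] := @real_cauchy (fun n => complex.Re (u n)).
  move=> e e0; have [N h] := H e e0; exists N => n m nN mN.
  by rewrite -ReB; apply: le_trans (Re_le _) (h _ _ nN mN).
have [|b Hb] := @real_cauchy (fun n => complex.Im (u n)).
  move=> e e0; have [N h] := H e e0; exists N => n m nN mN.
  by rewrite -ImB; apply: le_trans (Im_le _) (h _ _ nN mN).
exists (a +i* b) => e e0; have e2 : 0 < e / 2 by lra.
have [N1 h1] := Ha _ e2; have [N2 h2] := Hb _ e2.
exists (maxn N1 N2) => n; rewrite geq_max => /andP[/h1 k1 /h2 k2].
apply: le_trans (nc_le _) _; rewrite ReB ImB /=; clear -k1 k2; lra.
Qed.

Lemma cder_shift g z0 z l : cder g (z0 + z) l -> cder (fun w => g (z0 + w)) z l.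
Proof.
by move=> H e e0; have [d d0 Hd] := H e e0; exists d => // h /Hd; rewrite addrA.
Qed.

Lemma schwarz_at g z0 (T M : R) : 0 < T ->
  (forall z, nc (z - z0) < T -> cdiff g z) ->
  (forall z, nc (z - z0) < T -> nc (g z) <= M) ->
  exists l, [/\ cder g z0 l, nc l <= 2 * M / T,
    forall a, nc a <= T / 4 -> nc (g (z0 + a) - g z0) <= 4 * M / T * nc a &
    forall a, nc a <= T / 4 ->
      nc (g (z0 + a) - g z0 - a * l) <= 8 * M / T ^+ 2 * nc a ^+ 2].
Proof.
move=> T0 H HM; have [||] := @schwarz (fun w => g (z0 + w)) T M T0.
- move=> z zT; have [|l Hl] := H (z0 + z); first by rewrite (addrC z0) addrK.
  by exists l; exact: cder_shift.
- by move=> z zT; apply: HM; rewrite (addrC z0) addrK.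
set l := coef _ _ _; rewrite addr0 => h1 h2 h3 h4; exists l; split => //.
by move=> e e0; have [d d0 Hd] := h1 e e0; exists d => // h /Hd; rewrite add0r addr0.
Qed.

(** Pointwise convergence and a common bound suffice, because the second order estimate of
    [schwarz_at] is uniform in n: it makes the derivatives a Cauchy sequence and passes to the
    limit, where it yields the derivative of [f]. *)
Lemma ulim (g : nat -> C -> C) f z0 (d M : R) : 0 < d ->
  (forall n z, nc (z - z0) < d -> cdiff (g n) z) ->
  (forall n z, nc (z - z0) < d -> nc (g n z) <= M) ->
  (forall z, nc (z - z0) < d -> clim (fun n => g n z) (f z)) ->
  exists2 l, cder f z0 l & forall m : nat -> C, (forall n, cder (g n) z0 (m n)) -> clim m l.
Proof.
move=> d0 Hd HM Hl; pose K := 8 * M / d ^+ 2.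
have M0 : 0 <= M by apply: le_trans (HM 0%N z0 _); rewrite ?nc_ge0 // subrr nc0.
have K0 : 0 <= K by rewrite /K divr_ge0 ?sqr_ge0 // mulr_ge0.
have /choice[m Hm] : forall n, exists l, cder (g n) z0 l /\
    forall a, nc a <= d / 4 -> nc (g n (z0 + a) - g n z0 - a * l) <= K * nc a ^+ 2.
  by move=> n; have [l [h1 _ _ h4]] := schwarz_at d0 (Hd n) (HM n); exists l.
have l0 : clim (fun n => g n z0) (f z0) by apply: Hl; rewrite subrr nc0.
have la a : nc a <= d / 4 -> clim (fun n => g n (z0 + a)) (f (z0 + a)).
  by move=> ad; apply: Hl; rewrite (addrC z0) addrK; lra.
have [l ml] : exists l, clim m l.
  apply: cauchyC => e e0.
  (* A fixed increment at which the two second order errors use up at most e t / 2; the four errors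
     e t / 8 from pointwise convergence make up the rest. *)
  pose t := Num.min (d / 4) (e / (4 * (K + 1))).
  have K1 : 0 < 4 * (K + 1) by lra.
  have t0 : 0 < t by rewrite /t lt_min !divr_gt0.
  have td : t <= d / 4 by rewrite /t ge_min lexx.
  have tK : t * (4 * (K + 1)) <= e by rewrite -ler_pdivlMr // /t ge_min lexx orbT.
  pose a : C := t%:C; have na : nc a = t by rewrite nc_real gtr0_norm.
  have e8 : 0 < e * t / 8 by rewrite divr_gt0 // mulr_gt0.
  have ad : nc a <= d / 4 by rewrite na.
  have [N1 h1] := la a ad _ e8; have [N2 h2] := l0 _ e8.
  exists (maxn N1 N2) => n n'; rewrite !geq_max => /andP[/h1 n1 /h2 n2] /andP[/h1 n1' /h2 n2'].
  rewrite -(ler_pM2l t0) -{1}na -ncM.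
  have -> : a * (m n - m n') = ((g n' (z0 + a) - g n' z0 - a * m n') -
     (g n (z0 + a) - g n z0 - a * m n)) + (((g n (z0 + a) - f (z0 + a)) -
     (g n' (z0 + a) - f (z0 + a))) - ((g n z0 - f z0) - (g n' z0 - f z0))) by ring.
  apply: le_trans (ncD _ _) _.
  apply: le_trans (lerD (ncB _ _) (ncB _ _)) _.
  apply: le_trans (lerD (lexx _) (lerD (ncB _ _) (ncB _ _))) _.
  have k1 := (Hm n).2 _ ad; have k2 := (Hm n').2 _ ad; rewrite na in k1 k2.
  have k3 : K * t ^+ 2 <= e * t / 4 by clear -K0 t0 tK; nra.
  clear -k1 k2 k3 n1 n2 n1' n2'; lra.
exists l; last first.
  move=> m' Hm'; suff -> : m' = m by [].
  by apply/funext => n; exact: cder_uniq (Hm' n) (Hm n).1.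
have E a : nc a <= d / 4 -> nc (f (z0 + a) - f z0 - a * l) <= K * nc a ^+ 2.
  move=> ad; apply: clim_le (climB (climB (la a ad) l0) (climZ a ml)) _.
  by exists 0%N => n _; exact: (Hm n).2.
move=> e e0; exists (Num.min (d / 4) (e / (K + 1))).
  by rewrite lt_min !divr_gt0 //; lra.
move=> h; rewrite lt_min => /andP[/ltW h1].
rewrite ltr_pdivlMr => [h2|]; last by lra.
apply: le_trans (E h h1) _.
rewrite expr2 mulrA ler_wpM2r ?nc_ge0 //.
by apply: le_trans (ltW h2); rewrite mulrC ler_wpM2l ?nc_ge0 // lerDl.
Qed.

(** * Geometric tails and power series *)

Lemma geo_sum_le (q : R) n m : 0 <= q -> q < 1 -> (n <= m)%N ->
  \sum_(n <= k < m) q ^+ k <= q ^+ n / (1 - q).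
Proof.
move=> q0 q1 nm; rewrite ler_pdivlMr ?subr_gt0 //.
rewrite mulr_suml (eq_bigr (fun k => - (q ^+ k.+1 - q ^+ k))); last first.
  by move=> k _; rewrite exprS; ring.
rewrite sumrN telescope_sumr // opprB lerBlDr lerDl exprn_ge0 //.
Qed.

Lemma geom_csum (u : nat -> C) (K q : R) : 0 <= q -> q < 1 ->
  (forall k, nc (u k) <= K * q ^+ k) ->
  exists2 s : C, clim (fun n => \sum_(k < n) u k) s &
    forall n, nc (s - \sum_(k < n) u k) <= K * q ^+ n / (1 - q).
Proof.
move=> q0 q1 Hu.
have q1' : 0 < 1 - q by lra.
have K0 : 0 <= K.
  by have := le_trans (nc_ge0 _) (Hu 0%N); rewrite expr0 mulr1.
have tail n m : (n <= m)%N ->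
    nc (\sum_(k < m) u k - \sum_(k < n) u k) <= K * q ^+ n / (1 - q).
  move=> nm; rewrite -!(big_mkord xpredT u) (big_cat_nat (n := n)) //= addrAC subrr add0r.
  apply: le_trans (nc_sum _ _ _) _.
  apply: le_trans (ler_sum _ (fun k _ => Hu k)) _.
  by rewrite -mulr_sumr -mulrA ler_wpM2l // geo_sum_le.
have small (e : R) : 0 < e -> exists N : nat, K * q ^+ N / (1 - q) <= e.
  move=> e0; have : q ^+ n @[n --> \oo] --> (0 : R).
    by apply: cvg_expr; rewrite ger0_norm.
  have d0 : 0 < e * (1 - q) / (K + 1) by rewrite divr_gt0 ?mulr_gt0 //; lra.
  move=> /cvgrPdist_le /(_ _ d0)[N _ /(_ N (leqnn N))] /=.
  rewrite sub0r normrN ger0_norm ?exprn_ge0 // => h; exists N.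
  rewrite ler_pdivrMr //; apply: le_trans (ler_wpM2l K0 h) _.
  rewrite mulrCA ger_pMr ?mulr_gt0 // ler_pdivrMr; lra.
have [|s Hs] := @cauchyC (fun n => \sum_(k < n) u k).
  move=> e e0; have e2 : 0 < e / 2 by lra.
  have [N HN] := small _ e2; exists N => n m /tail k1 /tail k2.
  apply: le_trans (ncD3 _ (\sum_(k < N) u k) _) _.
  rewrite (ncC (\sum_(k < N) u k) (\sum_(k < m) u k)); lra.
exists s => // n; apply: clim_le (climB Hs (clim_cst _)) _.
by exists n => m /tail.
Qed.

(** Total in [z]: the value is 0 where the series diverges. *)
Definition psum (c : nat -> C) z : C := xget 0 [set s | clim (fun n => cpoly c n z) s].

Lemma psum_eq (c : nat -> C) z (s : C) : clim (fun n => cpoly c n z) s -> psum c z = s.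
Proof.
move=> H; rewrite /psum; case: xgetP => [y _ Hy|/(_ s)]; last by move=> /(_ H).
exact: clim_uniq Hy H.
Qed.

Lemma psum_ex (c : nat -> C) (K rho : R) z : nc z < rho ->
  (forall k, nc (c k) * rho ^+ k <= K) ->
  clim (fun n => cpoly c n z) (psum c z) /\
  forall n, nc (psum c z - cpoly c n z) <= K * (nc z / rho) ^+ n / (1 - nc z / rho).
Proof.
move=> zr HK; have pz := nc_ge0 z; have r0 : 0 < rho by lra.
have q0 : 0 <= nc z / rho by rewrite divr_ge0 // ltW.
have q1 : nc z / rho < 1 by rewrite ltr_pdivrMr // mul1r.
have [|s Hs Ht] := @geom_csum (fun k => c k * z ^+ k) K _ q0 q1.
  move=> k; rewrite ncM ncX expr_div_n mulrA ler_pdivlMr ?exprn_gt0 //.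
  by rewrite mulrAC ler_wpM2r // exprn_ge0.
by rewrite (psum_eq Hs).
Qed.

Lemma cpoly_le (c : nat -> C) (K rho : R) z n : nc z < rho ->
  (forall k, nc (c k) * rho ^+ k <= K) -> nc (cpoly c n z) <= K / (1 - nc z / rho).
Proof.
move=> zr HK; have pz := nc_ge0 z; have r0 : 0 < rho by lra.
have q0 : 0 <= nc z / rho by rewrite divr_ge0 // ltW.
have q1 : nc z / rho < 1 by rewrite ltr_pdivrMr // mul1r.
have K0 : 0 <= K by have := le_trans (mulr_ge0 (nc_ge0 _) ler01) (HK 0%N).
apply: le_trans (nc_sum _ _ _) _.
apply: le_trans (_ : \sum_(k < n) K * (nc z / rho) ^+ k <= _).
  apply: ler_sum => k _; rewrite ncM ncX expr_div_n mulrA ler_pdivlMr ?exprn_gt0 //.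
  by rewrite mulrAC ler_wpM2r // exprn_ge0.
rewrite -mulr_sumr ler_wpM2l //.
have := geo_sum_le q0 q1 (leq0n n); rewrite expr0 mul1r => h; apply: le_trans h.
by rewrite -(big_mkord xpredT (fun k => (nc z / rho) ^+ k)).
Qed.

(** [ulim] applied to the partial sums. The derivative is described through [z * l], whose series
    has coefficients k c_k without a shift of index; this is the operator z d/dz of the system. *)
Lemma psum_cder (c : nat -> C) (K rho : R) z : nc z < rho ->
  (forall k, nc (c k) * rho ^+ k <= K) ->
  exists2 l, cder (psum c) z l &
    clim (fun n => cpoly (fun k => k%:R * c k) n z) (z * l).
Proof.
move=> zr HK; have pz := nc_ge0 z; have r0 : 0 < rho by lra.
pose d := (rho - nc z) / 2; have d0 : 0 < d by rewrite /d; lra.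
have K0 : 0 <= K by have := le_trans (mulr_ge0 (nc_ge0 _) ler01) (HK 0%N).
have wr w : nc (w - z) < d -> nc w < nc z + d.
  by have := ncBl w z; lra.
have zdr : nc z + d < rho by rewrite /d; lra.
have [||w wd|l Hl Hm] := @ulim (fun n => cpoly c n) (psum c) z d
    (K / (1 - (nc z + d) / rho)) d0.
- by move=> n w _; exact: cdiff_cpoly.
- move=> n w /wr wd; apply: le_trans (cpoly_le n (lt_trans wd zdr) HK) _.
  rewrite ler_wpM2l // lef_pV2 ?posrE ?subr_gt0 ?ltr_pdivrMr ?mul1r //.
  + by rewrite lerD2l lerN2 ler_pM2r ?invr_gt0 // ltW.
  + exact: lt_trans wd zdr.
- by have [] := psum_ex (lt_trans (wr _ wd) zdr) HK.
exists l => //.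
have dm n : cder (cpoly c n) z (\sum_(k < n) c k * (k%:R * z ^+ k.-1)).
  have h (k : 'I_n) : cder (fun z => c k * z ^+ k) z (c k * (k%:R * z ^+ k.-1)).
    by apply: cderZ; exact: cderX.
  exact: cder_sum h.
have := climZ z (Hm _ dm).
rewrite (_ : (fun n => _) = (fun n => cpoly (fun k => k%:R * c k) n z)) //.
apply/funext => n; rewrite /cpoly mulr_sumr; apply: eq_bigr => k _.
case: (val k) => [|j]; first by rewrite !(mul0r, mulr0).
by rewrite /= exprS; ring.
Qed.

(** The coefficients are read at a fixed radius [s], possibly smaller than |z|; the remainder is
    estimated on a circle between |z| and [T], and [coef_indep] identifies the two sets of
    coefficients. *)
Lemma holo_psum g (T M s : R) z : 0 < s -> s < T ->
  (forall z, nc z < T -> cdiff g z) -> (forall z, nc z < T -> nc (g z) <= M) ->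
  nc z < T -> g z = psum (coef g s) z.
Proof.
move=> s0 sT H HM zT; have pz := nc_ge0 z.
pose r := (nc z + T) / 2; have zr : nc z < r by rewrite /r; lra.
have rT : r < T by rewrite /r; lra.
have r0 : 0 < r by lra.
apply/esym/psum_eq => e e0.
have q0 : 0 <= nc z / r by rewrite divr_ge0 // ltW.
have q1 : nc z / r < 1 by rewrite ltr_pdivrMr // mul1r.
have Hr w : nc w = r -> nc (g w) <= M by move=> wr; apply: HM; rewrite wr.
have M0 : 0 <= M by apply: le_trans (nc_ge0 _) (HM z zT).
have k0 : 0 <= r / (r - nc z) by rewrite divr_ge0 ?subr_ge0 // ltW.
have : (nc z / r) ^+ n @[n --> \oo] --> (0 : R).
  by apply: cvg_expr; rewrite ger0_norm.
pose D := M * (r / (r - nc z)); have D0 : 0 <= D by rewrite mulr_ge0.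
have d0 : 0 < e / (D + 1) by rewrite divr_gt0 //; lra.
move=> /cvgrPdist_le /(_ _ d0)[N _ HN]; exists N => n /HN /=.
rewrite sub0r normrN ger0_norm ?exprn_ge0 // => h.
rewrite ncC; have := taylor_rem n zr rT H Hr.
rewrite (_ : \sum_(k < n) coef g r k * z ^+ k = cpoly (coef g s) n z); last first.
  by apply: eq_bigr => k _; rewrite (coef_indep k H r0 s0 rT sT).
move=> k; apply: le_trans k _; rewrite mulrAC -/D.
apply: le_trans (ler_wpM2l D0 h) _.
by rewrite mulrCA ger_pMr // ler_pdivrMr; lra.
Qed.

Lemma coef_bound g (T M s r : R) k : 0 < s -> s < T ->
  (forall z, nc z < T -> cdiff g z) -> (forall z, nc z < T -> nc (g z) <= M) ->
  0 < r -> r < T -> nc (coef g s k) * r ^+ k <= M.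
Proof.
move=> s0 sT H HM r0 rT; rewrite (coef_indep k H s0 r0 sT rT).
apply: coef_le => //; first exact: rcont_circ_diff (ltW r0) rT H.
by move=> z zr; apply: HM; rewrite zr.
Qed.

Lemma psum_cont (c : nat -> C) (K rho : R) z : nc z < rho ->
  (forall k, nc (c k) * rho ^+ k <= K) -> ccont (psum c) z.
Proof. by move=> zr HK; have [l /cder_cont] := psum_cder zr HK. Qed.

Lemma rcont_psum (c : nat -> C) (K rho r : R) : 0 < r -> r < rho ->
  (forall k, nc (c k) * rho ^+ k <= K) -> rcont (oncircle (psum c) r).
Proof.
move=> r0 rr HK; apply: rcont_oncircle; first exact: ltW.
by move=> z zr; apply: psum_cont HK; rewrite zr.
Qed.

(** Partial sums have the right coefficient as soon as n > k, and the coefficient of the tail is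
    bounded by its supremum on the circle over r^k. *)
Lemma coef_psum (c : nat -> C) (K rho r : R) k : 0 < r -> r < rho ->
  (forall k, nc (c k) * rho ^+ k <= K) -> coef (psum c) r k = c k.
Proof.
move=> r0 rr HK.
have cp := rcont_psum r0 rr HK.
have K0 : 0 <= K by have := le_trans (mulr_ge0 (nc_ge0 _) ler01) (HK 0%N).
have rho0 : 0 < rho by lra.
have q0 : 0 <= r / rho by rewrite divr_ge0 // ltW.
have q1 : r / rho < 1 by rewrite ltr_pdivrMr // mul1r.
have rk : 0 < r ^+ k by rewrite exprn_gt0.
apply/eqP; rewrite -subr_eq0; apply/eqP/le0_nc_eq => e e0.
have : (r / rho) ^+ n @[n --> \oo] --> (0 : R).
  by apply: cvg_expr; rewrite ger0_norm.
pose D := K / (1 - r / rho); have D0 : 0 <= D by rewrite divr_ge0 // subr_ge0 ltW.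
have d0 : 0 < e * r ^+ k / (D + 1) by rewrite divr_gt0 ?mulr_gt0 //; lra.
move=> /cvgrPdist_le /(_ _ d0)[N _ HN].
pose n := maxn N k.+1; have := HN n (leq_maxl _ _).
rewrite /= sub0r normrN ger0_norm ?exprn_ge0 // => h.
have kn : (k < n)%N by exact: leq_maxr.
have E : coef (cpoly c n) r k = c k by rewrite coef_cpoly // kn.
rewrite -[X in _ - X]E -coefB //; last exact: rcont_cpoly.
rewrite -(ler_pM2r rk); apply: coef_le => //; first exact: rcontB (rcont_cpoly _ _ _).
move=> z zr; have zrho : nc z < rho by rewrite zr.
apply: le_trans ((psum_ex zrho HK).2 n) _; rewrite zr mulrAC -/D.
apply: le_trans (ler_wpM2l D0 h) _.
by rewrite mulrCA ger_pMr ?mulr_gt0 // ler_pdivrMr; lra.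
Qed.

(** Each of the k terms q^i with i < k is at least q^k. *)
Lemma natgeo_le (q : R) k : 0 <= q -> q < 1 -> k%:R * q ^+ k <= (1 - q)^-1.
Proof.
move=> q0 q1; have := geo_sum_le q0 q1 (leq0n k); rewrite expr0 mul1r.
apply: le_trans; rewrite big_mkord.
rewrite mulr_natl -[X in _ *+ X](card_ord k) -sumr_const; apply: ler_sum => i _.
apply: (ler_wiXn2l q0 (ltW q1)); exact: ltnW (ltn_ord i).
Qed.

(** [D] is given as a pointwise derivative only; its continuity on the circle, needed for [bessel],
    is obtained together with its coefficients by identifying z D(z) with a power series. *)
Lemma deriv_coef g (D : C -> C) (T M r : R) k : 0 < r -> r < T ->
  (forall z, nc z < T -> cder g z (D z)) -> (forall z, nc z < T -> nc (g z) <= M) ->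
  rcont (oncircle (fun z => z * D z) r) /\
  coef (fun z => z * D z) r k = k%:R * coef g r k.
Proof.
move=> r0 rT H HM.
have Hd z : nc z < T -> cdiff g z by exists (D z); exact: H.
pose c := coef g r; pose c' k := k%:R * c k.
(* The coefficients of [g] are bounded at [rho]; the extra factor k is absorbed in passing from
   [rho] down to [s], which still exceeds [r]. *)
pose rho := (r + T) / 2; pose s := (r + rho) / 2.
have rrho : r < rho by rewrite /rho; lra.
have rhoT : rho < T by rewrite /rho; lra.
have rs : r < s by rewrite /s; lra.
have srho : s < rho by rewrite /s; lra.
have rho0 : 0 < rho by lra.
have s0 : 0 < s by lra.
have HK j : nc (c j) * rho ^+ j <= M by exact: coef_bound rT Hd HM _ _.
have M0 : 0 <= M by have := le_trans (mulr_ge0 (nc_ge0 _) ler01) (HK 0%N).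
have q0 : 0 <= s / rho by rewrite divr_ge0 // ltW.
have q1 : s / rho < 1 by rewrite ltr_pdivrMr // mul1r.
have HK' j : nc (c' j) * s ^+ j <= M * (1 - s / rho)^-1.
  rewrite /c' ncM nc_nat.
  have -> : j%:R * nc (c j) * s ^+ j = nc (c j) * rho ^+ j * (j%:R * (s / rho) ^+ j).
    have : rho ^+ j != 0 by rewrite expf_neq0 // gt_eqF.
    rewrite (expr_div_n s rho j); move: (rho ^+ j) (s ^+ j) => A B A0.
    by field.
  apply: ler_pM => //; first by rewrite mulr_ge0 ?nc_ge0 // exprn_ge0 // ltW.
    by rewrite mulr_ge0 // exprn_ge0.
  exact: natgeo_le.
have E z : nc z = r -> z * D z = psum c' z.
  move=> zr; have zrho : nc z < rho by rewrite zr.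
  have [l Hl1 Hl2] := psum_cder zrho HK.
  rewrite (psum_eq Hl2); congr (z * _).
  apply: cder_uniq (H z _) _; first by rewrite zr.
  have pr : 0 < T - r by rewrite subr_gt0.
  apply: cder_ext pr _ Hl1 => w wz; apply/esym.
  by apply: (holo_psum r0 rT Hd HM); have := ncBl w z; lra.
have Eo : oncircle (fun z => z * D z) r = oncircle (psum c') r.
  by apply/funext => t; apply: E; rewrite nc_circle // ltW.
split; first by rewrite Eo; exact: rcont_psum r0 rs HK'.
rewrite -[RHS]/(c' k) -(coef_psum k r0 rs HK').
by apply: cmean_ext => [|z zr]; [exact: ltW | rewrite E].
Qed.

End CircleMean.

(** * Holomorphic families *)

Section HolomorphicFamilies.
Variable R : realType.
Local Notation C := R[i].
Implicit Types (e z h l : C).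

Lemma coefZ (g : C -> C) (a : C) (r : R) k : 0 < r -> rcont (oncircle g r) ->
  coef (fun z => a * g z) r k = a * coef g r k.
Proof.
move=> r0 cg; rewrite /coef -cmeanZ; last exact: rcontM cg (rcont_circ_inv k r0).
by apply: cmean_eq => z; rewrite mulrA.
Qed.

(** Differentiation under the mean: the second order remainder in [e] is uniform on the circle, and
    the derivative [L] is continuous there, being a uniform limit of difference quotients. *)
Lemma coef_holo (G : C -> C -> C) e0 (d r M : R) k : 0 < d -> 0 < r ->
  (forall e, nc (e - e0) < d -> rcont (oncircle (G e) r)) ->
  (forall t e, nc t = r -> nc (e - e0) < d -> cdiff (fun e => G e t) e) ->
  (forall t e, nc t = r -> nc (e - e0) < d -> nc (G e t) <= M) ->
  cdiff (fun e => coef (G e) r k) e0.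
Proof.
move=> d0 r0 Gc Gd GM; pose K := 8 * M / d ^+ 2.
have /choice[L HL] : forall t, exists l, nc t = r -> forall a, nc a <= d / 4 ->
    nc (G (e0 + a) t - G e0 t - a * l) <= K * nc a ^+ 2.
  move=> t; have [tr|tr] := pselect (nc t = r); last by exists 0.
  by have [l [_ _ _ h]] := schwarz_at d0 (fun e => @Gd t e tr) (fun e => @GM t e tr); exists l.
have M0 : 0 <= M.
  apply: le_trans (nc_ge0 _) (GM (r%:C * cis 0) e0 _ _).
    by rewrite nc_circle // ltW.
  by rewrite subrr nc0.
have K0 : 0 <= K by rewrite divr_ge0 ?sqr_ge0 // mulr_ge0.
have e0d a : nc a < d -> nc (e0 + a - e0) < d by rewrite (addrC e0) addrK.
have cL : rcont (oncircle L r).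
  move=> x eta eta0; pose T := Num.min (d / 4) (eta / (4 * (K + 1))).
  have K1 : 0 < 4 * (K + 1) by lra.
  have T0 : 0 < T by rewrite /T lt_min !divr_gt0.
  have Td : T <= d / 4 by rewrite /T ge_min lexx.
  have TK : K * T <= eta / 4.
    have : T * (4 * (K + 1)) <= eta by rewrite -ler_pdivlMr // /T ge_min lexx orbT.
    by clear -T0; nra.
  pose a : C := T%:C; have na : nc a = T by rewrite nc_real gtr0_norm.
  have a0 : a != 0 by rewrite -nc_gt0 na.
  have cQ : rcont (fun t => oncircle (G (e0 + a)) r t - oncircle (G e0) r t).
    apply: rcontB; apply: Gc; last by rewrite subrr nc0.
    by apply: e0d; rewrite na; lra.
  have et : 0 < eta / 4 * T by rewrite mulr_gt0 // divr_gt0.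
  have [s s0 Hs] := cQ x _ et; exists s => // y /Hs k1.
  have ad : nc a <= d / 4 by rewrite na.
  have HLt t : nc (oncircle (G (e0 + a)) r t - oncircle (G e0) r t - a * oncircle L r t) <= K * T ^+ 2.
    by have := HL (r%:C * cis t) (nc_circle t (ltW r0)) a ad; rewrite na.
  have kx := HLt x; have ky := HLt y.
  rewrite -(ler_pM2l T0) -{1}na -ncM.
  have -> : a * (oncircle L r y - oncircle L r x) =
    (oncircle (G (e0 + a)) r x - oncircle (G e0) r x - a * oncircle L r x) -
    (oncircle (G (e0 + a)) r y - oncircle (G e0) r y - a * oncircle L r y) +
    (oncircle (G (e0 + a)) r y - oncircle (G e0) r y -
    (oncircle (G (e0 + a)) r x - oncircle (G e0) r x)) by ring.
  apply: le_trans (ncD _ _) _; apply: le_trans (lerD (ncB _ _) (lexx _)) _.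
  have := ler_wpM2r (ltW T0) TK; rewrite -mulrA -expr2.
  have pT : 0 <= T * eta by rewrite mulr_ge0 // ltW.
  by move: k1 kx ky pT; clear; lra.
have rk : 0 < r ^+ k by rewrite exprn_gt0.
exists (coef L r k) => eta eta0.
exists (Num.min (d / 4) (eta * r ^+ k / (K + 1))).
  by rewrite lt_min !divr_gt0 ?mulr_gt0 //; lra.
move=> h; rewrite lt_min => /andP[/ltW h1].
rewrite ltr_pdivlMr => [h2|]; last by lra.
have cGh : rcont (oncircle (G (e0 + h)) r) by apply/Gc/e0d; lra.
have cG0 : rcont (oncircle (G e0) r) by apply: Gc; rewrite subrr nc0.
have chL : rcont (oncircle (fun z => h * L z) r) by exact: rcontM (rcont_cst h) cL.
rewrite -coefZ // -coefB // -coefB //; last exact: rcontB cGh cG0.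
rewrite -(ler_pM2r rk); apply: coef_le => //.
  exact: rcontB (rcontB cGh cG0) chL.
move=> z zr; apply: le_trans (HL z zr h h1) _.
rewrite expr2 mulrA [leRHS]mulrAC ler_wpM2r ?nc_ge0 //.
by apply: le_trans (ltW h2); rewrite mulrC ler_wpM2l ?nc_ge0 // lerDl.
Qed.

(** Separate holomorphy and a bound give joint differentiability. The point is that the partial
    derivative [A l] in [e] at height z0 + l is close to [A 0]; this is seen by comparing difference
    quotients at one fixed increment. *)
Lemma osgood (g : C -> C -> C) e0 z0 (d M : R) : 0 < d ->
  (forall e z, nc (e - e0) < d -> nc (z - z0) < d ->
     [/\ cdiff (fun e => g e z) e, cdiff (g e) z & nc (g e z) <= M]) ->
  exists a b, [/\ cder (fun e => g e z0) e0 a, cder (g e0) z0 b &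
   forall eta : R, 0 < eta -> exists2 r : R, 0 < r & forall h l, nc h < r -> nc l < r ->
     nc (g (e0 + h) (z0 + l) - g e0 z0 - h * a - l * b) <= eta * (nc h + nc l)].
Proof.
move=> d0 H; pose K := 8 * M / d ^+ 2.
have z0d : nc (z0 - z0) < d by rewrite subrr nc0.
have e0d : nc (e0 - e0) < d by rewrite subrr nc0.
have M0 : 0 <= M by have [_ _] := H _ _ e0d z0d; exact: le_trans (nc_ge0 _).
have K0 : 0 <= K by rewrite divr_ge0 ?sqr_ge0 // mulr_ge0.
have M4 : 0 <= 4 * M / d by rewrite divr_ge0 ?mulr_ge0 // ltW.
have shift (x y : C) : nc y < d -> nc (x + y - x) < d by rewrite (addrC x) addrK.
have ez l : nc l < d -> exists a, cder (fun e => g e (z0 + l)) e0 a /\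
    forall h, nc h <= d / 4 ->
    nc (g (e0 + h) (z0 + l) - g e0 (z0 + l) - h * a) <= K * nc h ^+ 2.
  move=> ld; have zl := shift z0 _ ld.
  have [|| a [h1 _ _ h4]] := @schwarz_at _ (fun e => g e (z0 + l)) e0 d M d0.
  - by move=> e ed; have [] := H _ _ ed zl.
  - by move=> e ed; have [] := H _ _ ed zl.
  by exists a.
have /choice[A HA] : forall l, exists a, nc l < d ->
    cder (fun e => g e (z0 + l)) e0 a /\
    forall h, nc h <= d / 4 ->
    nc (g (e0 + h) (z0 + l) - g e0 (z0 + l) - h * a) <= K * nc h ^+ 2.
  move=> l; have [ld|nl] := pselect (nc l < d); last by exists 0.
  by have [a] := ez l ld; exists a.
have ze e : nc (e - e0) < d -> exists b, [/\ cder (g e) z0 b,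
    forall l, nc l <= d / 4 -> nc (g e (z0 + l) - g e z0) <= 4 * M / d * nc l &
    forall l, nc l <= d / 4 ->
    nc (g e (z0 + l) - g e z0 - l * b) <= K * nc l ^+ 2].
  move=> ed; have [|| b [h1 _ h3 h4]] := @schwarz_at _ (g e) z0 d M d0.
  - by move=> z zd; have [] := H _ _ ed zd.
  - by move=> z zd; have [] := H _ _ ed zd.
  by exists b.
have [b [Hb1 Hb2 Hb3]] := ze e0 e0d.
have d00 : nc (0 : C) < d by rewrite nc0.
have [HA1 HA2] := HA 0 d00; rewrite addr0 in HA1 HA2.
exists (A 0), b; split => // eta eta0.
(* The fixed increment: each of the two quotients misses its derivative by at most eta / 8. The
   radius [r1] below makes the variation in [l], of Lipschitz constant 4 M / d, at most eta T /
   8. *)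
pose T := Num.min (d / 4) (eta / (8 * (K + 1))).
have K1 : 0 < 8 * (K + 1) by lra.
have T0 : 0 < T by rewrite /T lt_min !divr_gt0.
have Td : T <= d / 4 by rewrite /T ge_min lexx.
have TK : K * T <= eta / 8.
  have : T * (8 * (K + 1)) <= eta by rewrite -ler_pdivlMr // /T ge_min lexx orbT.
  by clear -T0; nra.
pose a : C := T%:C; have na : nc a = T by rewrite nc_real gtr0_norm.
have ad : nc a <= d / 4 by rewrite na.
have ad' : nc (e0 + a - e0) < d by apply: shift; lra.
have [_ [_ Ha2 _]] := ze _ ad'.
pose r1 := eta * T / (32 * (M / d + 1)).
have Md : 0 <= M / d by rewrite divr_ge0 // ltW.
have r10 : 0 < r1 by rewrite divr_gt0 ?mulr_gt0 //; lra.
exists (Num.min (d / 4) (Num.min r1 (eta / (2 * (K + 1))))).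
  by rewrite !lt_min r10 !divr_gt0 //; lra.
move=> h l; rewrite !lt_min => /andP[/ltW h1 /andP[_ h3]] /andP[/ltW l1 /andP[l2 l3]].
have ld : nc l < d by lra.
have [_ HAl] := HA l ld.
have AA : nc (A l - A 0) <= eta / 2.
  rewrite -(ler_pM2l T0) -{1}na -ncM.
  have -> : a * (A l - A 0) = ((g (e0 + a) z0 - g e0 z0 - a * A 0) -
    (g (e0 + a) (z0 + l) - g e0 (z0 + l) - a * A l)) +
    ((g (e0 + a) (z0 + l) - g (e0 + a) z0) - (g e0 (z0 + l) - g e0 z0)) by ring.
  apply: le_trans (ncD _ _) _; apply: le_trans (lerD (ncB _ _) (ncB _ _)) _.
  have k1 := HA2 a ad; have k2 := HAl a ad; have k3 := Ha2 l l1; have k4 := Hb2 l l1.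
  have k5 : 4 * M / d * nc l <= eta * T / 8.
    have : nc l * (32 * (M / d + 1)) <= eta * T.
      by rewrite -ler_pdivlMr ?(ltW l2) //; lra.
    have := nc_ge0 l; have -> : 4 * M / d = 4 * (M / d) by rewrite mulrA.
    by move: (M / d) Md => q q0; clear -q0; nra.
  have := ler_wpM2r (ltW T0) TK; rewrite -mulrA -expr2.
  rewrite na in k1 k2.
  have pT : 0 <= T * eta by rewrite mulr_ge0 // ltW.
  by move: k1 k2 k3 k4 k5 pT; clear; lra.
have -> : g (e0 + h) (z0 + l) - g e0 z0 - h * A 0 - l * b =
  (g (e0 + h) (z0 + l) - g e0 (z0 + l) - h * A l) +
  (h * (A l - A 0) + (g e0 (z0 + l) - g e0 z0 - l * b)) by ring.
apply: le_trans (ncD _ _) _; apply: le_trans (lerD (lexx _) (ncD _ _)) _.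
have k1 := HAl h h1; have k2 := Hb3 l l1; rewrite (ncM h).
have q (x : C) : nc x < eta / (2 * (K + 1)) -> K * nc x ^+ 2 <= eta / 2 * nc x.
  rewrite ltr_pdivlMr => [xe|]; last by lra.
  rewrite expr2 mulrA ler_wpM2r ?nc_ge0 //.
  by have := nc_ge0 x; clear -xe; nra.
have := q h h3; have := q l l3; have := ler_wpM2l (nc_ge0 h) AA.
have pl : 0 <= eta * nc l by rewrite mulr_ge0 ?nc_ge0 // ltW.
by move: k1 k2 pl; clear; lra.
Qed.

Lemma cdiff_prod (T : Type) (s : seq T) (u : T -> C -> C) e :
  (forall i, cdiff (u i) e) -> cdiff (fun t => \prod_(i <- s) u i t) e.
Proof.
move=> H; elim: s => [|i s IH].
  by under eq_fun do rewrite big_nil; exact: cdiff_cst.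
by under eq_fun do rewrite big_cons; exact: cdiffM (H i) IH.
Qed.

Lemma cdiff_det m (A : C -> 'M[C]_m) e :
  (forall i j, cdiff (fun t => A t i j) e) -> cdiff (fun t => \det (A t)) e.
Proof.
move=> H; rewrite /determinant; apply: cdiff_sum => s.
apply: cdiffM; first exact: cdiff_cst.
exact: (@cdiff_prod _ (index_enum _) (fun i t => A t i (perm.fun_of_perm s i)) e).
Qed.

(** Cramer's formula: cofactors and determinant are polynomials in the entries. *)
Lemma cdiff_inv m (A : C -> 'M[C]_m) e (d : R) i j : 0 < d ->
  (forall t, nc (t - e) < d -> A t \in unitmx) ->
  (forall i j, cdiff (fun t => A t i j) e) -> cdiff (fun t => invmx (A t) i j) e.
Proof.
move=> d0 U H.
apply: (@cdiff_ext _ (fun t => (\det (A t))^-1 * (\adj (A t)) i j) _ _ d) => //.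
  by move=> w /U Aw; rewrite /invmx Aw !mxE.
apply: cdiffM.
  apply: cdiffV; last exact: cdiff_det.
  by have := U e; rewrite subrr nc0 unitmxE unitfE; apply.
under eq_fun do rewrite mxE; rewrite /cofactor.
apply: cdiffM; first exact: cdiff_cst.
apply: cdiff_det => i' j'; under eq_fun do rewrite !mxE; exact: H.
Qed.

End HolomorphicFamilies.

(** * Inequalities between sums and sums of squares *)

Section SquareSums.
Variable R : realType.
Local Notation C := R[i].

Lemma sqr_sum_le (m : nat) (x : 'I_m -> R) :
  (\sum_i x i) ^+ 2 <= m%:R * \sum_i x i ^+ 2.
Proof.
have -> : m%:R * \sum_i x i ^+ 2 = \sum_i \sum_j (x i ^+ 2 / 2 + x j ^+ 2 / 2).
  have E i : \sum_j (x i ^+ 2 / 2 + x j ^+ 2 / 2) = m%:R * (x i ^+ 2 / 2) + \sum_j x j ^+ 2 / 2.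
    by rewrite big_split sumr_const card_ord mulr_natl.
  under [RHS]eq_bigr do rewrite E.
  by rewrite big_split sumr_const card_ord /= -mulr_sumr -!mulr_suml -mulr_natl; field.
rewrite expr2 big_distrlr; apply: ler_sum => i _; apply: ler_sum => j _.
by have := sqr_ge0 (x i - x j); rewrite sqrrB /=; lra.
Qed.

Lemma sum_sqr_le (m : nat) (x : 'I_m -> R) : (forall i, 0 <= x i) ->
  \sum_i x i ^+ 2 <= (\sum_i x i) ^+ 2.
Proof.
move=> H; rewrite [leRHS]expr2 mulr_suml; apply: ler_sum => i _.
rewrite expr2 ler_wpM2l // (bigD1 i) //= lerDl sumr_ge0 //.
Qed.

(** By telescoping 1/(y + 1)^2 <= 1/y - 1/(y + 1); the induction therefore carries the sharper bound
    2 - 1/(m + 1) for the terms up to k = m + 1. *)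
Lemma sum_inv_sqr m : \sum_(k < m) ((0 < k)%N%:R / k%:R ^+ 2 : R) <= 2.
Proof.
suff H : \sum_(k < m.+2) ((0 < k)%N%:R / k%:R ^+ 2 : R) <= 2 - m.+1%:R^-1.
  apply: le_trans (_ : _ <= 2 - m.+1%:R^-1) _; last by rewrite lerBlDr lerDl invr_ge0.
  apply: le_trans H; rewrite 2!big_ord_recr /= -addrA lerDl.
  by rewrite addr_ge0 // divr_ge0 ?sqr_ge0.
elim: m => [|m IH].
  by rewrite !big_ord_recr big_ord0 /= expr1n invr1; lra.
rewrite big_ord_recr /=; apply: le_trans (lerD IH (lexx _)) _.
have p1 : 0 < m.+1%:R :> R by rewrite ltr0n.
have -> : m.+2%:R = m.+1%:R + 1 :> R by rewrite -natr1.
move: m.+1%:R p1 => y y0.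
have y1 : 0 < y + 1 by lra.
rewrite -subr_ge0.
have -> : 2 - (y + 1)^-1 - (2 - y^-1 + 1 / (y + 1) ^+ 2) = (y * (y + 1) ^+ 2)^-1.
  by field; rewrite !gt_eqF.
by rewrite invr_ge0 mulr_ge0 ?sqr_ge0 // ltW.
Qed.

(** Cauchy-Schwarz against 1/k, in the form x_k <= (q/2) / k^2 + (k x_k)^2 / (2q): the two sums are
    at most q and q/2. The term k = 0 carries no weight, hence [x 0 = 0]. *)
Lemma l1_le_l2 m (x : nat -> R) (q : R) : 0 < q -> x 0%N = 0 ->
  \sum_(k < m) (k%:R * x k) ^+ 2 <= q ^+ 2 -> \sum_(k < m) x k <= 2 * q.
Proof.
move=> q0 x0 H.
have h1 : \sum_(k < m) x k <= \sum_(k < m) (q / 2 * ((0 < k)%N%:R / k%:R ^+ 2) +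
    (2 * q)^-1 * (k%:R * x k) ^+ 2).
  apply: ler_sum => -[[|k] km] _ /=.
    by rewrite x0 !mul0r expr0n !mulr0 addr0.
  have k0 : 0 < k.+1%:R :> R by rewrite ltr0n.
  move: k.+1%:R k0 (x k.+1) => y y0 z.
  rewrite -subr_ge0.
  have -> : q / 2 * (1 / y ^+ 2) + (2 * q)^-1 * (y * z) ^+ 2 - z =
    (2 * q)^-1 * (q / y - y * z) ^+ 2 by field; rewrite !gt_eqF.
  by rewrite mulr_ge0 ?sqr_ge0 // invr_ge0 mulr_ge0 // ltW.
apply: le_trans h1 _; rewrite big_split -!mulr_sumr.
have q2 : 0 <= q / 2 by lra.
have q3 : 0 <= (2 * q)^-1 by rewrite invr_ge0; lra.
have k1 := ler_wpM2l q2 (sum_inv_sqr m); have k2 := ler_wpM2l q3 H.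
have E : (2 * q)^-1 * q ^+ 2 = q / 2 by field; rewrite gt_eqF.
by rewrite E in k2; move: k1 k2; rewrite /=; lra.
Qed.

Lemma cpoly_l1 (c : nat -> C) m (z : C) :
  nc (cpoly c m z) <= \sum_(k < m) nc (c k) * nc z ^+ k.
Proof.
by apply: le_trans (nc_sum _ _ _) _; apply: ler_sum => k _; rewrite ncM ncX.
Qed.

Lemma cpoly_diff (c : nat -> C) m k (z : C) : (k <= m)%N -> nc z <= 1 ->
  nc (cpoly c m z - cpoly c k z) <= (\sum_(l < m) nc (c l)) * nc z ^+ k.
Proof.
move=> km z1; rewrite /cpoly -!(big_mkord xpredT (fun l => c l * z ^+ l)).
rewrite (big_cat_nat (n := k)) //= addrAC subrr add0r.
apply: le_trans (nc_sum _ _ _) _; rewrite mulr_suml.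
rewrite -(big_mkord xpredT (fun l => nc (c l) * nc z ^+ k)).
rewrite [leRHS](big_cat_nat (n := k)) //=.
have h1 : 0 <= \sum_(0 <= i < k) nc (c i) * nc z ^+ k.
  by apply: sumr_ge0 => i _; rewrite mulr_ge0 ?exprn_ge0 ?nc_ge0.
suff : \sum_(k <= i < m) nc (c i * z ^+ i) <= \sum_(k <= i < m) nc (c i) * nc z ^+ k by lra.
rewrite big_nat_cond [leRHS]big_nat_cond; apply: ler_sum => i /andP[/andP[ki _] _].
rewrite ncM ncX ler_wpM2l ?nc_ge0 //.
exact: (ler_wiXn2l (nc_ge0 z) z1).
Qed.

End SquareSums.

(** * Estimates for the right-hand side *)

Section VectorEstimates.
Variables (R : realType) (n : nat).
Local Notation C := R[i].
Local Notation V := 'rV[C]_n.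
Local Notation X := (C * C * V)%type.
Implicit Types (u v : V) (j : 'I_n).

Definition vn (v : V) : R := \sum_j nc (v 0 j).

Lemma vn_ge0 v : 0 <= vn v.
Proof. by apply: sumr_ge0 => j _; exact: nc_ge0. Qed.

Lemma vnD u v : vn (u + v) <= vn u + vn v.
Proof. by rewrite -big_split; apply: ler_sum => j _; rewrite mxE ncD. Qed.

Lemma vnZ a v : vn (a *: v) = nc a * vn v.
Proof. by rewrite mulr_sumr; apply: eq_bigr => j _; rewrite mxE ncM. Qed.

Lemma vnN v : vn (- v) = vn v.
Proof. by apply: eq_bigr => j _; rewrite mxE ncN. Qed.

Lemma vnB u v : vn (u - v) <= vn u + vn v.
Proof. by rewrite -(vnN v) vnD. Qed.

Lemma vnC u v : vn (u - v) = vn (v - u).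
Proof. by rewrite -vnN opprB. Qed.

Lemma vn0 : vn 0 = 0.
Proof. by rewrite /vn big1 // => j _; rewrite mxE nc0. Qed.

Lemma nc_le_vn v j : nc (v 0 j) <= vn v.
Proof.
by rewrite /vn (bigD1 j) //= lerDl sumr_ge0 // => i _; exact: nc_ge0.
Qed.

Lemma vn_le v (B : R) : (forall j, nc (v 0 j) <= B) -> vn v <= n%:R * B.
Proof.
move=> H; apply: le_trans (ler_sum _ (fun j _ => H j)) _.
by rewrite sumr_const card_ord mulr_natl.
Qed.

Lemma vn_eq0 v : vn v <= 0 -> v = 0.
Proof.
move=> H; apply/rowP => j; rewrite mxE; apply: le0_nc_eq => e e0.
exact: le_trans (le_trans (nc_le_vn v j) H) (ltW e0).
Qed.

Implicit Types x y : X.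

Definition sz (x : X) : R := nc x.1.1 + nc x.1.2 + vn x.2.

Lemma sz_ge0 x : 0 <= sz x.
Proof. by rewrite !addr_ge0 ?nc_ge0 ?vn_ge0. Qed.

Lemma szD x y : sz (x + y) <= sz x + sz y.
Proof.
rewrite /sz /=; have h1 := ncD x.1.1 y.1.1; have h2 := ncD x.1.2 y.1.2.
have := vnD x.2 y.2; lra.
Qed.

Lemma szZ a x : sz (a *: x) = nc a * sz x.
Proof. by rewrite /sz /= vnZ !ncM; ring. Qed.

Lemma szN x : sz (- x) = sz x.
Proof. by rewrite /sz /= vnN !ncN. Qed.

Lemma szB x y : sz (x - y) <= sz x + sz y.
Proof. by rewrite -(szN y) szD. Qed.

Lemma sz0 : sz 0 = 0.
Proof. by rewrite -[X in sz X](scale0r (0 : X)) szZ nc0 mul0r. Qed.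

Lemma sz_eq0 x : sz x <= 0 -> x = 0.
Proof.
case: x => [[a b] v]; rewrite /sz /= => H.
have pa := nc_ge0 a; have pb := nc_ge0 b; have pv := vn_ge0 v.
have -> : v = 0 by apply: vn_eq0; lra.
have /eqP -> : a == 0 by rewrite -nc_eq0 eq_le pa andbT; lra.
have /eqP -> // : b == 0 by rewrite -nc_eq0 eq_le pb andbT; lra.
Qed.

Variables (F : X -> V) (D : X -> X -> V) (s M : R).
Hypothesis s0 : 0 < s.
Hypothesis D_lin : forall x a (u v : X), D x (a *: u + v) = a *: D x u + D x v.
Hypothesis F_der : forall x (v : X) j, sz x < s ->
  cder (fun t => F (x + t *: v) 0 j) 0 (D x v 0 j).
Hypothesis F_bnd : forall x j, sz x < s -> nc (F x 0 j) <= M.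

Lemma diff0 x : D x 0 = 0.
Proof.
have := D_lin x (-1) 0 0; rewrite scaler0 add0r scaleN1r addNr.
by [].
Qed.

Lemma bound_ge0 : (0 < n)%N -> 0 <= M.
Proof.
move=> n0; have z0 : sz (0 : X) < s by rewrite sz0.
exact: le_trans (nc_ge0 _) (F_bnd (Ordinal n0) z0).
Qed.

Lemma cder_line x (v : X) j t : sz (x + t *: v) < s ->
  cder (fun w => F (x + w *: v) 0 j) t (D (x + t *: v) v 0 j).
Proof.
move=> /(F_der v j) H e e0; have [d d0 Hd] := H e e0; exists d; first exact: d0.
move=> h hd; have := Hd h hd.
by rewrite scale0r addr0 add0r scalerDl addrA.
Qed.

(** One-variable estimates on the complex line x + t v, which stays in the domain for |t| < s / (2
    sz v). The condition 8 sz v <= s says that t = 1 lies within a quarter of this radius. *)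
Lemma line_schwarz x (v : X) j : 2 * sz x <= s -> 0 < sz v ->
  [/\ nc (D x v 0 j) <= 4 * M / s * sz v,
      8 * sz v <= s -> nc (F (x + v) 0 j - F x 0 j) <= 8 * M / s * sz v &
      8 * sz v <= s -> nc (F (x + v) 0 j - F x 0 j - D x v 0 j) <=
        32 * M / s ^+ 2 * sz v ^+ 2].
Proof.
move=> xs v0.
have sp := s0; have xs1 : sz x < s by have := sz_ge0 x; lra.
pose T := s / (2 * sz v).
have T0 : 0 < T by rewrite divr_gt0 // mulr_gt0.
pose f t := F (x + t *: v) 0 j.
have xt t : nc t < T -> sz (x + t *: v) < s.
  rewrite /T ltr_pdivlMr ?mulr_gt0 // => tT; apply: le_lt_trans (szD _ _) _.
  by rewrite szZ; lra.
have df t : nc t < T -> cdiff f t.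
  by move=> /xt /(@cder_line x v j t) H; eexists; exact: H.
have bf t : nc t < T -> nc (f t) <= M by move=> /xt tT; exact: F_bnd.
have [h1 h2 h3 h4] := schwarz T0 df bf.
have E : coef f (T / 2) 1 = D x v 0 j.
  exact: cder_uniq h1 (F_der v j xs1).
have f0 : f 0 = F x 0 j by rewrite /f scale0r addr0.
have f1 : f 1 = F (x + v) 0 j by rewrite /f scale1r.
have T4 : 8 * sz v <= s -> nc (1 : C) <= T / 4.
  by move=> h; rewrite nc1 /T -mulrA -invfM ler_pdivlMr ?mulr_gt0 //; lra.
split.
- rewrite -E; apply: le_trans h2 _; rewrite le_eqVlt; apply/orP; left; apply/eqP.
  by rewrite /T; field; rewrite !gt_eqF.
- move=> /T4 /h3; rewrite f0 f1 nc1 mulr1 => h; apply: le_trans h _.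
  rewrite le_eqVlt; apply/orP; left; apply/eqP.
  by rewrite /T; field; rewrite !gt_eqF.
- move=> /T4 /h4; rewrite f0 f1 nc1 expr1n mulr1 mul1r E => h; apply: le_trans h _.
  rewrite le_eqVlt; apply/orP; left; apply/eqP.
  by rewrite /T; field; rewrite !gt_eqF.
Qed.

(** [D x v - D y v] is the derivative at t = 0 of F(x + t v) - F(y + t v), which is bounded by the
    Lipschitz estimate for [F]; Cauchy's estimate in t concludes. *)
Lemma diff_lip x y (v : X) j : 4 * sz x <= s -> 4 * sz y <= s -> 8 * sz (x - y) <= s ->
  nc (D x v 0 j - D y v 0 j) <= 64 * M / s ^+ 2 * sz (x - y) * sz v.
Proof.
move=> xs ys xys; have sp := s0.
have [v0|v0] := leP (sz v) 0.
  by rewrite (sz_eq0 v0) !diff0 mxE subrr nc0 sz0 mulr0.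
have [d0|d0] := leP (sz (x - y)) 0.
  have xy : x = y by apply/eqP; rewrite -subr_eq0; apply/eqP; exact: sz_eq0.
  by rewrite xy !subrr nc0 sz0 mulr0 mul0r.
pose T := s / (4 * sz v).
have T0 : 0 < T by rewrite divr_gt0 // mulr_gt0.
have px := sz_ge0 x; have py := sz_ge0 y.
have xt t (z : X) : 4 * sz z <= s -> nc t < T -> 2 * sz (z + t *: v) < s.
  move=> zs; rewrite /T ltr_pdivlMr ?mulr_gt0 // => tT.
  by have := szD z (t *: v); rewrite szZ; lra.
pose f (z : X) t := F (z + t *: v) 0 j.
have df (z : X) t : 4 * sz z <= s -> nc t < T -> cdiff (f z) t.
  move=> zs tT; have h := xt t z zs tT.
  have zt : sz (z + t *: v) < s by have := sz_ge0 (z + t *: v); lra.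
  by eexists; exact: cder_line zt.
have cf (z : X) : 4 * sz z <= s -> cder (f z) 0 (D z v 0 j).
  by move=> zs; apply: F_der; have := sz_ge0 z; lra.
have [||h1 h2 _ _] := @schwarz _ (fun t => f x t - f y t) T (8 * M / s * sz (x - y)) T0.
- by move=> t tT; apply: cdiffB; exact: df.
- move=> t tT; have h := xt t y ys tT.
  have [_ h3 _] := line_schwarz j (ltW h) d0.
  by have := h3 xys; rewrite (addrAC y) (addrC y (x - y)) subrK.
have E : coef (fun t => f x t - f y t) (T / 2) 1 = D x v 0 j - D y v 0 j.
  apply: cder_uniq h1 _; have := cderD (cf x xs) (cderZ (-1) (cf y ys)).
  by rewrite mulN1r; under eq_fun do rewrite mulN1r.
rewrite -E; apply: le_trans h2 _; rewrite le_eqVlt; apply/orP; left; apply/eqP.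
by rewrite /T; field; rewrite !gt_eqF.
Qed.

Lemma vector_estimates : (0 < n)%N -> exists r K : R, [/\ 0 < r, 0 < K, r < s &
  [/\ forall x (v : X), sz x <= r -> vn (D x v) <= K * sz v,
      forall x y (v : X), sz x <= r -> sz y <= r ->
        vn (D x v - D y v) <= K * sz (x - y) * sz v,
      forall x (v : X), sz x <= r -> sz (x + v) <= r ->
        vn (F (x + v) - F x - D x v) <= K * sz v ^+ 2 &
      forall x (v : X), sz x <= r -> sz (x + v) <= r ->
        vn (F (x + v) - F x) <= K * sz v]].
Proof.
move=> n0; have M0 := bound_ge0 n0; have sp := s0.
(* If x and x + v have size at most s/16, then v has size at most s/8, as [line_schwarz] asks. [K]
   adds up all constants, with 1 to make it positive. *)
pose r := s / 16; pose K := n%:R * (4 * M / s + 8 * M / s + 32 * M / s ^+ 2 + 64 * M / s ^+ 2) + 1.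
have a1 : 0 <= M / s by rewrite divr_ge0 // ltW.
have a2 : 0 <= M / s ^+ 2 by rewrite divr_ge0 // sqr_ge0.
have n1 : 0 <= n%:R :> R by [].
have Kle (B : R) : B <= 4 * M / s + 8 * M / s + 32 * M / s ^+ 2 + 64 * M / s ^+ 2 ->
    n%:R * B <= K.
  by move=> h; rewrite /K; apply: le_trans (ler_wpM2l n1 h) _; rewrite lerDl.
have vsz x (v : X) : sz x <= r -> sz (x + v) <= r -> 8 * sz v <= s.
  move=> h1 h2; have := szB (x + v) x; rewrite addrAC subrr add0r /r in h1 h2 *; lra.
have xsz x : sz x <= r -> 2 * sz x <= s by rewrite /r; lra.
have r0 : 0 < r by rewrite /r; lra.
have rs : r < s by rewrite /r; lra.
have K0 : 0 < K by rewrite /K ltr_wpDl // mulr_ge0 //; lra.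
have v0E (v : X) : sz v <= 0 -> v = 0 /\ sz v = 0.
  by move=> h; split; [exact: sz_eq0 | apply/eqP; rewrite eq_le h sz_ge0].
exists r, K; split => //; split.
- move=> x v xr; have [/v0E[vE v0]|v0] := leP (sz v) 0.
    by rewrite v0 vE diff0 vn0 mulr0.
  apply: le_trans (vn_le (B := 4 * M / s * sz v) _) _.
    by move=> j; have [] := line_schwarz j (xsz _ xr) v0.
  by rewrite mulrA ler_wpM2r ?(ltW v0) // Kle //; lra.
- move=> x y v xr yr.
  apply: le_trans (vn_le (B := 64 * M / s ^+ 2 * sz (x - y) * sz v) _) _.
    move=> j; rewrite !mxE; have := szB x y; rewrite /r in xr yr.
    by move=> h; apply: diff_lip; lra.
  rewrite !mulrA; apply: ler_wpM2r; first exact: sz_ge0.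
  apply: ler_wpM2r; first exact: sz_ge0.
  by have := Kle (64 * M / s ^+ 2); rewrite !mulrA; apply; lra.
- move=> x v xr xvr; have [/v0E[vE v0]|v0] := leP (sz v) 0.
    by rewrite v0 vE diff0 addr0 subrr subr0 vn0 expr0n mulr0.
  apply: le_trans (vn_le (B := 32 * M / s ^+ 2 * sz v ^+ 2) _) _.
    move=> j; rewrite !mxE; have [_ _ h] := line_schwarz j (xsz _ xr) v0.
    exact: h (vsz _ _ xr xvr).
  by rewrite mulrA ler_wpM2r ?sqr_ge0 // Kle //; lra.
- move=> x v xr xvr; have [/v0E[vE v0]|v0] := leP (sz v) 0.
    by rewrite v0 vE addr0 subrr vn0 mulr0.
  apply: le_trans (vn_le (B := 8 * M / s * sz v) _) _.
    move=> j; rewrite !mxE; have [_ h _] := line_schwarz j (xsz _ xr) v0.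
    exact: h (vsz _ _ xr xvr).
  by rewrite mulrA ler_wpM2r ?(ltW v0) // Kle //; lra.
Qed.

End VectorEstimates.

(** * The recursion for the Taylor coefficients *)

Lemma finite_near (R : realType) (T : finType) (Q : T -> R[i] -> Prop) :
  (forall j, exists2 d : R, 0 < d & forall h, nc h < d -> Q j h) ->
  exists2 d : R, 0 < d & forall h, nc h < d -> forall j, Q j h.
Proof.
move=> H; suff [d d0 Hd] : exists2 d : R, 0 < d & forall h, nc h < d ->
    forall j, j \in enum T -> Q j h.
  by exists d => // h hd j; apply: Hd => //; rewrite mem_enum.
elim: (enum T) => [|i s [d d0 Hd]]; first by exists 1.
have [d' d'0 Hd'] := H i; exists (Num.min d d'); first by rewrite lt_min d0.
move=> h; rewrite lt_min => /andP[h1 h2] j; rewrite inE => /orP[/eqP ->|].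
  exact: Hd'.
exact: Hd.
Qed.

Section LocalEquation.
Variables (R : realType) (n : nat).
Local Notation C := R[i].
Local Notation V := 'rV[C]_n.
Local Notation X := (C * C * V)%type.
Implicit Types (u v w : V) (j : 'I_n) (e z : C).

Definition vcder (p : C -> V) t (p' : V) :=
  forall j, cder (fun t => p t 0 j) t (p' 0 j).

Variables (F : X -> V) (D : X -> X -> V) (r K : R).
Hypotheses (r0 : 0 < r) (K0 : 0 < K).
Hypothesis D_lin : forall x a (u v : X), D x (a *: u + v) = a *: D x u + D x v.
Hypothesis D_bnd : forall x (v : X), sz x <= r -> vn (D x v) <= K * sz v.
Hypothesis D_lip : forall x y (v : X), sz x <= r -> sz y <= r ->
  vn (D x v - D y v) <= K * sz (x - y) * sz v.
Hypothesis F_diff : forall x (v : X), sz x <= r -> sz (x + v) <= r ->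
  vn (F (x + v) - F x - D x v) <= K * sz v ^+ 2.
Hypothesis F_lip : forall x (v : X), sz x <= r -> sz (x + v) <= r ->
  vn (F (x + v) - F x) <= K * sz v.
Hypothesis F_00 : forall e, nc e <= r -> F (e, 0, 0) = 0.

(* Acts on row vectors on the right: [w *m jac e = D (e, 0, 0) (0, 0, w)]. *)
Definition jac e : 'M[C]_n := \matrix_(i, j) D (e, 0, 0) (0, 0, delta_mx 0 i) 0 j.

Lemma D_add x (u v : X) : D x (u + v) = D x u + D x v.
Proof. by have := D_lin x 1 u v; rewrite !scale1r. Qed.

Lemma D_zero x : D x 0 = 0.
Proof.
by have := D_lin x (-1) 0 0; rewrite scaler0 add0r scaleN1r addNr.
Qed.

Lemma D_scale x a (u : X) : D x (a *: u) = a *: D x u.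
Proof. by have := D_lin x a u 0; rewrite D_zero !addr0. Qed.

Lemma jac_mul e w : w *m jac e = D (e, 0, 0) (0, 0, w).
Proof.
have -> : (0, 0, w) = \sum_i w 0 i *: (0, 0, delta_mx 0 i) :> X.
  have H (s : seq 'I_n) : \sum_(i <- s) w 0 i *: ((0, 0, delta_mx 0 i) : X) =
      (0, 0, \sum_(i <- s) w 0 i *: delta_mx 0 i).
    elim: s => [|i s IH]; first by rewrite !big_nil.
    rewrite !big_cons IH; by congr (_, _, _); rewrite /= ?scaler0 ?addr0.
  by rewrite H {1}(row_sum_delta w).
have Ds (s : seq 'I_n) : D (e, 0, 0) (\sum_(i <- s) w 0 i *: ((0, 0, delta_mx 0 i) : X)) =
    \sum_(i <- s) w 0 i *: D (e, 0, 0) (0, 0, delta_mx 0 i).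
  elim: s => [|i s IH]; first by rewrite !big_nil D_zero.
  by rewrite !big_cons D_add D_scale IH.
rewrite Ds; apply/rowP => j; rewrite mxE summxE; apply: eq_bigr => i _.
by rewrite !mxE.
Qed.

(** * The nonlinearity and its derivative along curves *)

Definition nonlin e z w : V := F (e, z, w) - w *m jac e.

Lemma sz3 e z w : sz ((e, z, w) : X) = nc e + nc z + vn w.
Proof. by []. Qed.

Lemma jac_bnd e w : nc e <= r -> vn (w *m jac e) <= K * vn w.
Proof.
move=> er; rewrite jac_mul; apply: le_trans (D_bnd _ _) _.
  by rewrite sz3 nc0 vn0 !addr0.
by rewrite sz3 !nc0 !add0r.
Qed.

Lemma jac_lip e e' w : nc e <= r -> nc e' <= r ->
  vn (w *m jac e - w *m jac e') <= K * nc (e - e') * vn w.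
Proof.
move=> er er'; rewrite !jac_mul; apply: le_trans (D_lip _ _ _) _.
- by rewrite sz3 nc0 vn0 !addr0.
- by rewrite sz3 nc0 vn0 !addr0.
have -> : (e, 0, 0) - (e', 0, 0) = (e - e', 0, 0) :> X.
  by congr (_, _, _); rewrite /= subrr.
by rewrite !sz3 !nc0 vn0 !addr0 !add0r.
Qed.

(** The difference is a second order remainder of [F] at (e, z, w2) plus the change of the
    differential between (e, 0, 0) and (e, z, w2). The Lipschitz constant is thus small with z, w1,
    w2, uniformly in e. *)
Lemma nonlin_lip e z w1 w2 : nc e + nc z + vn w1 <= r -> nc e + nc z + vn w2 <= r ->
  vn (nonlin e z w1 - nonlin e z w2) <= 2 * K * (nc z + vn w1 + vn w2) * vn (w1 - w2).
Proof.
move=> h1 h2; set v : X := (0, 0, w1 - w2); set x : X := (e, z, w2).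
have xv : x + v = (e, z, w1).
  by congr (_, _, _); rewrite /= ?addr0 // addrC subrK.
have er : nc e <= r.
  by have := nc_ge0 z; have := vn_ge0 w1; move: h1; lra.
have k1 : vn (F (x + v) - F x - D x v) <= K * sz v ^+ 2.
  by apply: F_diff; rewrite ?xv.
have k2 : vn (D x v - D (e, 0, 0) v) <= K * sz (x - (e, 0, 0)) * sz v.
  by apply: D_lip => //; rewrite sz3 nc0 vn0 !addr0.
have sv : sz v = vn (w1 - w2) by rewrite sz3 !nc0 !add0r.
have sx : sz (x - (e, 0, 0)) = nc z + vn w2.
  have -> : x - (e, 0, 0) = (0, z, w2) :> X by congr (_, _, _); rewrite /= ?subrr ?subr0.
  by rewrite sz3 nc0 add0r.
have -> : nonlin e z w1 - nonlin e z w2 = (F (x + v) - F x - D x v) + (D x v - D (e, 0, 0) v).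
  rewrite /nonlin xv -jac_mul mulmxBl; apply/rowP => j; rewrite !mxE; ring.
apply: le_trans (vnD _ _) _; apply: le_trans (lerD k1 k2) _; rewrite sv sx.
have := vnB w1 w2; have := vn_ge0 (w1 - w2); have := vn_ge0 w1; have := vn_ge0 w2.
have := nc_ge0 z; have kp := K0.
set a := nc z; set b := vn w1; set c := vn w2; set d := vn (w1 - w2).
move=> pa pc pb pd dbc; rewrite expr2 mulrA -mulrDl ler_wpM2r //.
rewrite -mulrDr [2 * K]mulrC -mulrA ler_wpM2l ?(ltW kp) //; lra.
Qed.

Lemma nonlin_bnd e z w : nc e + nc z + vn w <= r -> vn (nonlin e z w) <= 2 * K * r.
Proof.
move=> h; have er : nc e <= r.
  by have := nc_ge0 z; have := vn_ge0 w; move: h; lra.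
have rp := r0; have kp := K0.
rewrite /nonlin (_ : F (e, z, w) = F (e, z, w) - F (e, 0, 0)); last first.
  by rewrite (F_00 er) subr0.
have E : (e, z, w) = (e, 0, 0) + (0, z, w) :> X.
  by congr (_, _, _); rewrite /= ?addr0 ?add0r.
apply: le_trans (vnB _ _) _.
have k1 := jac_bnd w er.
have k2 : vn (F (e, z, w) - F (e, 0, 0)) <= K * sz ((0, z, w) : X).
  by rewrite E; apply: F_lip; rewrite -?E // sz3 nc0 vn0 !addr0.
rewrite sz3 nc0 add0r in k2; apply: le_trans (lerD k2 k1) _.
rewrite -mulrDr [2 * K]mulrC -mulrA ler_wpM2l ?(ltW kp) //.
by have := nc_ge0 z; have := nc_ge0 e; have := vn_ge0 w; move: h; lra.
Qed.

(** Chain rule along a curve through the point x: the quadratic remainder handles the increment [v],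
    the bound on [D x] its deviation from the tangent. *)
Lemma F_curve_cder (a b : C -> C) (p : C -> V) t a' b' p' j :
  cder a t a' -> cder b t b' -> vcder p t p' ->
  nc (a t) + nc (b t) + vn (p t) < r ->
  cder (fun t => F (a t, b t, p t) 0 j) t (D (a t, b t, p t) (a', b', p') 0 j).
Proof.
move=> Ha Hb Hp hx; set x : X := (a t, b t, p t).
pose g s : X := (a s, b s, p s); pose g' : X := (a', b', p').
have rp := r0; have kp := K0.
have n1 : 0 < n.+2%:R :> R by rewrite ltr0n.
have Hg (e : R) : 0 < e -> exists2 d : R, 0 < d & forall h, nc h < d ->
    sz (g (t + h) - g t - h *: g') <= e * nc h.
  move=> e0; have e1 : 0 < e / n.+2%:R by rewrite divr_gt0.
  have [d1 d10 H1] := Ha _ e1; have [d2 d20 H2] := Hb _ e1.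
  have [d3 d30 H3] := finite_near (fun j => Hp j _ e1).
  exists (Num.min (Num.min d1 d2) d3); first by rewrite !lt_min d10 d20.
  move=> h; rewrite !lt_min => /andP[/andP[/H1 k1 /H2 k2] /H3 k3].
  have -> : e * nc h = e / n.+2%:R * nc h + e / n.+2%:R * nc h + n%:R * (e / n.+2%:R * nc h).
    by rewrite -addn2 natrD; field; rewrite -natrD pnatr_eq0 addn2.
  rewrite sz3; apply: lerD; first exact: lerD k1 k2.
  by apply: vn_le => i; rewrite !mxE; exact: k3.
move=> e e0; have sg := sz_ge0 g'.
pose G := sz g' + 1; have G0 : 0 < G by rewrite /G; lra.
(* The value 1 gives sz v <= |h| G; the value e / (2 K) makes the linear error at most half of e
   |h|. *)
have e1 : 0 < Num.min 1 (e / (2 * K)) by rewrite lt_min ltr01 divr_gt0 // mulr_gt0.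
have [d d0 Hd] := Hg _ e1.
pose y := r - sz x; have y0 : 0 < y by rewrite /y subr_gt0.
exists (Num.min d (Num.min (y / G) (e / (2 * K * G ^+ 2)))).
  by rewrite !lt_min d0 !divr_gt0 ?mulr_gt0 ?exprn_gt0.
move=> h; rewrite !lt_min !ltr_pdivlMr ?mulr_gt0 ?exprn_gt0 //.
move=> /andP[/Hd k1 /andP[k2 k3]].
have ph := nc_ge0 h.
pose v := g (t + h) - g t.
have l1 : Num.min 1 (e / (2 * K)) <= 1 :> R by rewrite ge_min lexx.
have l2 : Num.min 1 (e / (2 * K)) <= e / (2 * K) :> R by rewrite ge_min lexx orbT.
have sv : sz v <= nc h * G.
  rewrite -(subrK (h *: g') v); apply: le_trans (szD _ _) _; rewrite szZ /G.
  have -> : nc h * (sz g' + 1) = nc h + nc h * sz g'.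
    by move: (sz g') => q; ring.
  rewrite lerD2r; apply: le_trans k1 _; exact: ler_piMl ph l1.
have xr : sz x <= r by exact: ltW.
have xv : x + v = g (t + h) by rewrite /v addrC subrK.
have xvr : sz (x + v) <= r.
  apply: le_trans (szD _ _) _; move: sv k2; rewrite /y; lra.
have k4 := F_diff xr xvr.
have -> : F (a (t + h), b (t + h), p (t + h)) 0 j - F (a t, b t, p t) 0 j -
    h * D x g' 0 j = (F (x + v) - F x - D x v) 0 j + D x (v - h *: g') 0 j.
  have -> : D x (v - h *: g') = - h *: D x g' + D x v.
    by rewrite addrC -scaleNr D_lin.
  rewrite xv; move: (D x v) (D x g') => Dv Dg; rewrite !mxE.
  move: (Dv 0 j) (Dg 0 j) => A B; rewrite /g /x; ring.
apply: le_trans (ncD _ _) _; apply: le_trans (lerD (nc_le_vn _ _) (nc_le_vn _ _)) _.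
have k5 := D_bnd (v - h *: g') xr.
apply: le_trans (lerD k4 k5) _.
have q1 : K * sz v ^+ 2 <= e / 2 * nc h.
  have : sz v ^+ 2 <= (nc h * G) ^+ 2.
    by rewrite ler_pXn2r ?nnegrE ?sz_ge0 // mulr_ge0 // ltW.
  move=> /(ler_wpM2l (ltW kp)) h1; apply: le_trans h1 _.
  have -> : K * (nc h * G) ^+ 2 = (nc h * (2 * K * G ^+ 2)) * nc h / 2 by field.
  by rewrite mulrAC; apply: ler_wpM2r => //; rewrite ler_pM2r ?invr_gt0 // ltW.
have q2 : K * sz (v - h *: g') <= e / 2 * nc h.
  apply: le_trans (ler_wpM2l (ltW kp) k1) _.
  rewrite mulrA ler_wpM2r //; apply: le_trans (ler_wpM2l (ltW kp) l2) _.
  by rewrite le_eqVlt; apply/orP; left; apply/eqP; field; rewrite gt_eqF.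
by move: q1 q2; lra.
Qed.

Lemma F_bnd e z w : nc e + nc z + vn w <= r -> vn (F (e, z, w)) <= K * r.
Proof.
move=> h; have kp := K0; have pz := nc_ge0 z; have pw := vn_ge0 w; have pe := nc_ge0 e.
have er : nc e <= r by lra.
rewrite (_ : F (e, z, w) = F (e, z, w) - F (e, 0, 0)); last first.
  by rewrite (F_00 er) subr0.
have E : (e, z, w) = (e, 0, 0) + (0, z, w) :> X.
  by congr (_, _, _); rewrite /= ?addr0 ?add0r.
rewrite E; apply: le_trans (F_lip _ _) _.
- by rewrite sz3 nc0 vn0 !addr0.
- by rewrite -E sz3.
- by rewrite sz3 nc0 add0r ler_wpM2l ?(ltW kp) //; lra.
Qed.

Lemma vcder_cst v t : vcder (fun=> v) t 0.
Proof.
move=> k; have -> : (0 : V) 0 k = 0 by rewrite mxE.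
exact: cder_cst.
Qed.

(** The entry is the first Taylor coefficient in t of F(e, 0, t delta_i), so [coef_holo] gives
    holomorphy in e from that of [F]. *)
Lemma jac_holo e i j : nc e < r -> cdiff (fun e => jac e i j) e.
Proof.
move=> er; pose d := (r - nc e) / 2; have d0 : 0 < d by rewrite /d; lra.
have sd t : vn (t *: delta_mx 0 i : V) = nc t.
  rewrite vnZ /vn (bigD1 i) //= mxE !eqxx nc1 big1 ?addr0 ?mulr1 // => k ki.
  by rewrite mxE (negbTE ki) andbF nc0.
pose G e t := F (e, 0, t *: delta_mx 0 i) 0 j.
have near e' : nc (e' - e) < d -> nc e' < nc e + d by have := ncBl e' e; lra.
have dE : nc e + d + d = r by rewrite /d; field.
have ct t : vcder (fun t => t *: delta_mx 0 i : V) t (delta_mx 0 i).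
  move=> k; under eq_fun do rewrite mxE.
  have := cderM (cder_id t) (cder_cst ((delta_mx 0 i : V) 0 k) t).
  by rewrite mulr0 addr0 mul1r.
have Gd e' t : nc (e' - e) < d -> nc t < d -> cder (G e') t (D (e', 0, t *: delta_mx 0 i) (0, 0, delta_mx 0 i) 0 j).
  move=> /near ed td.
  apply: (F_curve_cder j (cder_cst e' t) (cder_cst 0 t) (ct t)).
  by rewrite nc0 addr0 sd; lra.
have Ge e' t : nc (e' - e) < d -> nc t < d -> cdiff (fun e => G e t) e'.
  move=> /near ed td; eexists.
  apply: (F_curve_cder (p := fun=> t *: delta_mx 0 i) (p' := 0) j (cder_id e') (cder_cst 0 e')).
    exact: vcder_cst.
  by rewrite nc0 addr0 sd; lra.
have GM e' t : nc (e' - e) < d -> nc t < d -> nc (G e' t) <= K * r.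
  move=> /near ed td; apply: le_trans (nc_le_vn _ _) _.
  by apply: F_bnd; rewrite nc0 addr0 sd; lra.
have JG e' : nc (e' - e) < d -> coef (G e') (d / 2) 1 = jac e' i j.
  move=> ed; have [||h _ _ _] := @schwarz _ (G e') d (K * r) d0.
  - by move=> t td; eexists; exact: Gd.
  - by move=> t td; exact: GM.
  apply: cder_uniq h _; have := Gd e' 0 ed; rewrite nc0 => /(_ d0).
  by rewrite scale0r mxE.
have d2 : 0 < d / 2 by lra.
have td (t : C) : nc t = d / 2 -> nc t < d by move=> ->; lra.
apply: (cdiff_ext d0 JG); apply: (coef_holo (M := K * r) 1 d0 d2).
- move=> e' ed; apply: rcont_oncircle => [|t /td tt]; first exact: ltW.
  by apply: cdiff_cont; eexists; exact: Gd.
- by move=> t e' /td tt ed; exact: Ge.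
- by move=> t e' /td tt ed; exact: GM.
Qed.

Lemma cder_mul_jac (p : C -> V) z p' e j : vcder p z p' ->
  cder (fun z => (p z *m jac e) 0 j) z ((p' *m jac e) 0 j).
Proof.
move=> Hp; have H i : cder (fun z => p z 0 i * jac e i j) z (p' 0 i * jac e i j).
  have := cderM (Hp i) (cder_cst (jac e i j) z).
  by rewrite mulr0 addr0.
rewrite (_ : (fun z => _) = (fun z => \sum_i p z 0 i * jac e i j)).
  by rewrite mxE; exact: cder_sum H.
by apply/funext => t; rewrite mxE.
Qed.

(** The z-derivative of [nonlin e z (p z)] for a curve with value w and derivative w' at z. *)
Definition nonlin' e z w w' : V := D (e, z, w) (0, 1, w') - w' *m jac e.

Lemma nonlin_cder e (p : C -> V) z p' j : vcder p z p' -> nc e + nc z + vn (p z) < r ->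
  cder (fun z => nonlin e z (p z) 0 j) z (nonlin' e z (p z) p' 0 j).
Proof.
move=> Hp h; have H1 := F_curve_cder j (cder_cst e z) (cder_id z) Hp h.
have H2 := cder_mul_jac e j Hp.
have -> : (fun z => nonlin e z (p z) 0 j) =
    (fun t => F (e, t, p t) 0 j + (-1) * (p t *m jac e) 0 j).
  by apply/funext => t; rewrite /nonlin mulN1r !mxE.
have -> : nonlin' e z (p z) p' 0 j =
    D (e, z, p z) (0, 1, p') 0 j + (-1) * (p' *m jac e) 0 j.
  by rewrite /nonlin' mulN1r !mxE.
exact: cderD H1 (cderZ (-1) H2).
Qed.

(** The source of smallness: z w' is met only by D(e, z, w) - D(e, 0, 0), since [jac e] removes the
    differential at (e, 0, 0). *)
Lemma nonlin'_bnd e z w w' : nc e + nc z + vn w <= r ->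
  vn (z *: nonlin' e z w w') <= K * nc z + K * (nc z + vn w) * vn (z *: w').
Proof.
move=> h; have kp := K0; have pz := nc_ge0 z; have pw := vn_ge0 w; have pe := nc_ge0 e.
have er : nc e <= r by lra.
have -> : z *: nonlin' e z w w' = z *: D (e, z, w) (0, 1, 0) +
   (D (e, z, w) (0, 0, z *: w') - D (e, 0, 0) (0, 0, z *: w')).
  rewrite /nonlin' jac_mul.
  have -> : ((0, 1, w') : X) = (0, 1, 0) + (0, 0, w').
    by congr (_, _, _); rewrite /= ?addr0 ?add0r.
  have -> : ((0, 0, z *: w') : X) = z *: (0, 0, w').
    by congr (_, _, _); rewrite /= scaler0.
  by rewrite D_add !D_scale scalerBr scalerDr addrA.
apply: le_trans (vnD _ _) _; apply: lerD.
  rewrite vnZ mulrC ler_wpM2r //; apply: le_trans (D_bnd _ _) _; first by rewrite sz3.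
  by rewrite sz3 nc0 vn0 nc1 add0r addr0 mulr1.
have E : (e, z, w) - (e, 0, 0) = (0, z, w) :> X.
  by congr (_, _, _); rewrite /= ?subrr ?subr0.
have := @D_lip (e, z, w) (e, 0, 0) (0, 0, z *: w').
by rewrite E !sz3 !nc0 !vn0 !addr0 !add0r; apply.
Qed.

(** The Lipschitz constant of [nonlin] is itself O(|z|) along curves vanishing at 0, so agreement of
    p1 and p2 up to O(z^k) improves to O(z^(k+1)). Read on a circle of radius t, coefficient i <= k
    then differs by at most A t, and t tends to 0. *)
Lemma coef_stab e (p1 p2 : C -> V) (sg rho B d : R) k i j :
  0 < rho -> rho < sg -> 0 < d -> 0 <= B -> (i <= k)%N ->
  (forall z, nc z < sg -> exists p', vcder p1 z p') ->
  (forall z, nc z < sg -> exists p', vcder p2 z p') ->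
  (forall z, nc z < sg -> nc e + nc z + vn (p1 z) < r) ->
  (forall z, nc z < sg -> nc e + nc z + vn (p2 z) < r) ->
  (forall z, nc z < d -> vn (p1 z) <= B * nc z) ->
  (forall z, nc z < d -> vn (p2 z) <= B * nc z) ->
  (forall z, nc z < d -> vn (p1 z - p2 z) <= B * nc z ^+ k) ->
  coef (fun z => nonlin e z (p1 z) 0 j) rho i = coef (fun z => nonlin e z (p2 z) 0 j) rho i.
Proof.
move=> rho0 rhosg d0 B0 ik H1 H2 S1 S2 B1 B2 B12; have kp := K0.
have dN (p : C -> V) : (forall z, nc z < sg -> exists p', vcder p z p') ->
   (forall z, nc z < sg -> nc e + nc z + vn (p z) < r) ->
   forall z, nc z < sg -> cdiff (fun z => nonlin e z (p z) 0 j) z.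
  by move=> H S z zs; have [p' Hp] := H z zs; eexists; exact: nonlin_cder Hp (S z zs).
have N1 := dN _ H1 S1; have N2 := dN _ H2 S2.
apply/eqP; rewrite -subr_eq0; apply/eqP/le0_nc_eq => eta eta0.
pose A := 2 * K * (1 + 2 * B) * B.
have A0 : 0 <= A by rewrite /A !mulr_ge0 //; lra.
pose t := Num.min (Num.min (d / 2) 1) (Num.min rho (eta / (A + 1))).
have t0 : 0 < t by rewrite /t !lt_min rho0 ltr01 !divr_gt0 //; lra.
have td : t <= d / 2 by rewrite /t !ge_min lexx.
have t1 : t <= 1 by rewrite /t !ge_min lexx orbT.
have tr : t <= rho by rewrite /t !ge_min lexx orbT.
have tA : t * (A + 1) <= eta.
  by rewrite -ler_pdivlMr; [rewrite /t !ge_min lexx !orbT | lra].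
have ts : t < sg by exact: le_lt_trans rhosg.
rewrite (coef_indep i N1 rho0 t0 rhosg ts) (coef_indep i N2 rho0 t0 rhosg ts).
have c1 := rcont_circ_diff (ltW t0) ts N1; have c2 := rcont_circ_diff (ltW t0) ts N2.
rewrite -coefB //.
have ti : 0 < t ^+ i by rewrite exprn_gt0.
rewrite -(ler_pM2r ti); apply: (coef_le i t0 (rcontB c1 c2)).
move=> z zt; have zd : nc z < d by rewrite zt; lra.
have zs : nc z < sg by rewrite zt.
have -> : nonlin e z (p1 z) 0 j - nonlin e z (p2 z) 0 j = (nonlin e z (p1 z) - nonlin e z (p2 z)) 0 j.
  by rewrite !mxE.
apply: le_trans (nc_le_vn _ _) _.
apply: le_trans (nonlin_lip (ltW (S1 z zs)) (ltW (S2 z zs))) _.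
have b1 := B1 z zd; have b2 := B2 z zd; have b3 := B12 z zd; rewrite zt in b1 b2 b3 *.
apply: le_trans (_ : (A * t) * t ^+ k <= _).
  have -> : A * t * t ^+ k = 2 * K * (t + B * t + B * t) * (B * t ^+ k).
    by rewrite /A; ring.
  apply: ler_pM; rewrite ?vn_ge0 //.
    by rewrite !mulr_ge0 ?addr_ge0 ?vn_ge0 // ltW.
  by rewrite ler_wpM2l ?mulr_ge0 ?(ltW kp) // !lerD.
have At : A * t <= eta by lra.
apply: ler_pM => //; first by rewrite mulr_ge0 // ltW.
  by rewrite exprn_ge0 // ltW.
exact: (ler_wiXn2l (ltW t0) t1).
Qed.

(** * Vector polynomials and the recursively defined coefficients *)

Definition vpoly (c : nat -> V) m z : V := \row_j cpoly (fun k => c k 0 j) m z.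

Definition dpoly (c : nat -> C) m z : C := \sum_(k < m) c k * (k%:R * z ^+ k.-1).

Lemma cder_cpoly c m z : cder (cpoly c m) z (dpoly c m z).
Proof.
have h (k : 'I_m) : cder (fun z => c k * z ^+ k) z (c k * (k%:R * z ^+ k.-1)).
  by apply: cderZ; exact: cderX.
exact: cder_sum h.
Qed.

Lemma mul_dpoly c m z : z * dpoly c m z = cpoly (fun k => k%:R * c k) m z.
Proof.
rewrite /cpoly mulr_sumr; apply: eq_bigr => k _.
case: (val k) => [|j]; first by rewrite !(mul0r, mulr0).
by rewrite /= exprS; ring.
Qed.

Definition vpoly' (c : nat -> V) m z : V := \row_j dpoly (fun k => c k 0 j) m z.

Lemma vcder_vpoly c m z : vcder (vpoly c m) z (vpoly' c m z).
Proof.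
by move=> j; rewrite mxE; under eq_fun do rewrite mxE; exact: cder_cpoly.
Qed.

Lemma eq_vpoly c c' m z : (forall k, (k < m)%N -> c k = c' k) -> vpoly c m z = vpoly c' m z.
Proof.
by move=> H; apply/rowP => j; rewrite !mxE; apply: eq_bigr => k _; rewrite H.
Qed.

(* [fcoef_upto sg e m] lists the coefficients [b_k] up to [k = m]; the Taylor coefficients
   of the nonlinearity are read off on the circle of radius [sg / 2]. *)
Fixpoint fcoef_upto (sg : R) e m : nat -> V :=
  if m is m'.+1 then fun k => if k == m then
    (\row_j coef (fun z => nonlin e z (vpoly (fcoef_upto sg e m') m z) 0 j) (sg / 2) m) *m
      invmx ((m%:R * e)%:M - jac e)
  else fcoef_upto sg e m' k else fun=> 0.

Definition fcoef sg e k := fcoef_upto sg e k k.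

Lemma fcoef_uptoE sg e m k : (k <= m)%N -> fcoef_upto sg e m k = fcoef sg e k.
Proof.
elim: m => [|m IH]; first by rewrite leqn0 => /eqP ->.
rewrite leq_eqVlt => /orP[/eqP -> //|km].
by rewrite /= ltn_eqF // IH.
Qed.

Lemma fcoef0 sg e : fcoef sg e 0 = 0.
Proof. by []. Qed.

Lemma fcoefS sg e m : fcoef sg e m.+1 =
  (\row_j coef (fun z => nonlin e z (vpoly (fcoef sg e) m.+1 z) 0 j) (sg / 2) m.+1) *m
      invmx ((m.+1%:R * e)%:M - jac e).
Proof.
have E : vpoly (fcoef_upto sg e m) m.+1 = vpoly (fcoef sg e) m.+1.
  by apply/funext => z; apply: eq_vpoly => k; rewrite ltnS => /(fcoef_uptoE sg e).
rewrite -E {E} -[LHS]/(fcoef_upto sg e m.+1 m.+1).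
by rewrite [LHS]/= eqxx.
Qed.

(** * Convergence *)

Section Solution.
Variables (S0 : set C) (E c q sg : R).
Hypothesis S0_le : forall e, S0 e -> nc e <= E.
Hypothesis resolvent : forall e k (y : V), S0 e -> (0 < k)%N ->
  c * vn y <= vn (y *m ((k%:R * e)%:M - jac e)).
Hypotheses (c_gt0 : 0 < c) (q_gt0 : 0 < q) (sg_gt0 : 0 < sg).
Hypothesis size_lt : E + sg + 2 * n%:R * q < r.
Hypothesis small1 : n%:R ^+ 2 / c ^+ 2 * (2 * (K * sg) ^+ 2) <= q ^+ 2 / 2.
Hypothesis small2 :
  n%:R ^+ 2 / c ^+ 2 * (2 * (K * (sg + 2 * n%:R * q)) ^+ 2 * n%:R) <= 2^-1.

Local Notation be := (fcoef sg).

(** The lower bound [resolvent] makes the square matrix injective on rows. *)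
Lemma shift_unit e k : S0 e -> (0 < k)%N -> (k%:R * e)%:M - jac e \in unitmx.
Proof.
move=> He k0; rewrite -row_free_unit; apply: inj_row_free => v Hv.
have := resolvent v He k0; rewrite Hv vn0 => h.
by apply: vn_eq0; have cp := c_gt0; rewrite pmulr_rle0 in h.
Qed.

Lemma fcoef_rec e k j : S0 e -> (0 < k)%N ->
  (be e k *m ((k%:R * e)%:M - jac e)) 0 j =
  coef (fun z => nonlin e z (vpoly (be e) k z) 0 j) (sg / 2) k.
Proof.
case: k => // k He k0; rewrite fcoefS mulmxKV ?mxE //.
exact: shift_unit.
Qed.

Lemma vpoly_diff (a : nat -> V) m : a 0%N = 0 -> exists B : R, 0 <= B /\
  forall z, nc z < 1 -> vn (vpoly a m z) <= B * nc z /\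
    forall k, (k <= m)%N -> vn (vpoly a m z - vpoly a k z) <= B * nc z ^+ k.
Proof.
move=> a0; exists (\sum_j \sum_(l < m) nc (a l 0 j)); split.
  by apply: sumr_ge0 => j _; apply: sumr_ge0 => l _; exact: nc_ge0.
move=> z z1.
have H k : (k <= m)%N -> vn (vpoly a m z - vpoly a k z) <=
    (\sum_j \sum_(l < m) nc (a l 0 j)) * nc z ^+ k.
  move=> km; rewrite /vn mulr_suml; apply: ler_sum => j _; rewrite !mxE.
  exact: cpoly_diff (ltW z1).
split => //; case: m H => [|m] H.
  have -> : vpoly a 0 z = 0 by apply/rowP => j; rewrite !mxE /cpoly big_ord0.
  rewrite vn0 mulr_ge0 ?nc_ge0 //.
  by apply: sumr_ge0 => j _; apply: sumr_ge0 => l _; exact: nc_ge0.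
have := H 1%N isT; rewrite expr1.
have -> : vpoly a 1 z = 0 by apply/rowP => j; rewrite !mxE /cpoly big_ord1 a0 mxE mul0r.
by rewrite subr0.
Qed.

(** Passage from weighted square sums on circles to a bound on the open disc, through a radius
    strictly between |z| and [sg], which is positive also for z = 0. *)
Lemma vpoly_le (a : nat -> V) m z : a 0%N = 0 -> nc z < sg ->
  (forall rho, 0 < rho -> rho < sg ->
     \sum_i \sum_(k < m) (k%:R * (nc (a k 0 i) * rho ^+ k)) ^+ 2 <= q ^+ 2) ->
  forall i, \sum_(k < m) nc (a k 0 i) * nc z ^+ k <= 2 * q.
Proof.
move=> a0 zs H i; have qp := q_gt0; have sp := sg_gt0; have pz := nc_ge0 z.
pose rho := (nc z + sg) / 2; have h1 : 0 < rho by rewrite /rho; lra.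
have h2 : rho < sg by rewrite /rho; lra.
have zr : nc z <= rho by rewrite /rho; lra.
apply: le_trans (_ : \sum_(k < m) nc (a k 0 i) * rho ^+ k <= _).
  by apply: ler_sum => k _; rewrite ler_wpM2l ?nc_ge0 // lerXn2r ?nnegrE // ltW.
apply: (l1_le_l2 (x := fun k => nc (a k 0 i) * rho ^+ k)) => //.
  by rewrite a0 mxE nc0 mul0r.
apply: le_trans (H rho h1 h2); rewrite [leRHS](bigD1 i) //= lerDl.
by apply: sumr_ge0 => i' _; apply: sumr_ge0 => k _; exact: sqr_ge0.
Qed.

Lemma vpoly_bound (a : nat -> V) m z : a 0%N = 0 -> nc z < sg ->
  (forall rho, 0 < rho -> rho < sg ->
     \sum_i \sum_(k < m) (k%:R * (nc (a k 0 i) * rho ^+ k)) ^+ 2 <= q ^+ 2) ->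
  vn (vpoly a m z) <= 2 * n%:R * q.
Proof.
move=> a0 zs H; rewrite [2 * _]mulrC -mulrA; apply: vn_le => i; rewrite mxE.
exact: le_trans (cpoly_l1 _ _ _) (vpoly_le a0 zs H i).
Qed.

(* The Sobolev-type estimate: [z d/dz] of [nonlin e z (p_m z)] is controlled in the mean
   square over circles by [z p_m'], and multiplication of the coefficients by the
   bounded resolvents does not increase mean squares by more than a constant. *)
Lemma fcoef_bound m : forall e, S0 e -> forall rho, 0 < rho -> rho < sg ->
  \sum_i \sum_(k < m) (k%:R * (nc (be e k 0 i) * rho ^+ k)) ^+ 2 <= q ^+ 2.
Proof.
have qp := q_gt0; have sp := sg_gt0; have cp := c_gt0; have rp := r0; have kp := K0.
have nn : 0 <= n%:R :> R by [].
elim: m => [|m IH] e He rho rho0 rhos.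
  by rewrite big1 ?sqr_ge0 // => i _; rewrite big_ord0.
pose p := vpoly (be e) m; pose p' := vpoly' (be e) m.
have eE := S0_le He.
have pb z : nc z < sg -> vn (p z) <= 2 * n%:R * q.
  by move=> zs; apply: vpoly_bound => //; exact: IH.
have szp z : nc z < sg -> nc e + nc z + vn (p z) < r.
  by move=> zs; have := pb z zs; have sl := size_lt; lra.
pose G j z := nonlin e z (p z) 0 j; pose dG j z := nonlin' e z (p z) (p' z) 0 j.
have Gd j z : nc z < sg -> cder (G j) z (dG j z).
  by move=> zs; apply: nonlin_cder (szp z zs); exact: vcder_vpoly.
have GM j z : nc z < sg -> nc (G j z) <= 2 * K * r.
  move=> zs; apply: le_trans (nc_le_vn _ _) _.
  by apply: nonlin_bnd; exact: ltW (szp z zs).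
have DC j k := deriv_coef k rho0 rhos (Gd j) (GM j).
(* The square of the bound from [nonlin'_bnd], by (x + y)^2 <= 2 x^2 + 2 y^2 and [sqr_sum_le]. The
   hypotheses [small1] and [small2] ensure n^2 / c^2 (al + bt q^2) <= q^2, which closes the
   induction. *)
pose al := 2 * (K * sg) ^+ 2; pose bt := 2 * (K * (sg + 2 * n%:R * q)) ^+ 2 * n%:R.
have al0 : 0 <= al by rewrite /al mulr_ge0 // sqr_ge0.
have bt0 : 0 <= bt by rewrite /bt mulr_ge0 // mulr_ge0 // sqr_ge0.
pose pk i := cpoly (fun k => k%:R * be e k 0 i) m.
have W j : \sum_(k < m.+1) (k%:R * (nc (coef (G j) rho k) * rho ^+ k)) ^+ 2 <= al + bt * q ^+ 2.
  have := bessel m.+1 rho0 (DC j 0%N).1 => h.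
  rewrite (eq_bigr (fun k : 'I_m.+1 => (nc (coef (fun z => z * dG j z) rho k) * rho ^+ k) ^+ 2)); last first.
    by move=> k _; rewrite (DC j k).2 ncM nc_nat mulrA.
  apply: le_trans h _.
  apply: le_trans (msq_le (p := pk) (al := al) (be := bt) rho0 (DC j 0%N).1 _ _) _.
  - by move=> i; exact: rcont_cpoly.
  - move=> z zr; have zs : nc z < sg by rewrite zr.
    have zp' i : (z *: p' z) 0 i = pk i z by rewrite !mxE mul_dpoly.
    have h1 : nc (z * dG j z) <= K * sg + K * (sg + 2 * n%:R * q) * \sum_i nc (pk i z).
      have -> : z * dG j z = (z *: nonlin' e z (p z) (p' z)) 0 j by rewrite [RHS]mxE.
      apply: le_trans (nc_le_vn _ _) _.
      apply: le_trans (nonlin'_bnd (p' z) (ltW (szp z zs))) _.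
      have -> : vn (z *: p' z) = \sum_i nc (pk i z) by apply: eq_bigr => i _; rewrite zp'.
      apply: lerD; first by rewrite ler_wpM2l ?(ltW kp) // ltW.
      rewrite -!mulrA ler_wpM2l ?(ltW kp) // ler_wpM2r //.
        by apply: sumr_ge0 => i _; exact: nc_ge0.
      by have := pb z zs; lra.
    have := sqr_sum_le (fun i => nc (pk i z)).
    move: (\sum_i nc (pk i z)) (\sum_i nc (pk i z) ^+ 2) h1 => s1 s2 h1 h2.
    apply: le_trans (_ : (K * sg + K * (sg + 2 * n%:R * q) * s1) ^+ 2 <= _).
      by rewrite lerXn2r ?nnegrE ?nc_ge0 // (le_trans _ h1) ?nc_ge0.
    apply: le_trans (_ : 2 * (K * sg) ^+ 2 + 2 * (K * (sg + 2 * n%:R * q)) ^+ 2 * s1 ^+ 2 <= _).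
      move: (K * sg) (K * (sg + 2 * n%:R * q)) => x y.
      by have := sqr_ge0 (x - y * s1); rewrite sqrrB sqrrD exprMn; lra.
    by rewrite /al /bt lerD2l -[leRHS]mulrA ler_wpM2l // mulr_ge0 ?sqr_ge0.
  rewrite lerD2l ler_wpM2l //; apply: le_trans (IH e He rho rho0 rhos).
  rewrite le_eqVlt; apply/orP; left; apply/eqP; apply: eq_bigr => i _.
  rewrite parseval //; apply: eq_bigr => k _.
  by rewrite ncM nc_nat mulrA.
(* Mode by mode, the resolvent costs 1 / c^2, and comparing sums with sums of squares over the
   coordinates costs a factor n. *)
have Bk (k : 'I_m.+1) : \sum_i (k%:R * (nc (be e k 0 i) * rho ^+ k)) ^+ 2 <=
    n%:R / c ^+ 2 * \sum_j (k%:R * (nc (coef (G j) rho k) * rho ^+ k)) ^+ 2.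
  have [k0|k0] := posnP k.
    rewrite k0 big1; last by move=> i _; rewrite mul0r expr0n.
    apply: mulr_ge0; first by rewrite divr_ge0 ?sqr_ge0.
    by apply: sumr_ge0 => i _; exact: sqr_ge0.
  have km : (k <= m)%N by rewrite -ltnS.
  (* The recursion uses the partial sum below k on the circle of radius [sg / 2]; [coef_stab]
     replaces it by the longer polynomial [p], and [coef_indep] moves the circle to [rho]. *)
  have E1 j : (be e k *m ((k%:R * e)%:M - jac e)) 0 j = coef (G j) rho k.
    rewrite (fcoef_rec j He k0).
    have [B [B0 HB]] := vpoly_diff m (fcoef0 sg e).
    have [B' [B'0 HB']] := vpoly_diff k (fcoef0 sg e).
    have kb z : nc z < sg -> vn (vpoly (be e) k z) <= 2 * n%:R * q.
      move=> zs; apply: vpoly_bound => // s s0 ss; apply: le_trans (IH e He s s0 ss).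
      apply: ler_sum => i _; rewrite -(big_mkord xpredT (fun l => (l%:R * (nc (be e l 0 i) * s ^+ l)) ^+ 2)).
      rewrite -[leRHS](big_mkord xpredT (fun l => (l%:R * (nc (be e l 0 i) * s ^+ l)) ^+ 2)).
      by rewrite [leRHS](big_cat_nat (n := k)) //= lerDl sumr_ge0 // => l _; exact: sqr_ge0.
    have szk z : nc z < sg -> nc e + nc z + vn (vpoly (be e) k z) < r.
      by move=> zs; have := kb z zs; have sl := size_lt; lra.
    have h2 : sg / 2 < sg by lra.
    have h3 : 0 < sg / 2 by lra.
    have Gd' z : nc z < sg -> cdiff (G j) z by move=> zs; eexists; exact: Gd.
    refine (etrans _ (coef_indep k Gd' h3 rho0 h2 rhos)).
    have BB : 0 <= B + B' by rewrite addr_ge0.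
    apply: (@coef_stab e (vpoly (be e) k) p sg (sg / 2) (B + B') 1 k k j h3 h2
      ltr01 BB (leqnn k)).
    - by move=> z _; eexists; exact: vcder_vpoly.
    - by move=> z _; eexists; exact: vcder_vpoly.
    - exact: szk.
    - exact: szp.
    - move=> z /HB'[h _]; apply: le_trans h _; rewrite ler_wpM2r ?nc_ge0 //; lra.
    - move=> z /HB[h _]; apply: le_trans h _; rewrite ler_wpM2r ?nc_ge0 //; lra.
    - move=> z /HB[_ /(_ k km) h]; rewrite vnC; apply: le_trans h _.
      by rewrite ler_wpM2r ?exprn_ge0 ?nc_ge0 //; lra.
  pose y := be e k.
  have h1 := resolvent y He k0.
  have h2 : vn (y *m ((k%:R * e)%:M - jac e)) = \sum_j nc (coef (G j) rho k).
    by apply: eq_bigr => j _; rewrite E1.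
  rewrite h2 in h1.
  have h3 := sqr_sum_le (fun j => nc (coef (G j) rho k)).
  have h4 := sum_sqr_le (fun i => nc_ge0 (y 0 i)); rewrite -/(vn y) in h4.
  have h5 : vn y ^+ 2 <= (\sum_j nc (coef (G j) rho k)) ^+ 2 / c ^+ 2.
    rewrite ler_pdivlMr ?exprn_gt0 // mulrC -exprMn lerXn2r ?nnegrE //.
      by rewrite mulr_ge0 ?vn_ge0 // ltW.
    by apply: sumr_ge0 => j _; exact: nc_ge0.
  pose w := (k%:R * rho ^+ k) ^+ 2.
  have w0 : 0 <= w by exact: sqr_ge0.
  have -> : \sum_i (k%:R * (nc (be e k 0 i) * rho ^+ k)) ^+ 2 = w * \sum_i nc (y 0 i) ^+ 2.
    by rewrite mulr_sumr; apply: eq_bigr => i _; rewrite /w; ring.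
  have -> : \sum_j (k%:R * (nc (coef (G j) rho k) * rho ^+ k)) ^+ 2 =
     w * \sum_j nc (coef (G j) rho k) ^+ 2.
    by rewrite mulr_sumr; apply: eq_bigr => i _; rewrite /w; ring.
  rewrite mulrCA ler_wpM2l //; apply: le_trans h4 (le_trans h5 _).
  by rewrite [leRHS]mulrAC ler_wpM2r // invr_ge0 sqr_ge0.
rewrite exchange_big /=; apply: le_trans (ler_sum _ (fun k _ => Bk k)) _.
rewrite -mulr_sumr exchange_big /=.
have nc2 : 0 <= n%:R / c ^+ 2 by rewrite divr_ge0 ?sqr_ge0.
apply: le_trans (ler_wpM2l nc2 (ler_sum _ (fun j _ => W j))) _.
rewrite sumr_const card_ord -[(_ + _) *+ n]mulr_natl.
have s1 := small1; have s2 := small2; rewrite -/al in s1; rewrite -/bt in s2.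
have -> : n%:R / c ^+ 2 * (n%:R * (al + bt * q ^+ 2)) =
  n%:R ^+ 2 / c ^+ 2 * al + (n%:R ^+ 2 / c ^+ 2 * bt) * q ^+ 2 by ring.
have := ler_wpM2r (sqr_ge0 q) s2; lra.
Qed.

(** * The sum of the series and the equation it satisfies *)

Definition sol e z : V := \row_j psum (fun k => be e k 0 j) z.

Lemma fcoef_le e k j rho : S0 e -> 0 < rho -> rho < sg ->
  nc (be e k 0 j) * rho ^+ k <= 2 * q.
Proof.
move=> He rho0 rhos.
have zs : nc (rho%:C : C) < sg by rewrite nc_real gtr0_norm.
have := vpoly_le (fcoef0 sg e) zs (fcoef_bound k.+1 He) j.
rewrite nc_real gtr0_norm // big_ord_recr /=; apply: le_trans.
by rewrite lerDr sumr_ge0 // => i _; rewrite mulr_ge0 ?exprn_ge0 ?nc_ge0 // ltW.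
Qed.

Lemma mid_radius z : nc z < sg -> exists2 rho : R, nc z < rho & 0 < rho /\ rho < sg.
Proof.
have sp := sg_gt0; have pz := nc_ge0 z; move=> zs.
by exists ((nc z + sg) / 2); [lra | split; lra].
Qed.

Lemma sol_clim e z j : S0 e -> nc z < sg ->
  clim (fun m => cpoly (fun k => be e k 0 j) m z) (sol e z 0 j).
Proof.
move=> He zs; have [rho zr [r1 r2]] := mid_radius zs.
have H k := fcoef_le k j He r1 r2.
by rewrite mxE; exact: (psum_ex zr H).1.
Qed.

Lemma cpoly_fcoef_le e z m j : S0 e -> nc z < sg ->
  nc (cpoly (fun k => be e k 0 j) m z) <= 2 * q.
Proof.
move=> He zs; apply: le_trans (cpoly_l1 _ _ _) _.
exact: vpoly_le (fcoef0 sg e) zs (fcoef_bound m He) j.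
Qed.

Lemma sol_le e z j : S0 e -> nc z < sg -> nc (sol e z 0 j) <= 2 * q.
Proof.
move=> He zs; apply: clim_le (sol_clim j He zs) _.
by exists 0%N => m _; exact: cpoly_fcoef_le.
Qed.

Lemma sol_bound e z : S0 e -> nc z < sg -> vn (sol e z) <= 2 * n%:R * q.
Proof.
move=> He zs; rewrite [2 * _]mulrC -mulrA; apply: vn_le => j; exact: sol_le.
Qed.

Lemma sol_size e z : S0 e -> nc z < sg -> nc e + nc z + vn (sol e z) < r.
Proof.
move=> He zs; have := sol_bound He zs; have := S0_le He; have sl := size_lt; lra.
Qed.

Lemma sol_cder e z : S0 e -> nc z < sg -> exists p', vcder (sol e) z p' /\
  forall j, clim (fun m => cpoly (fun k => k%:R * be e k 0 j) m z) (z * p' 0 j).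
Proof.
move=> He zs; have [rho zr [r1 r2]] := mid_radius zs.
have /choice[l Hl] : forall j, exists l, cder (psum (fun k => be e k 0 j)) z l /\
    clim (fun m => cpoly (fun k => k%:R * be e k 0 j) m z) (z * l).
  move=> j; have H k := fcoef_le k j He r1 r2.
  by have [l h1 h2] := psum_cder zr H; exists l.
exists (\row_j l j); split=> j; rewrite mxE; last by case: (Hl j).
rewrite (_ : (fun t => sol e t 0 j) = psum (fun k => be e k 0 j)); first by case: (Hl j).
by apply/funext => t; rewrite mxE.
Qed.

(** [B] may depend on e and k: the lemma only supplies the order of contact at z = 0 that
    [coef_stab] requires. *)
Lemma sol_tail e k : S0 e -> exists2 B : R, 0 <= B & forall z, nc z < sg / 4 ->
  vn (sol e z - vpoly (be e) k z) <= B * nc z ^+ k.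
Proof.
move=> He; have sp := sg_gt0; have qp := q_gt0; pose rho := sg / 2.
have r1 : 0 < rho by rewrite /rho; lra.
have r2 : rho < sg by rewrite /rho; lra.
have rk : 0 < rho ^+ k by rewrite exprn_gt0.
exists (n%:R * (4 * q / rho ^+ k)).
  by rewrite mulr_ge0 // divr_ge0 ?mulr_ge0 // ltW.
move=> z zs; have zr : nc z < rho by rewrite /rho; lra.
rewrite -mulrA; apply: vn_le => j; rewrite !mxE.
have H l := fcoef_le l j He r1 r2.
apply: le_trans ((psum_ex zr H).2 k) _.
have pz := nc_ge0 z.
have h1 : nc z / rho <= 1 / 2.
  by rewrite ler_pdivrMr // /rho; lra.
have h2 : 0 < 1 - nc z / rho by lra.
rewrite ler_pdivrMr // (expr_div_n (nc z) rho k).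
have -> : 4 * q / rho ^+ k * nc z ^+ k * (1 - nc z / rho) =
  2 * q * (nc z ^+ k / rho ^+ k) * (2 * (1 - nc z / rho)).
  by move: (nc z ^+ k) (rho ^+ k) (nc z / rho) rk => x y w y0; field; rewrite gt_eqF.
rewrite ler_peMr //; last by lra.
by rewrite !mulr_ge0 ?invr_ge0 ?exprn_ge0 // ltW.
Qed.

Lemma sol0 e : S0 e -> sol e 0 = 0.
Proof.
move=> He; have sp := sg_gt0; have z0 : nc (0 : C) < sg by rewrite nc0.
apply/rowP => j; rewrite [RHS]mxE; apply: clim_uniq (sol_clim j He z0) _.
have cp0 (m : nat) : cpoly (fun k => be e k 0 j) m 0 = 0.
  rewrite /cpoly big1 // => -[[|k] km] _ /=; first by rewrite mxE mul0r.
  by rewrite expr0n mulr0.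
by under eq_fun do rewrite cp0; exact: clim_cst.
Qed.

(** For k > 0, [sol] and its partial sum below k agree up to O(z^k), so [coef_stab] reduces to the
    recursion. For k = 0 the recursion says nothing; there both sides vanish, the left one being the
    value at z = 0. *)
Lemma sol_coef e j k : S0 e ->
  coef (fun z => nonlin e z (sol e z) 0 j) (sg / 2) k =
  (be e k *m ((k%:R * e)%:M - jac e)) 0 j.
Proof.
move=> He; have sp := sg_gt0.
have s1 : 0 < sg / 2 by lra.
have s2 : sg / 2 < sg by lra.
have Gd z : nc z < sg -> cdiff (fun z => nonlin e z (sol e z) 0 j) z.
  move=> zs; have [p' [Hp _]] := sol_cder He zs.
  by eexists; exact: nonlin_cder Hp (sol_size He zs).
have er : nc e <= r.
  have z0 : nc (0 : C) < sg by rewrite nc0.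
  have := sol_size He z0; rewrite nc0; have := vn_ge0 (sol e 0); lra.
have [->|k0] := posnP k.
  rewrite fcoef0 mul0mx mxE.
  have cm : cmean (fun z => nonlin e z (sol e z) 0 j) (sg / 2) = nonlin e 0 (sol e 0) 0 j.
    apply: cmean_center => //.
      by apply/cdiff_cont/Gd; rewrite nc0.
    by move=> z /andP[_ zs]; apply: Gd; lra.
  rewrite sol0 // /nonlin mul0mx subr0 (F_00 er) mxE in cm.
  rewrite -[RHS]cm; apply: cmean_eq => z.
  by rewrite expr0 invr1 mulr1.
rewrite (fcoef_rec j He k0).
have [B1 [B10 HB1]] := vpoly_diff k (fcoef0 sg e).
have [B2 B20 HB2] := sol_tail 1 He.
have [B3 B30 HB3] := sol_tail k He.
pose d := Num.min 1 (sg / 4).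
have d0 : 0 < d by rewrite /d lt_min ltr01; lra.
have d1 z : nc z < d -> nc z < 1 by rewrite /d lt_min => /andP[].
have d4 z : nc z < d -> nc z < sg / 4 by rewrite /d lt_min => /andP[].
have BB : 0 <= B1 + B2 + B3 by rewrite !addr_ge0.
have pb z : nc z < sg -> nc e + nc z + vn (vpoly (be e) k z) < r.
  move=> zs; have h := vpoly_bound (fcoef0 sg e) zs (fcoef_bound k He).
  by have := S0_le He; have sl := size_lt; lra.
apply: (@coef_stab e (sol e) (vpoly (be e) k) sg (sg / 2) (B1 + B2 + B3) d k k j s1 s2
  d0 BB (leqnn k)).
- by move=> z zs; have [p' [Hp _]] := sol_cder He zs; exists p'.
- by move=> z _; eexists; exact: vcder_vpoly.
- by move=> z zs; exact: sol_size.
- exact: pb.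
- move=> z /d4/HB2; rewrite expr1.
  have -> : vpoly (be e) 1 z = 0.
    by apply/rowP => i; rewrite !mxE /cpoly big_ord1 fcoef0 mxE mul0r.
  rewrite subr0 => h; apply: le_trans h _.
  by rewrite ler_wpM2r ?nc_ge0 //; lra.
- move=> z /d1/HB1[h _]; apply: le_trans h _.
  by rewrite ler_wpM2r ?nc_ge0 //; lra.
- move=> z /d4/HB3 h; apply: le_trans h _.
  by rewrite ler_wpM2r ?exprn_ge0 ?nc_ge0 //; lra.
Qed.

(** By [sol_coef] the power series of [nonlin e z (sol e z)] is, coefficient by coefficient, that of
    e z f' - f J(e); both sums are limits of the same partial sums. *)
Lemma sol_ode e z : S0 e -> nc z < sg -> exists p', vcder (sol e) z p' /\
  (e * z) *: p' = F (e, z, sol e z).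
Proof.
move=> He zs; have sp := sg_gt0.
have [p' [Hp Hc]] := sol_cder He zs; exists p'; split=> //.
have s1 : 0 < sg / 2 by lra.
have s2 : sg / 2 < sg by lra.
apply/rowP => j; rewrite mxE.
pose G z := nonlin e z (sol e z) 0 j.
have Gd t : nc t < sg -> cdiff G t.
  move=> ts; have [t' [Ht _]] := sol_cder He ts.
  by eexists; exact: nonlin_cder Ht (sol_size He ts).
have GM t : nc t < sg -> nc (G t) <= 2 * K * r.
  move=> ts; apply: le_trans (nc_le_vn _ _) _.
  by apply: nonlin_bnd; exact: ltW (sol_size He ts).
have [rho zr [r1 r2]] := mid_radius zs.
have GB k : nc (coef G (sg / 2) k) * rho ^+ k <= 2 * K * r.
  exact: coef_bound s2 Gd GM r1 r2.
have := (psum_ex zr GB).1; rewrite -(holo_psum s1 s2 Gd GM zs) => L1.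
have L2 : clim (fun m => cpoly (coef G (sg / 2)) m z)
    (e * (z * p' 0 j) - \sum_i sol e z 0 i * jac e i j).
  have -> : (fun m => cpoly (coef G (sg / 2)) m z) = (fun m =>
      e * cpoly (fun k => k%:R * be e k 0 j) m z -
      \sum_i jac e i j * cpoly (fun k => be e k 0 i) m z).
    apply/funext => m; rewrite /cpoly mulr_sumr.
    under [X in _ - X]eq_bigr do rewrite mulr_sumr.
    rewrite exchange_big /= -sumrB; apply: eq_bigr => k _.
    rewrite /G sol_coef // mulmxBr mul_mx_scalar !mxE mulrBl mulr_suml.
    congr (_ - _); first by ring.
    by apply: eq_bigr => i _; ring.
  apply: climB; first exact: climZ (Hc j).
  apply: clim_sum => i; rewrite mulrC; apply: climZ; exact: sol_clim.
have := clim_uniq L1 L2; rewrite /G /nonlin !mxE => /eqP.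
rewrite subr_eq addrC subrKC => /eqP ->.
by rewrite mulrA.
Qed.

(** Continuity of the coefficients at the vertex, by induction on m: subtracting the recursions at e
    and at 0 expresses (y - y0) J(0) through lower coefficients and terms of order |e|, and the
    resolvent bound at e = 0 removes J(0). [A] grows with m, which is harmless as only finitely many
    coefficients are compared at a time. *)
Lemma fcoef_lip0 m : S0 0 -> exists2 A : R, 0 <= A & forall k e, (k < m)%N -> S0 e ->
  vn (be e k - be 0 k) <= A * nc e.
Proof.
move=> H0; have sp := sg_gt0; have qp := q_gt0; have cp := c_gt0; have kp := K0.
have rp := r0; pose s := sg / 2.
have s1 : 0 < s by rewrite /s; lra.
have s2 : s < sg by rewrite /s; lra.
have nn : 0 <= n%:R :> R by [].
have s0 : 0 <= s by exact: ltW.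
elim: m => [|m [A A0 HA]]; first by exists 0.
have sm : 0 < s ^+ m by rewrite exprn_gt0.
have [m0|m0] := posnP m.
  exists A => // k e; rewrite m0 ltnS leqn0 => /eqP -> _.
  by rewrite !fcoef0 subrr vn0 mulr_ge0 ?nc_ge0.
pose P := \sum_(l < m) s ^+ l.
have P0 : 0 <= P by apply: sumr_ge0 => l _; rewrite exprn_ge0.
pose Y := n%:R * (2 * q / s ^+ m).
have Y0 : 0 <= Y by rewrite mulr_ge0 // divr_ge0 ?mulr_ge0 // ltW.
(* First summand: Cauchy's estimate on |z| = s for the change of the source term. Second: m e y and
   y (J(e) - J(0)), with [Y] bounding y. *)
pose T := n%:R * ((K * (1 + r) + 2 * K * (A * P)) / s ^+ m) + Y * (m%:R + K).
have AP : 0 <= A * P by rewrite mulr_ge0.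
have T0 : 0 <= T.
  have rr : 0 <= 1 + r by lra.
  by rewrite addr_ge0 ?mulr_ge0 ?addr_ge0 ?mulr_ge0 ?invr_ge0 //; exact: ltW.
exists (A + T / c); first by rewrite addr_ge0 // divr_ge0 // ltW.
move=> k e; rewrite ltnS leq_eqVlt => /orP[/eqP -> He|km He]; last first.
  apply: le_trans (HA k e km He) _; rewrite ler_wpM2r ?nc_ge0 // lerDl divr_ge0 //.
  exact: ltW.
apply: le_trans (_ : T / c * nc e <= _); last first.
  by rewrite ler_wpM2r ?nc_ge0 // lerDr.
rewrite mulrAC ler_pdivlMr // mulrC.
apply: le_trans (resolvent _ H0 m0) _; rewrite mulr0.
have er : nc e <= r.
  have z0 : nc (0 : C) < sg by rewrite nc0.
  by have := sol_size He z0; have := vn_ge0 (sol e 0); rewrite nc0; lra.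
have r00 : nc (0 : C) <= r by rewrite nc0; exact: ltW.
set y := be e m; set y0 := be 0 m.
have yY : vn y <= Y.
  by apply: vn_le => j; rewrite ler_pdivlMr //; exact: fcoef_le.
have pw (z : C) : nc z = s -> vn (vpoly (be e) m z - vpoly (be 0) m z) <= A * P * nc e.
  move=> zs; rewrite /vn.
  apply: le_trans (_ : \sum_j \sum_(l < m) nc ((be e l - be 0 l) 0 j) * s ^+ l <= _).
    apply: ler_sum => j _; rewrite !mxE -sumrB.
    apply: le_trans (nc_sum _ _ _) _; apply: ler_sum => l _.
    by rewrite -mulrBl ncM ncX zs !mxE.
  rewrite exchange_big /=; under eq_bigr do rewrite -mulr_suml.
  rewrite mulrAC mulr_sumr; apply: ler_sum => l _.
  by rewrite ler_wpM2r ?exprn_ge0 //; exact: HA.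
have szp e' z : S0 e' -> nc z < sg -> nc e' + nc z + vn (vpoly (be e') m z) < r.
  move=> He' zs; have h := vpoly_bound (fcoef0 sg e') zs (fcoef_bound m He').
  by have := S0_le He'; have sl := size_lt; lra.
have NN z j : nc z = s -> nc (nonlin e z (vpoly (be e) m z) 0 j - nonlin 0 z (vpoly (be 0) m z) 0 j) <=
    (K * (1 + r) + 2 * K * (A * P)) * nc e.
  move=> zs; have zg : nc z < sg by rewrite zs.
  have h1 := szp e z He zg; have h2 := szp 0 z H0 zg; have h3 := pw z zs.
  set w := vpoly (be e) m z in h1 h3 *; set w0 := vpoly (be 0) m z in h2 h3 *.
  have -> : nonlin e z w 0 j - nonlin 0 z w0 0 j = ((F (e, z, w) - F (0, z, w0)) -
     ((w *m jac e - w *m jac 0) + (w - w0) *m jac 0)) 0 j.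
    rewrite /nonlin mulmxBl; move: (w *m _) (w *m jac 0) (w0 *m _) => a1 a2 a3.
    by rewrite !mxE; ring.
  apply: le_trans (nc_le_vn _ _) _; apply: le_trans (vnB _ _) _.
  have E1 : (e, z, w) = (0, z, w0) + (e, 0, w - w0) :> X.
    by congr (_, _, _); rewrite /= ?addr0 ?add0r // addrC subrK.
  have k1 : vn (F (e, z, w) - F (0, z, w0)) <= K * (nc e + vn (w - w0)).
    have l1 : sz ((0, z, w0) : X) <= r by rewrite sz3 ltW.
    have l2 : sz ((e, z, w) : X) <= r by rewrite sz3 ltW.
    by rewrite E1 in l2; have := F_lip l1 l2; rewrite -E1 sz3 nc0 addr0.
  have k2 := jac_lip w er r00; rewrite subr0 in k2.
  have k3 := jac_bnd (w - w0) r00.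
  have k4 : K * nc e * vn w <= K * nc e * r.
    rewrite ler_wpM2l ?mulr_ge0 ?nc_ge0 ?(ltW kp) //.
    by have := nc_ge0 e; have := nc_ge0 z; lra.
  have k5 := ler_wpM2l (ltW kp) h3.
  have := vnD (w *m jac e - w *m jac 0) ((w - w0) *m jac 0).
  by move: k1 k2 k3 k4 k5; lra.
have Gc e' j : S0 e' -> rcont (oncircle (fun z => nonlin e' z (vpoly (be e') m z) 0 j) s).
  move=> He'; apply: rcont_oncircle => // z zs; apply: cdiff_cont; eexists.
  by apply: nonlin_cder (vcder_vpoly _ _ _) _; apply: szp => //; rewrite zs.
have -> : (y - y0) *m (0%:M - jac 0) = (y *m ((m%:R * e)%:M - jac e) -
    y0 *m ((m%:R * 0)%:M - jac 0)) - (y *m (m%:R * e)%:M - (y *m jac e - y *m jac 0)).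
  have z0 : (0 : C)%:M = (0 : 'M[C]_n).
    by apply/matrixP => i j; rewrite !mxE mul0rn.
  rewrite mulr0 z0.
  rewrite !mulmxBr !mulmxBl !mulmx0.
  move: (y *m _) (y *m jac e) (y *m jac 0) (y0 *m jac 0) => a1 a2 a3 a4.
  by apply/rowP => j; rewrite !mxE; ring.
apply: le_trans (vnB _ _) _; rewrite mulrDl; apply: lerD.
  rewrite -(mulrA n%:R); apply: vn_le => j.
  have -> : (y *m ((m%:R * e)%:M - jac e) - y0 *m ((m%:R * 0)%:M - jac 0)) 0 j =
      (y *m ((m%:R * e)%:M - jac e)) 0 j - (y0 *m ((m%:R * 0)%:M - jac 0)) 0 j.
    by rewrite [LHS]mxE [X in _ + X]mxE.
  rewrite /y /y0 (fcoef_rec j He m0) (fcoef_rec j H0 m0) -/s.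
  rewrite -(coefB _ s1 (Gc e j He) (Gc 0 j H0)).
  rewrite mulrAC ler_pdivlMr //; apply: (coef_le _ s1 (rcontB (Gc e j He) (Gc 0 j H0))).
  by move=> z zs; exact: NN.
apply: le_trans (vnB _ _) _; rewrite mul_mx_scalar vnZ ncM nc_nat.
have k1 := jac_lip y er r00; rewrite subr0 in k1.
have k2 : m%:R * nc e * vn y <= m%:R * nc e * Y.
  by rewrite ler_wpM2l // mulr_ge0 ?nc_ge0.
have k3 : K * nc e * vn y <= K * nc e * Y.
  by rewrite ler_wpM2l // mulr_ge0 ?nc_ge0 // ltW.
by move: k1 k2 k3; lra.
Qed.

(** * Holomorphy in the interior of the cone and limit at the vertex *)

Definition inner e := exists2 d : R, 0 < d & forall e', nc (e' - e) < d -> S0 e'.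

Lemma inner_mem e : inner e -> S0 e.
Proof. by move=> [d d0]; apply; rewrite subrr nc0. Qed.

Lemma inner_near e : inner e ->
  exists2 d : R, 0 < d & forall e', nc (e' - e) < d -> inner e'.
Proof.
move=> [d d0 H]; have d2 : 0 < d / 2 by lra.
exists (d / 2) => // e' h; exists (d / 2) => // e'' h'; apply: H.
by have := ncD3 e'' e' e; lra.
Qed.

Lemma vpoly_size e m z : S0 e -> nc z < sg -> nc e + nc z + vn (vpoly (be e) m z) < r.
Proof.
move=> He zs; have h := vpoly_bound (fcoef0 sg e) zs (fcoef_bound m He).
by have := S0_le He; have sl := size_lt; lra.
Qed.

Lemma S0_lt e : S0 e -> nc e < r.
Proof.
move=> He; have z0 : nc (0 : C) < sg by rewrite nc0.
by have := sol_size He z0; have := vn_ge0 (sol e 0); rewrite nc0; lra.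
Qed.

(** Strong induction: the source term is a circle mean of functions holomorphic in e, treated by
    [coef_holo], and the inverse matrix is covered by Cramer's formula. *)
Lemma fcoef_holo k : forall e j, inner e -> cdiff (fun e => be e k 0 j) e.
Proof.
have sp := sg_gt0; have sg2 : sg / 2 < sg by lra.
elim/ltn_ind: k => -[|k] IH e j He.
  under eq_fun do rewrite fcoef0 mxE; exact: cdiff_cst.
under eq_fun do rewrite fcoefS mxE.
apply: cdiff_sum => l; apply: cdiffM.
  under eq_fun do rewrite mxE.
  have [d d0 Hd] := inner_near He.
  have pd z : nc z = sg / 2 -> forall e', nc (e' - e) < d ->
      exists p', vcder (fun e => vpoly (be e) k.+1 z) e' p'.
    move=> zs e' /Hd He'.
    have /choice[p' Hp] : forall i, cdiff (fun e => vpoly (be e) k.+1 z 0 i) e'.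
      move=> i; under eq_fun do rewrite mxE; apply: cdiff_sum => -[m km].
      by apply: cdiffM; [exact: IH | exact: cdiff_cst].
    by exists (\row_i p' i) => i; rewrite mxE.
  apply: (@coef_holo R (fun e z => nonlin e z (vpoly (be e) k.+1 z) 0 l) e d (sg / 2) (2 * K * r)) => //.
  - by lra.
  - move=> e' /Hd/inner_mem He'; apply: rcont_oncircle => [|z zs]; first by lra.
    apply: cdiff_cont; eexists; apply: nonlin_cder (vcder_vpoly _ _ _) _.
    by apply: vpoly_size => //; rewrite zs.
  - move=> z e' zs he; have [p' Hp] := pd z zs e' he.
    have He' := inner_mem (Hd e' he).
    have Jd i i' : cdiff (fun e => jac e i i') e' by apply: jac_holo; exact: S0_lt.
    rewrite /nonlin; under eq_fun do rewrite mxE; under eq_fun do rewrite [X in _ + X]mxE.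
    apply: cdiffB.
      eexists; apply: F_curve_cder (cder_id e') (cder_cst z e') Hp _.
      by apply: vpoly_size => //; rewrite zs.
    under eq_fun do rewrite mxE; apply: cdiff_sum => i.
    by apply: cdiffM => //; exists (p' 0 i); exact: Hp.
  move=> z e' zs /Hd/inner_mem He'; apply: le_trans (nc_le_vn _ _) _; apply: nonlin_bnd.
  by apply/ltW/vpoly_size => //; rewrite zs.
have [d d0 Hd] := He.
apply: (cdiff_inv (d := d)) => //.
  by move=> t /Hd Ht; exact: shift_unit.
move=> i i'; under eq_fun do rewrite mxE; under eq_fun do rewrite [X in _ + X]mxE.
apply: cdiffB; last by apply: jac_holo; exact: S0_lt (inner_mem He).
under eq_fun do rewrite mxE; case: (i == i').
  by apply: cdiffM; [exact: cdiff_cst | exact: cdiff_id].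
exact: cdiff_cst.
Qed.

(** The partial sums are bounded by 2 q independently of e, so [ulim] applies in the variable e. *)
Lemma sol_inner_cdiff e z j : inner e -> nc z < sg -> cdiff (fun e => sol e z 0 j) e.
Proof.
move=> He zs; have [d d0 Hd] := inner_near He.
have [] := @ulim R (fun m e => cpoly (fun k => be e k 0 j) m z)
  (fun e => sol e z 0 j) e d (2 * q) d0.
- move=> m e' /Hd He'; apply: cdiff_sum => k.
  by apply: cdiffM; [exact: fcoef_holo | exact: cdiff_cst].
- by move=> m e' /Hd/inner_mem He'; exact: cpoly_fcoef_le.
- by move=> e' /Hd/inner_mem He'; exact: sol_clim.
by move=> l Hl _; exists l.
Qed.

Lemma sol_joint e z j : inner e -> nc z < sg -> exists a l,
  forall eta : R, 0 < eta -> exists2 d : R, 0 < d & forall h k, nc h < d -> nc k < d ->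
    nc (sol (e + h) (z + k) 0 j - sol e z 0 j - h * a - k * l) <= eta * (nc h + nc k).
Proof.
move=> He zs; have [d d0 Hd] := inner_near He.
have d'0 : 0 < Num.min d (sg - nc z) by rewrite lt_min d0 subr_gt0.
have [] := @osgood R (fun e z => sol e z 0 j) e z (Num.min d (sg - nc z)) (2 * q) d'0.
  move=> e' z'; rewrite !lt_min => /andP[/Hd He' _] /andP[_ hz].
  have zs' : nc z' < sg by have := ncBl z' z; lra.
  split; first exact: sol_inner_cdiff.
    by have [p' [Hp _]] := sol_cder (inner_mem He') zs'; exists (p' 0 j); exact: Hp.
  by apply: sol_le => //; exact: inner_mem.
by move=> a [l [_ _ H]]; exists a, l.
Qed.

Lemma sol_lim z : S0 0 -> nc z < sg -> forall eta : R, 0 < eta ->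
  exists2 d : R, 0 < d & forall e, S0 e -> nc e < d -> vn (sol e z - sol 0 z) <= eta.
Proof.
move=> H0 zs eta eta0; have qp := q_gt0; have [rho zr [r1 r2]] := mid_radius zs.
have pz := nc_ge0 z.
have t0 : 0 <= nc z / rho by rewrite divr_ge0 // ltW.
have t1 : nc z / rho < 1 by rewrite ltr_pdivrMr // mul1r.
have u0 : 0 < 1 - nc z / rho by lra.
have [m Hm] : exists m, (n%:R * (2 * q / (1 - nc z / rho))) * (nc z / rho) ^+ m <= eta / 3.
  set B := n%:R * _.
  have B0 : 0 <= B by rewrite mulr_ge0 // divr_ge0 ?mulr_ge0 // ltW.
  have nt : `|nc z / rho| < 1 by rewrite ger0_norm.
  have /cvgrPdist_lt /(_ (eta / 3 / (B + 1))) := cvg_expr nt.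
  have h : 0 < eta / 3 / (B + 1) by rewrite !divr_gt0 //; lra.
  move=> /(_ h)[m _ /(_ m (leqnn m))] /=; rewrite sub0r normrN ger0_norm ?exprn_ge0 //.
  rewrite ltr_pdivlMr; last by lra.
  by move=> h'; exists m; have := exprn_ge0 m t0; lra.
have [A A0 HA] := fcoef_lip0 m H0.
have tail e : S0 e -> vn (sol e z - vpoly (be e) m z) <= eta / 3.
  move=> He; apply: le_trans Hm; rewrite -mulrA; apply: vn_le => j; rewrite !mxE.
  have H l := fcoef_le l j He r1 r2.
  by apply: le_trans ((psum_ex zr H).2 m) _; rewrite mulrAC.
pose B := A * \sum_(l < m) nc z ^+ l.
have B0 : 0 <= B by rewrite mulr_ge0 // sumr_ge0 // => l _; rewrite exprn_ge0.
have B1 : 0 < B + 1 by lra.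
exists (eta / 3 / (B + 1)); first by rewrite !divr_gt0.
move=> e He; rewrite ltr_pdivlMr // => he.
have mid : vn (vpoly (be e) m z - vpoly (be 0) m z) <= B * nc e.
  rewrite /vn.
  apply: le_trans (_ : \sum_j \sum_(l < m) nc ((be e l - be 0 l) 0 j) * nc z ^+ l <= _).
    apply: ler_sum => j _; rewrite !mxE -sumrB.
    apply: le_trans (nc_sum _ _ _) _; apply: ler_sum => l _.
    by rewrite -mulrBl ncM ncX !mxE.
  rewrite exchange_big /=; under eq_bigr do rewrite -mulr_suml.
  rewrite /B mulrAC mulr_sumr; apply: ler_sum => l _.
  by rewrite ler_wpM2r ?exprn_ge0 //; exact: HA.
have h1 := tail e He; have h2 := tail 0 H0; have pe := nc_ge0 e.
have -> : sol e z - sol 0 z = (sol e z - vpoly (be e) m z) +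
    ((vpoly (be e) m z - vpoly (be 0) m z) - (sol 0 z - vpoly (be 0) m z)).
  by apply/rowP => j; rewrite !mxE; ring.
apply: le_trans (vnD _ _) _.
have := vnB (vpoly (be e) m z - vpoly (be 0) m z) (sol 0 z - vpoly (be 0) m z).
by lra.
Qed.

(** At e = 0 the equation reads -w J(0) = N(0, z, w). The resolvent bounds the difference of the
    left sides below by c |w1 - w2|, and the Lipschitz constant of N on the right is smaller than
    [c]. *)
Lemma reduced_uniq z w1 w2 : S0 0 ->
  nc z + vn w1 <= r -> nc z + vn w2 <= r -> 2 * K * (nc z + vn w1 + vn w2) < c ->
  F (0, z, w1) = 0 -> F (0, z, w2) = 0 -> w1 = w2.
Proof.
move=> H0 s1 s2 sc f1 f2; apply/eqP; rewrite -subr_eq0; apply/eqP/vn_eq0.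
have := resolvent (w1 - w2) H0 (ltn0Sn 0); rewrite mulr0.
have z0 : (0 : C)%:M = (0 : 'M[C]_n).
  by apply/matrixP => i j; rewrite !mxE mul0rn.
have -> : (w1 - w2) *m (0%:M - jac 0) = nonlin 0 z w1 - nonlin 0 z w2.
  rewrite z0 /nonlin f1 f2 sub0r mulmxN mulmxBl.
  by move: (w1 *m _) (w2 *m _) => a1 a2; apply/rowP => j; rewrite !mxE; ring.
have := @nonlin_lip 0 z w1 w2; rewrite nc0 add0r => /(_ s1 s2) h1 h2.
have := le_trans h2 h1; rewrite -subr_ge0 -mulrBl.
have h : 2 * K * (nc z + vn w1 + vn w2) - c < 0 by lra.
by rewrite nmulr_rge0.
Qed.

(* [g] and [sol 0] agree wherever [vn (g z) <= r1]. If [vn (g z)] exceeded [r1], it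
   would equal [r1] somewhere on the segment from [0] to [z], where [sol 0] is
   smaller than [r1]. *)
Lemma reduced_global (g : C -> V) r1 : S0 0 -> 2 * n%:R * q < r1 -> sg + r1 <= r ->
  2 * K * (sg + r1 + r1) < c ->
  (forall z, nc z < sg -> forall eta : R, 0 < eta ->
     exists2 d : R, 0 < d & forall z', nc (z' - z) < d -> vn (g z' - g z) <= eta) ->
  g 0 = 0 -> (forall z, nc z < sg -> F (0, z, g z) = 0) ->
  forall z, nc z < sg -> g z = sol 0 z.
Proof.
move=> H0 q1 s1 Kc gc g0 gF; have kp := K0.
have sF z : nc z < sg -> F (0, z, sol 0 z) = 0.
  by move=> zs; have [p' [_ <-]] := sol_ode H0 zs; rewrite mul0r scale0r.
have loc z : nc z < sg -> vn (g z) <= r1 -> g z = sol 0 z.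
  move=> zs gz; have sz := sol_bound H0 zs.
  apply: (reduced_uniq H0 _ _ _ (gF z zs) (sF z zs)); [by lra | by lra |].
  apply: le_lt_trans Kc; rewrite -!mulrA ler_wpM2l // ler_wpM2l ?(ltW kp) //; lra.
move=> z zs; apply: (loc z) => //; rewrite leNgt; apply/negP => big.
pose phi (t : R) := vn (g (t%:C * z)).
have tz (t : R) : t \in `[0, 1] -> nc (t%:C * z) < sg.
  rewrite in_itv /= => /andP[t0 t1]; rewrite ncMr ger0_norm //.
  by apply: le_lt_trans zs; rewrite ler_piMl ?nc_ge0.
have phic : {within `[0, 1], continuous phi}.
  apply: continuous_in_subspaceT => t; rewrite inE /= => t01.
  apply/cvgrPdist_le => eta eta0; have [d d0 Hd] := gc _ (tz t t01) _ eta0.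
  have pz := nc_ge0 z.
  have d1 : 0 < d / (nc z + 1) by rewrite divr_gt0 //; lra.
  near=> u.
  have hu : `|t - u| < d / (nc z + 1) by near: u; exact: cvgr_dist_lt.
  have hd : nc (u%:C * z - t%:C * z) < d.
    rewrite -mulrBl -realcB ncMr distrC.
    move: hu; rewrite ltr_pdivlMr; last by lra.
    by have := normr_ge0 (t - u); lra.
  have h := Hd _ hd.
  rewrite /phi ler_norml; have h1 := vnD (g (u%:C * z) - g (t%:C * z)) (g (t%:C * z)).
  have h2 := vnB (g (u%:C * z)) (g (u%:C * z) - g (t%:C * z)).
  rewrite subrK in h1; rewrite subKr in h2.
  by apply/andP; split; lra.
have phi0 : phi 0 = 0 by rewrite /phi mul0r g0 vn0.
have phi1 : phi 1 = vn (g z) by rewrite /phi mul1r.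
have r10 : 0 <= r1.
  have qp := q_gt0; apply: ltW; apply: le_lt_trans q1.
  by rewrite !mulr_ge0 // ltW.
have [||t t01 pt] := @IVT R phi 0 1 r1 _ phic _ => //.
  by rewrite phi0 phi1 ge_min le_max r10 (ltW big) /= orbT.
have ts := tz t t01.
have gt : vn (g (t%:C * z)) <= r1 by rewrite -/(phi t) pt.
have := sol_bound H0 ts; rewrite -(loc _ ts gt) -/(phi t) pt; lra.
Unshelve. all: by end_near.
Qed.

End Solution.

End LocalEquation.

(** * Resolvents and cones *)

Section ResolventBound.
Variable (R : realType).
Local Notation C := R[i].

Lemma vn_mulmx n (A : 'M[C]_n) : exists2 B : R, 0 <= B &
  forall y : 'rV[C]_n, vn (y *m A) <= B * vn y.
Proof.
exists (\sum_i \sum_j nc (A i j)).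
  by apply: sumr_ge0 => i _; apply: sumr_ge0 => j _; exact: nc_ge0.
move=> y; rewrite /vn.
apply: le_trans (_ : \sum_j \sum_i nc (y 0 i) * nc (A i j) <= _).
  apply: ler_sum => j _; rewrite mxE; apply: le_trans (nc_sum _ _ _) _.
  by apply: ler_sum => i _; rewrite ncM.
rewrite exchange_big /= mulr_sumr; apply: ler_sum => i _.
rewrite -mulr_sumr mulrC ler_wpM2r ?nc_ge0 // [leRHS](bigD1 i) //= lerDl.
by apply: sumr_ge0 => k _; apply: sumr_ge0 => j _; exact: nc_ge0.
Qed.

Lemma eigenvalue_trmx (F : fieldType) n (A : 'M[F]_n) l :
  eigenvalue A^T l = eigenvalue A l.
Proof.
rewrite !eigenvalue_root_char; suff -> : char_poly A^T = char_poly A by [].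
rewrite /char_poly -det_tr; congr (\det _); apply/matrixP => i j.
by rewrite !mxE eq_sym.
Qed.

(* Removing one eigenvalue [l] at a time: for [x = y (mu - A)] and [u = y (A - l)],
   [(mu - l) y = u + x] and [u (mu - A) = x (A - l)]. *)
Lemma resolvent_bound n (A : 'M[C]_n.+1) (Q : set C) :
  (forall l, eigenvalue A l -> exists2 k : R, 0 < k & forall mu, Q mu -> k <= nc (mu - l)) ->
  exists2 c : R, 0 < c & forall mu (y : 'rV[C]_n.+1), Q mu ->
    c * vn y <= vn (y *m (mu%:M - A)).
Proof.
move=> H; have [s Hs] := closed_field_poly_normal (char_poly A).
rewrite (monicP (char_poly_monic A)) scale1r in Hs.
have sH l : l \in s -> exists2 k : R, 0 < k & forall mu, Q mu -> k <= nc (mu - l).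
  by move=> ls; apply: H; rewrite eigenvalue_root_char Hs root_prod_XsubC.
(* Restricting to rows killed by the product over [s] makes an induction on the list of roots
   possible; for the full list the restriction is void by Cayley-Hamilton. *)
suff [c c0 Hc] : exists2 c : R, 0 < c & forall mu (y : 'rV[C]_n.+1), Q mu ->
    y *m horner_mx A (\prod_(l <- s) ('X - l%:P)) = 0 ->
    c * vn y <= vn (y *m (mu%:M - A)).
  exists c => // mu y Qmu; apply: Hc => //.
  by rewrite -Hs Cayley_Hamilton mulmx0.
elim: s {Hs} sH => [|l s IH] sH.
  exists 1 => // mu y _; rewrite big_nil rmorph1 mulmx1 => ->.
  by rewrite vn0 mulr0 vn_ge0.
have [|c c0 Hc] := IH; first by move=> m ms; apply: sH; rewrite inE ms orbT.
have [k k0 Hk] := sH l (mem_head _ _).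
have [B B0 HB] := vn_mulmx (A - l%:M).
(* From c |u| <= B |x| and k |y| <= |u| + |x| follows k |y| <= (B/c + 1) |x|. *)
have Bc : 0 < B / c + 1 by rewrite ltr_wpDl // divr_ge0 // ltW.
exists (k / (B / c + 1)); first exact: divr_gt0.
move=> mu y Qmu; rewrite big_cons rmorphM rmorphB /= horner_mx_X horner_mx_C => Hy.
set x := y *m (mu%:M - A); pose u := y *m (A - l%:M).
have h1 : c * vn u <= B * vn x.
  apply: le_trans (HB x).
  have -> : x *m (A - l%:M) = u *m (mu%:M - A).
    rewrite /x /u -!mulmxA; congr (_ *m _).
    apply: comm_mxB; last exact: comm_mx_scalar.
    by apply/comm_mx_sym/comm_mxB; [exact: comm_mx_scalar | exact: comm_mx_refl].
  apply: Hc => //; rewrite /u -mulmxA; exact: Hy.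
have h2 : (mu - l) *: y = u + x.
  rewrite /u /x -mulmxDr -mul_mx_scalar; congr (_ *m _).
  by rewrite raddfB /= [RHS]addrC addrA subrK.
have h3 : k * vn y <= vn u + vn x.
  apply: le_trans (vnD _ _); rewrite -h2 vnZ ler_wpM2r ?vn_ge0 //; exact: Hk.
rewrite mulrAC ler_pdivrMr //; apply: le_trans h3 _.
rewrite mulrDr mulr1 lerD2r mulrC mulrAC ler_pdivlMr // mulrC.
exact: h1.
Qed.

End ResolventBound.

(** * The principal argument and cones *)

Section Argument.
Variable (R : realType).
Local Notation C := R[i].
Implicit Types (z l m : C) (t : R).

(** The angle exists as plus or minus the acos of Re z / |z|, by the sign of Im z. Only its cosine
    is recorded, as sectors are symmetric about the real axis. *)
Lemma Arg_spec z : z != 0 -> - pi < Arg z <= pi /\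
  complex.Re z = nc z * cos (Arg z).
Proof.
rewrite -nc_gt0 => z0; have zn := gt_eqF z0.
have sq : (complex.Re z / nc z) ^+ 2 + (complex.Im z / nc z) ^+ 2 = 1.
  by rewrite !expr_div_n -mulrDl -nc_sqr divff // expf_eq0 zn.
have x1 : -1 <= complex.Re z / nc z <= 1.
  by rewrite -ler_norml normrM normfV (gtr0_norm z0) ler_pdivrMr // mul1r Re_le.
have polar t : complex.Re z / nc z = cos t -> complex.Im z / nc z = sin t ->
    z = `|z| * (cos t +i* sin t).
  have aux (N a b' : R) : N != 0 -> a +i* b' = N%:C * ((a / N) +i* (b' / N)).
    by move=> N0; apply/eqP; rewrite eq_complex /=; apply/andP; split; apply/eqP; field.
  move=> <- <-; rewrite normE -aux ?zn //.
  by move: z {z0 zn sq x1 aux} => [].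
have [t tI tz] : exists2 t, - pi < t <= pi & z = `|z| * (cos t +i* sin t).
  have a0 := acos_ge0 x1; have ap := acos_lepi x1.
  have ca : cos (acos (complex.Re z / nc z)) = complex.Re z / nc z.
    by apply: acosK; rewrite in_itv.
  have sa := sin_acos x1; rewrite -sq addrAC subrr add0r sqrtr_sqr in sa.
  have [b0|b0] := leP 0 (complex.Im z / nc z).
    exists (acos (complex.Re z / nc z)).
      by rewrite ap (lt_le_trans _ a0) // oppr_lt0 pi_gt0.
    by apply: polar => //; rewrite sa ger0_norm.
  exists (- acos (complex.Re z / nc z)); last first.
    by apply: polar; rewrite ?cosN ?sinN // sa ltr0_norm // opprK.
  apply/andP; split; last by rewrite (le_trans _ (pi_ge0 R)) // oppr_le0.
  (* The angle -pi is excluded: a normalised real part -1 would force the imaginary part to vanish,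
     whereas it is negative here. *)
  rewrite ltrN2 acos_ltpi //; case/andP: x1 => x1 ->; rewrite andbT lt_neqAle x1 andbT.
  apply/negP => /eqP e1; have := sq; rewrite -e1 sqrrN expr1n => /eqP.
  by rewrite -subr_eq0 addrC addKr sqrf_eq0 => /eqP e2; rewrite e2 ltxx in b0.
rewrite /Arg; case: xgetP => [y _ [yI yz]|/(_ t)]; last by case.
split; first exact: yI.
have := congr1 (@complex.Re R) yz; rewrite normE; move: (nc z) => N ->.
by rewrite /= mul0r subr0.
Qed.

Lemma cos_norm t : cos `|t| = cos t.
Proof. by case: (ger0P t) => // _; rewrite cosN. Qed.

Lemma Arg_norm z : z != 0 -> `|Arg z| \in `[0, pi].
Proof.
move=> /Arg_spec[/andP[h1 h2] _]; rewrite in_itv /= normr_ge0 /=.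
by rewrite ler_norml h2 ltW.
Qed.

(** Since cos is strictly decreasing on [0, pi], angular conditions become inequalities between Re z
    and |z|; the argument does not appear beyond this translation. *)
Lemma Arg_lt z t : z != 0 -> 0 <= t <= pi ->
  (`|Arg z| < t) = (cos t * nc z < complex.Re z).
Proof.
move=> z0 tI; have [_ ->] := Arg_spec z0.
rewrite mulrC ltr_pM2l ?nc_gt0 // -(cos_norm (Arg z)).
by rewrite ltr_cos // ?Arg_norm // in_itv.
Qed.

(** For k0 < k1 the distance from l to the narrower cone is at least a multiple of |l|, uniformly in
    m: if m were close to l, then |m| would be close to |l| and Re m too large. *)
Lemma cone_gap (k0 k1 : R) l m : 0 <= k1 -> complex.Re l <= k0 * nc l ->
  k1 * nc m <= complex.Re m -> (k1 - k0) * nc l <= (1 + k1) * nc (m - l).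
Proof.
move=> k10 hl hm.
have h1 := ncBl l m; rewrite ncC in h1.
have h2 : complex.Re m - complex.Re l <= nc (m - l).
  by rewrite -ReB; apply: le_trans (Re_le _); exact: ler_norm.
have h3 : k1 * (nc l - nc m) <= k1 * nc (m - l) by rewrite ler_wpM2l.
by lra.
Qed.

End Argument.

(** * Passage to the differentiability of the library *)

Section Interface.
Variables (R : realType) (n : nat).
Local Notation C := R[i].
Local Notation V := 'rV[C]_n.
Local Notation X := (C * C * V)%type.

Lemma complex_gt0 (e : C) : 0 < e -> exists2 d : R, 0 < d & e = d%:C.
Proof.
case: e => a b; rewrite ltcE /= => /andP[/eqP -> a0]; by exists a.
Qed.

Lemma lt_norm_nc (z : C) (d : R) : (`|z| < d%:C) = (nc z < d).
Proof. by rewrite normE ltcR. Qed.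

Lemma le_norm_nc (z : C) (d : R) : (`|z| <= d%:C) = (nc z <= d).
Proof. by rewrite normE lecR. Qed.

Lemma ball_nc (z w : C) (d : R) : ball z d%:C w <-> nc (w - z) < d.
Proof. by rewrite -ball_normE /= lt_norm_nc ncC. Qed.

Lemma ball_row (v w : V) (d : R) : 0 < d ->
  ball v d%:C w <-> forall j, nc (w 0 j - v 0 j) < d.
Proof.
move=> d0; split=> [[_ h] j|h]; first by have := h 0 j; rewrite ball_nc.
by split=> [|i j]; rewrite ?ltcR //; apply/ball_nc; rewrite !ord1.
Qed.

Lemma nbhs_nc (T : pseudoMetricType C) (x : T) (A : set T) : nbhs x A <->
  exists2 d : R, 0 < d & forall y, ball x d%:C y -> A y.
Proof.
split=> [/nbhs_ballP[e /= /complex_gt0[d d0 ->] H]|[d d0 H]]; first by exists d.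
by apply/nbhs_ballP; exists d%:C => //=; rewrite ltcR.
Qed.

Lemma within_cvgP (S : set C) (a : C) (G : C -> V) (l : V) :
  G @ within S (nbhs a) --> l <->
  forall eps : R, 0 < eps -> exists2 d : R, 0 < d &
    forall h, S h -> nc (h - a) < d -> forall j, nc (G h 0 j - l 0 j) < eps.
Proof.
split=> [H eps e0|H A /nbhs_nc[e e0 HA]].
  have /H/nbhs_nc[d d0 Hd] : nbhs l (ball l eps%:C).
    by apply/nbhs_nc; exists eps.
  exists d => // h Sh hd; apply/(ball_row l) => //; apply: Hd => //.
  exact/ball_nc.
have [d d0 Hd] := H e e0; apply/nbhs_nc; exists d => // h /ball_nc hd Sh.
by apply: HA; apply/ball_row => //; exact: Hd.
Qed.

Lemma differentiable_cder (F : X -> V) x (v : X) j : differentiable F x ->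
  cder (fun t => F (x + t *: v) 0 j) 0 ('d F x v 0 j).
Proof.
move=> dF; have /cvg_ex[l Hl] := @diff_derivable C _ _ F x v dF.
have El : 'd F x v = l by rewrite -deriveE //; apply: cvg_lim.
rewrite El => e e0; have [d d0 Hd] := (within_cvgP _ _ _ _).1 Hl e e0.
exists d => // h hd; rewrite scale0r addr0 add0r.
have [->|h0] := eqVneq h 0.
  by rewrite scale0r addr0 subrr mul0r subrr nc0 mulr0.
have := Hd h h0; rewrite subr0 => /(_ hd j); rewrite !mxE /= => /ltW H.
rewrite addrC [h *: v + x]addrC in H.
have -> : F (x + h *: v) 0 j - F x 0 j - h * l 0 j =
  h * (h^-1 * (F (x + h *: v) 0 j - F x 0 j) - l 0 j).
  by rewrite mulrBr mulVKf.
rewrite ncM mulrC ler_wpM2r ?nc_ge0 //.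
by move: H; rewrite addrC.
Qed.

Lemma norm_row_lt (v : V) (d : R) j : `|v| < d%:C -> nc (v 0 j) < d.
Proof.
move=> vd; have d0 : 0 < d by rewrite -ltcR (le_lt_trans (normr_ge0 v)).
have : ball (0 : V) d%:C v by rewrite -ball_normE /= sub0r normrN.
by move=> /ball_row => /(_ d0 j); rewrite mxE subr0.
Qed.

Lemma norm_row_le (v : V) (d : R) : 0 <= d -> (forall j, nc (v 0 j) <= d) -> `|v| <= d%:C.
Proof.
move=> d0 H; have [->|v0] := eqVneq `|v| 0; first by rewrite lecR.
have [[i j] vij] := mx_norm_neq0 v0; rewrite [`|v|]vij.
by rewrite le_norm_nc /= ord1.
Qed.

Lemma norm_pair_ge (h : C * C) : (nc h.1)%:C <= `|h| /\ (nc h.2)%:C <= `|h|.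
Proof.
have := lexx `|h|; rewrite {1}prod_normE comparable_ge_max.
  by rewrite !normE => /andP.
by rewrite !normE; apply: real_comparable; rewrite complex_real.
Qed.

Definition lin_pair (a l : V) (h : C * C) : V := h.1 *: a + h.2 *: l.

Lemma lin_pair_linear a l : linear (lin_pair a l).
Proof.
move=> k u v; rewrite /lin_pair /= !scalerDl scalerDr !scalerA.
by rewrite addrACA.
Qed.

HB.instance Definition _ a l :=
  GRing.isLinear.Build C (C * C)%type V _ (lin_pair a l) (lin_pair_linear a l).

Lemma lin_pair_continuous a l : continuous (lin_pair a l).
Proof.
move=> h; apply: cvgD; apply: cvgZr_tmp; [exact: cvg_fst | exact: cvg_snd].
Qed.

(** A continuous linear map with remainder o(|h|) is the differential; the finitely many coordinate
    estimates are made simultaneous. Working with eta / 2 absorbs |h.1| + |h.2| <= 2 |h| for the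
    maximum norm on pairs. *)
Lemma differentiable_joint (f : C -> C -> V) e z :
  (forall j, exists a l, forall eta : R, 0 < eta -> exists2 d : R, 0 < d &
    forall h k, nc h < d -> nc k < d ->
    nc (f (e + h) (z + k) 0 j - f e z 0 j - h * a - k * l) <= eta * (nc h + nc k)) ->
  differentiable (fun p : C * C => f p.1 p.2) (e, z).
Proof.
move=> /choice[a /choice[l H]].
pose L : {linear (C * C)%type -> V} := lin_pair (\row_j a j) (\row_j l j).
have Lc : continuous L by exact: lin_pair_continuous.
pose g (p : (C * C)%type) := f p.1 p.2.
suff /eqaddoP Lo : forall eps : C, 0 < eps -> \forall h \near (0 : (C * C)%type),
    `|(g \o shift (e, z) - (cst (g (e, z)) + L)) h| <= eps * `|h|.
  by apply/diff_locallyP; rewrite (diff_unique Lc Lo).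
move=> _ /complex_gt0[eta eta0 ->].
have [d d0 Hd] : exists2 d : R, 0 < d & forall h : C * C, nc h.1 < d -> nc h.2 < d ->
    forall j, nc (f (e + h.1) (z + h.2) 0 j - f e z 0 j - h.1 * a j - h.2 * l j)
      <= eta / 2 * (nc h.1 + nc h.2).
  (* [finite_near] speaks of one increment, so both are dominated by a single [h], which is then
     taken to be the longer of the two. *)
  have [|d d0 Hd] := @finite_near R 'I_n (fun j h => forall h1 h2, nc h1 <= nc h ->
    nc h2 <= nc h -> nc (f (e + h1) (z + h2) 0 j - f e z 0 j - h1 * a j - h2 * l j)
      <= eta / 2 * (nc h1 + nc h2)).
    move=> j; have [|d d0 Hd] := H j (eta / 2); first by lra.
    by exists d => // h hd h1 h2 H1 H2; apply: Hd; [exact: le_lt_trans H1 hd | exact: le_lt_trans H2 hd].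
  exists d => // h H1 H2 j.
  have [h12|h21] := leP (nc h.1) (nc h.2); first exact: (Hd _ H2).
  by apply: (Hd _ H1) => //; exact: ltW.
apply/nbhs_nc; exists d => // h [/ball_nc h1 /ball_nc h2].
rewrite /= subr0 in h1; rewrite /= subr0 in h2.
have [n1 n2] := norm_pair_ge h.
have nh : nc h.1 + nc h.2 <= 2 * complex.Re `|h|.
  by move: n1 n2; case: `|h| => x y; rewrite !lecE /= => /andP[_ ?] /andP[_ ?]; lra.
have -> : `|h| = (complex.Re `|h|)%:C.
  by move: n1; case: `|h| => x y; rewrite lecE /= => /andP[/eqP -> _].
rewrite -realcM; apply: norm_row_le.
  rewrite mulr_ge0 ?(ltW eta0) //; have := nc_ge0 h.1; have := nc_ge0 h.2; lra.
move=> j; apply: le_trans (_ : eta / 2 * (nc h.1 + nc h.2) <= _); last first.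
  by rewrite -mulrA ler_wpM2l ?(ltW eta0) // mulrC; lra.
apply: le_trans (Hd h h1 h2 j); rewrite /= !mxE /=.
have -> : g (h + (e, z)) = f (e + h.1) (z + h.2) by rewrite (addrC e) (addrC z).
rewrite le_eqVlt; apply/orP; left; apply/eqP; congr nc.
by rewrite /g /=; ring.
Qed.

Lemma differentiable_derive1 (f : C -> V) z (p' : V) :
  (forall j, cder (fun t => f t 0 j) z (p' 0 j)) ->
  differentiable f z /\ derive1 f z = p'.
Proof.
move=> H.
have L : (fun h : C => h^-1 *: (f (h + z) - f z)) @ 0^' --> p'.
  apply/within_cvgP => eps eps0; have e2 : 0 < eps / 2 by lra.
  have [d d0 Hd] := @finite_near R 'I_n
    (fun j h => nc (f (z + h) 0 j - f z 0 j - h * p' 0 j) <= eps / 2 * nc h)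
    (fun j => H j _ e2).
  exists d => // h h0; rewrite subr0 => /Hd Hh j; rewrite !mxE.
  have -> : h^-1 * (f (h + z) 0 j - f z 0 j) - p' 0 j =
      h^-1 * (f (z + h) 0 j - f z 0 j - h * p' 0 j).
    by rewrite [z + h]addrC !mulrBr mulKf.
  rewrite ncM ncV mulrC ltr_pdivrMr ?nc_gt0 //; apply: le_lt_trans (Hh j) _.
  by rewrite ltr_pM2r ?nc_gt0 //; lra.
split; last exact: cvg_lim.
apply/derivable1_diffP/cvg_ex; exists p'.
rewrite [X in X @ _](_ : _ = fun h : C => h^-1 *: (f (h + z) - f z)); first exact: L.
by apply/funext => h /=; rewrite [h *: _]mulr1.
Qed.

Lemma differentiable_vn_cont (g : C -> V) z : differentiable g z ->
  forall eta : R, 0 < eta -> exists2 d : R, 0 < d &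
    forall z', nc (z' - z) < d -> vn (g z' - g z) <= eta.
Proof.
move=> /differentiable_continuous gc eta eta0.
have [e e0 en] : exists2 e : R, 0 < e & n%:R * e <= eta.
  exists (eta / n.+1%:R); first by rewrite divr_gt0.
  by rewrite mulrCA ler_piMr ?(ltW eta0) // ler_pdivrMr // mul1r ler_nat.
have {}gc : g @ z --> g z := gc.
have /cvgrPdist_lt/(_ e%:C) := gc; rewrite ltcR => /(_ e0) gn.
have /nbhs_nc[d d0 Hd] := gn.
exists d => // z' /ball_nc/Hd H.
apply: le_trans en; rewrite vnC; apply: vn_le => j.
exact: ltW (norm_row_lt j H).
Qed.

Lemma open_nc (S : set C) :
  (forall z, S z -> exists2 d : R, 0 < d & forall z', nc (z' - z) < d -> S z') -> open S.
Proof.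
move=> H; rewrite openE => z /H[d d0 Hd]; apply/nbhs_nc; exists d => // z' /ball_nc.
exact: Hd.
Qed.

Lemma open_disc (r : R) : open (disc r : set C).
Proof.
apply: open_nc => z; rewrite /disc /= lt_norm_nc => zr.
exists (r - nc z); first by rewrite subr_gt0.
by move=> z' h; rewrite lt_norm_nc; have := ncBl z' z; lra.
Qed.

(** Both sides are directional derivatives, and their difference quotients are the same function. *)
Lemma jacobian_partial (F : X -> V) i j : differentiable F (0, 0, 0) ->
  ('J (fun f : V => F (0, 0, f)) 0) i j = 'd F (0, 0, 0) (0, 0, delta_mx 0 i) 0 j.
Proof.
move=> dF; rewrite /jacobian mxE.
have dG : differentiable (fun f : V => F (0, 0, f)) 0.
  by apply: (@differentiable_comp _ _ _ _ (fun f : V => (0, 0, f) : X) F).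
have <- := @deriveE C _ _ _ _ (delta_mx 0 i) dG.
have <- := @deriveE C _ _ _ _ (0, 0, delta_mx 0 i) dF.
rewrite /derive.
have e1 h : ((fun f : V => F (0, 0, f)) \o shift 0) (h *: delta_mx 0 i) =
    (F \o shift (0, 0, 0)) (h *: ((0, 0, delta_mx 0 i) : X)).
  have e2 : h *: ((0, 0, delta_mx 0 i) : X) = (0, 0, h *: delta_mx 0 i).
    by congr (_, _, _); exact: scaler0.
  by rewrite /= e2 addr0 (addr0 ((0, 0, _) : X)).
by under eq_fun => h do rewrite e1.
Qed.

(** The bound 1 comes from continuity at the origin, where [F] vanishes; no compactness of the
    polydisc enters. *)
Lemma polydisc_bound (U : set X) (F : X -> V) (rho rho1 : R) :
  0 < rho -> rho < rho1 -> closed_polydisc rho rho1 `<=` U ->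
  (forall x, U x -> differentiable F x) -> F (0, 0, 0) = 0 ->
  exists2 s : R, 0 < s & s <= rho /\ forall x, sz x < s ->
    U x /\ forall j, nc (F x 0 j) <= 1.
Proof.
move=> r0 r1 pU dF F0.
have U0 : U (0, 0, 0).
  apply: pU; split => [||j]; rewrite /closed_disc /= ?mxE le_norm_nc nc0 ltW //.
  exact: lt_trans r1.
have /cvgrPdist_lt/(_ 1%:C) := differentiable_continuous (dF _ U0).
rewrite F0 ltcR => /(_ ltr01) Fc; have /nbhs_nc[d d0 Hd] := Fc.
exists (Num.min d rho); first by rewrite lt_min d0.
split; first by rewrite ge_min lexx orbT.
move=> [[e z] w]; rewrite /sz /= lt_min => /andP[xd xr].
have e0 := nc_ge0 e; have z0 := nc_ge0 z; have w0 := vn_ge0 w.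
have wj j : nc (w 0 j) <= vn w by exact: nc_le_vn.
split.
  apply: pU; split => [||j]; rewrite /closed_disc /= le_norm_nc; try lra.
  by have := wj j; lra.
move=> j; rewrite ltW // norm_row_lt // -normrN -sub0r; apply: Hd.
split; first by split; apply/ball_nc; rewrite subr0 /=; lra.
by apply/ball_row => // k; rewrite mxE subr0 /=; have := wj k; lra.
Qed.

End Interface.

(** * The theorem *)

Section Constants.
Variable R : realType.
Local Notation C := R[i].

(** Solvable because [sg] is chosen after [q]: the source term, of size K sg, must be small against
    c q, while the term proportional to the unknown only needs K (sg + 2 N q) small against c, with
    N = n + 1. *)
Lemma small_constants (r K c : R) n : 0 < r -> 0 < K -> 0 < c ->
  exists E q sg : R, [/\ 0 < E, 0 < q, 0 < sg & [/\ K * E <= c,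
    E + sg + 2 * n.+1%:R * q < r,
    n.+1%:R ^+ 2 / c ^+ 2 * (2 * (K * sg) ^+ 2) <= q ^+ 2 / 2,
    n.+1%:R ^+ 2 / c ^+ 2 * (2 * (K * (sg + 2 * n.+1%:R * q)) ^+ 2 * n.+1%:R) <= 2^-1 &
    sg + 3 * n.+1%:R * q <= r /\
    2 * K * (sg + 3 * n.+1%:R * q + 3 * n.+1%:R * q) < c]].
Proof.
move=> r0 K0 c0; have : 1 <= n.+1%:R :> R by rewrite ler1n.
move: (n.+1%:R) => N N1; have N0 : 0 < N by lra.
have N3 : 0 < N ^+ 3 by rewrite exprn_gt0.
(* The first entries of [E] and [q] keep all sizes below [r]. The 15 in [q] serves 18/225 <= 1/2 in
   the mean square estimate and 14 < 15 in the uniqueness condition; the second entry of [sg] is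
   exactly the source condition. *)
pose E := Num.min (r / 4) (c / K).
pose q := Num.min (r / (6 * N)) (c / (15 * K * N ^+ 3)).
pose sg := Num.min q (q * c / (2 * N * K)).
have E0 : 0 < E by rewrite lt_min !divr_gt0.
have KN : 0 < 15 * K * N ^+ 3 by rewrite !mulr_gt0.
have q0 : 0 < q by rewrite lt_min !divr_gt0 // mulr_gt0.
have NK : 0 < 2 * N * K by rewrite !mulr_gt0.
have sg0 : 0 < sg by rewrite lt_min q0 divr_gt0 // mulr_gt0.
have E4 : E <= r / 4 by rewrite ge_min lexx.
have EK : K * E <= c by rewrite mulrC -ler_pdivlMr // ge_min lexx orbT.
have qN : q * (6 * N) <= r by rewrite -ler_pdivlMr ?mulr_gt0 // ge_min lexx.
have qK : q * (15 * K * N ^+ 3) <= c by rewrite -ler_pdivlMr // ge_min lexx orbT.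
have sq : sg <= q by rewrite ge_min lexx.
have sK : sg * (2 * N * K) <= q * c by rewrite -ler_pdivlMr // ge_min lexx orbT.
clearbody E q sg.
have qqN : q <= q * N by rewrite ler_peMr // ltW.
have N2 : N <= N ^+ 3 by rewrite ler_eXnr.
have c2 : 0 < c ^+ 2 by rewrite exprn_gt0.
exists E, q, sg; split=> //; split=> //.
- by lra.
- have h : (sg * (2 * N * K)) ^+ 2 <= (q * c) ^+ 2.
    by rewrite lerXn2r ?nnegrE // mulr_ge0 // ltW.
  rewrite mulrAC ler_pdivrMr //.
  have -> : N ^+ 2 * (2 * (K * sg) ^+ 2) = (sg * (2 * N * K)) ^+ 2 / 2 by field.
  have -> : q ^+ 2 / 2 * c ^+ 2 = (q * c) ^+ 2 / 2 by field.
  by rewrite ler_wpM2r.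
- have h1 : K * (sg + 2 * N * q) <= K * (3 * (N * q)) by rewrite ler_wpM2l ?(ltW K0) //; lra.
  have h0 : 0 <= K * (sg + 2 * N * q) by rewrite mulr_ge0 ?addr_ge0 ?mulr_ge0 // ltW.
  have h2 : (K * (sg + 2 * N * q)) ^+ 2 <= (K * (3 * (N * q))) ^+ 2.
    by rewrite lerXn2r ?nnegrE // (le_trans h0).
  have h3 : (q * (15 * K * N ^+ 3)) ^+ 2 <= c ^+ 2.
    by rewrite lerXn2r ?nnegrE ?mulr_ge0 // ltW.
  rewrite mulrAC ler_pdivrMr //.
  apply: le_trans (_ : N ^+ 3 * (2 * (K * (3 * (N * q))) ^+ 2) <= _).
    have -> : N ^+ 2 * (2 * (K * (sg + 2 * N * q)) ^+ 2 * N) =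
      N ^+ 3 * (2 * (K * (sg + 2 * N * q)) ^+ 2) by ring.
    by rewrite ler_wpM2l ?(ltW N3) // ler_wpM2l.
  apply: le_trans (_ : N * (N ^+ 3 * (2 * (K * (3 * (N * q))) ^+ 2)) <= _).
    by rewrite ler_peMl // mulr_ge0 ?(ltW N3) // mulr_ge0 // sqr_ge0.
  have -> : N * (N ^+ 3 * (2 * (K * (3 * (N * q))) ^+ 2)) =
    (q * (15 * K * N ^+ 3)) ^+ 2 * (18 / 225) by field.
  have := sqr_ge0 (q * (15 * K * N ^+ 3)); lra.
split; first by lra.
apply: le_lt_trans (_ : 14 * (q * K * N ^+ 3) < _); last first.
  have h : 0 < q * K * N ^+ 3 by rewrite !mulr_gt0.
  by move: h qK; rewrite !mulrA; lra.
have h1 : sg + 3 * N * q + 3 * N * q <= 7 * (q * N ^+ 3).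
  have : q * N <= q * N ^+ 3 by rewrite ler_wpM2l // ltW.
  lra.
have := ler_wpM2l (ltW K0) h1; lra.
Qed.

Lemma sector_cone (gamma E : R) (e : C) : 0 <= gamma / 2 <= pi ->
  sector gamma E e <-> nc e < E /\ cos (gamma / 2) * nc e < complex.Re e.
Proof.
move=> gpi; rewrite /sector /=; split=> [[/andP[e0 eE] ea]|[eE eR]].
  rewrite normr_gt0 in e0; rewrite lt_norm_nc in eE; split=> //.
  by rewrite -Arg_lt.
have e0 : e != 0 by apply: contraTneq eR => ->; rewrite nc0 mulr0 ltxx.
by rewrite normr_gt0 e0 lt_norm_nc eE Arg_lt.
Qed.

Lemma sector_near (gamma E : R) (e : C) : 0 <= gamma / 2 <= pi -> sector gamma E e ->
  exists2 d : R, 0 < d & forall e', nc (e' - e) < d -> sector gamma E e'.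
Proof.
move=> gpi /(sector_cone _ _ gpi); set k := cos _ => -[eE eR].
have k1 : `|k| <= 1 by rewrite ler_norml cos_geN1 cos_le1.
pose d := Num.min (E - nc e) ((complex.Re e - k * nc e) / 2).
have d0 : 0 < d by rewrite lt_min subr_gt0 eE divr_gt0 ?subr_gt0.
have d1 : d <= E - nc e by rewrite ge_min lexx.
have d2 : d <= (complex.Re e - k * nc e) / 2 by rewrite ge_min lexx orbT.
exists d => // e' he; apply/sector_cone => //; rewrite -/k; clearbody d k.
have h1 := ncBl e' e.
have h2 := Re_le (e' - e); rewrite ReB ler_norml in h2.
have h3 : k * (nc e' - nc e) <= nc (e' - e).
  apply: le_trans (ler_norm _) _; rewrite normrM -[leRHS]mul1r ler_pM // ler_norml.
  by rewrite h1 andbT; have := ncBl e e'; rewrite ncC; lra.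
by split; lra.
Qed.

(** The cone for mu has half-angle gamma0/4, half of the angle free of eigenvalues, so [cone_gap]
    has a positive gap between the two cosines. Invertibility gives |l| > 0 and thereby a positive
    distance also at mu = 0. *)
Lemma cone_resolvent n (A : 'M[C]_n.+1) (gamma0 : R) : A \in unitmx -> 0 < gamma0 ->
  (forall l, eigenvalue A l -> gamma0 / 2 < `|Arg l|) ->
  gamma0 / 2 <= pi /\ exists2 c : R, 0 < c & forall mu (y : 'rV[C]_n.+1),
    cos (gamma0 / 4) * nc mu <= complex.Re mu -> c * vn y <= vn (y *m (mu%:M - A)).
Proof.
move=> Au g0 HA.
have lne l : eigenvalue A l -> l != 0.
  case/eigenvalueP => v vA v0; apply: contra_neq v0 => l0.
  by rewrite -[v](mulmxK Au) vA l0 scale0r mul0mx.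
(* A complex matrix of positive size has an eigenvalue, and its argument is at most pi in modulus.
   This puts gamma0/4 below pi/2, where the cosine is nonnegative. *)
have gpi : gamma0 / 2 <= pi.
  have [[|l s] Hs] := closed_field_poly_normal (char_poly A).
    move: (size_char_poly A); rewrite Hs big_nil (monicP (char_poly_monic A)).
    by rewrite scale1r size_poly1.
  have El : eigenvalue A l.
    rewrite eigenvalue_root_char Hs (monicP (char_poly_monic A)) scale1r.
    by rewrite root_prod_XsubC mem_head.
  have := HA l El; have := Arg_norm (lne l El); rewrite in_itv /=; lra.
split=> //; have p0 := pi_gt0 R.
have k1 : 0 <= cos (gamma0 / 4) by apply: cos_ge0_pihalf; lra.
have k01 : cos (gamma0 / 2) < cos (gamma0 / 4).
  by rewrite ltr_cos ?in_itv /=; lra.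
apply: (resolvent_bound (Q := [set mu | cos (gamma0 / 4) * nc mu <= complex.Re mu])).
move=> l El; have l0 := lne l El.
have hl : complex.Re l <= cos (gamma0 / 2) * nc l.
  rewrite leNgt -Arg_lt //; last by lra.
  by rewrite -leNgt ltW // HA.
exists ((cos (gamma0 / 4) - cos (gamma0 / 2)) * nc l / (1 + cos (gamma0 / 4))).
  by rewrite divr_gt0 ?mulr_gt0 ?nc_gt0 //; lra.
move=> mu hm; rewrite ler_pdivrMr; last by lra.
by rewrite [leRHS]mulrC; apply: cone_gap.
Qed.

End Constants.

Theorem proposition2 (R : realType) (nu : nat) (nu_ge1 : (1 <= nu)%N)
    (rho rho1 : R) (rho_gt0 : 0 < rho) (rho_lt_rho1 : rho < rho1)
    (U : set (R[i] * R[i] * 'rV[R[i]]_nu))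
    (F : R[i] * R[i] * 'rV[R[i]]_nu -> 'rV[R[i]]_nu)
    (polydisc_sub : closed_polydisc rho rho1 `<=` U)
    (F_hol : holomorphic U F)
    (F_00 : forall e, closed_disc rho e -> F (e, 0, 0) = 0)
    (A_unit : Jacobian_f F 0 0 0 \in unitmx)
    (gamma0 : R) (gamma0_gt0 : 0 < gamma0)
    (A_eigen : forall lambda, eigenvalue (Jacobian_f F 0 0 0) lambda ->
       gamma0 / 2 < `|Arg lambda|) :
  exists gamma E sigma : R,
    [/\ 0 < gamma, 0 < E, 0 < sigma &
      exists f : R[i] -> R[i] -> 'rV[R[i]]_nu,
        solves_system U F (sector gamma E) (disc sigma) f /\
        exists fstar : R[i] -> 'rV[R[i]]_nu,
          [/\ solves_reduced U F (disc sigma) fstar,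
              forall g, solves_reduced U F (disc sigma) g ->
                forall z, disc sigma z -> g z = fstar z &
              forall z, disc sigma z ->
                f e z @[e --> within (sector gamma E) (nbhs (0 : R[i]))]
                  --> fstar z]].
Proof.
case: nu nu_ge1 => // n _ in U F polydisc_sub F_hol F_00 A_unit A_eigen *.
have [U_open F_diff] := F_hol.
have rho_nc e : nc e <= rho -> F (e, 0, 0) = 0.
  by move=> er; apply: F_00; rewrite /closed_disc /= le_norm_nc.
have F0 : F (0, 0, 0) = 0 by apply: rho_nc; rewrite nc0 ltW.
have [s s0 [s_rho Hs]] := polydisc_bound rho_gt0 rho_lt_rho1 polydisc_sub F_diff F0.
pose D x := 'd F x : R[i] * R[i] * 'rV[R[i]]_n.+1 -> 'rV[R[i]]_n.+1.
have D_lin x a u v : D x (a *: u + v) = a *: D x u + D x v by exact: linearP.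
have F_der x v j : sz x < s -> cder (fun t => F (x + t *: v) 0 j) 0 (D x v 0 j).
  by move=> /Hs[/F_diff dF _]; exact: differentiable_cder.
have F_bnd x j : sz x < s -> nc (F x 0 j) <= 1 by move=> /Hs[_]; exact.
have [r [K [r0 K0 rs [D_bnd D_lip F_quad F_lip]]]] :=
  vector_estimates s0 D_lin F_der F_bnd (ltn0Sn n).
have F_00r e : nc e <= r -> F (e, 0, 0) = 0.
  by move=> er; apply: rho_nc; lra.
have s00 : sz ((0, 0, 0) : R[i] * R[i] * 'rV[R[i]]_n.+1) < s.
  by rewrite sz3 !nc0 vn0 !addr0.
(* [jac] acts on rows from the right and [Jacobian_f] on columns; invertibility and eigenvalues are
   unaffected by the transposition. *)
have jac0E : jac D 0 = (Jacobian_f F 0 0 0)^T.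
  apply/matrixP => i j; rewrite /Jacobian_f trmxK mxE jacobian_partial //.
  exact: F_diff (Hs _ s00).1.
clearbody D.
have J_unit : jac D 0 \in unitmx by rewrite jac0E unitmx_tr.
have J_eigen l : eigenvalue (jac D 0) l -> gamma0 / 2 < `|Arg l|.
  by rewrite jac0E eigenvalue_trmx; exact: A_eigen.
have [gpi [c2 c20 Hc2]] := cone_resolvent J_unit gamma0_gt0 J_eigen.
(* Half of [c2] is given up in replacing J(0) by J(e), which differ by at most K E <= c for |e| <=
   E. *)
pose c := c2 / 2; have c0 : 0 < c by rewrite /c; lra.
have [E [q [sg [E0 q0 sg0 [KE size small1 small2 [size2 small3]]]]]] :=
  small_constants n r0 K0 c0.
pose kap := cos (gamma0 / 4).
(* The closed cone of half-angle gamma0/4, cut at radius [E]. Only e is cut: the cone inequality is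
   homogeneous, so k e satisfies it for all k, and the bound for J(0) holds on the whole cone. *)
pose S0 : set R[i] := [set e | nc e <= E /\ kap * nc e <= complex.Re e].
have S0_le e : S0 e -> nc e <= E by case.
have S00 : S0 0 by split; rewrite nc0 ?mulr0 // ltW.
have nn0 : 0 <= n.+1%:R :> R by [].
have Nq : 0 < n.+1%:R * q by rewrite mulr_gt0.
have Er : E <= r.
  apply/ltW/(le_lt_trans _ size); rewrite -addrA lerDl addr_ge0 ?(ltW sg0) //.
  by rewrite -mulrA mulr_ge0 // ltW.
have resolvent e k (y : 'rV[R[i]]_n.+1) : S0 e -> (0 < k)%N ->
    c * vn y <= vn (y *m ((k%:R * e)%:M - jac D e)).
  move=> [eE eR] _.
  have cone : kap * nc (k%:R * e) <= complex.Re (k%:R * e).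
    have -> : complex.Re (k%:R * e) = k%:R * complex.Re e.
      by rewrite !mulr_natl raddfMn.
    by rewrite ncM nc_nat mulrCA ler_wpM2l.
  have h1 := Hc2 _ y cone.
  have r00 : nc (0 : R[i]) <= r by rewrite nc0 ltW.
  have h2 := jac_lip D_lin D_lip y (le_trans eE Er) r00; rewrite subr0 in h2.
  have h3 : K * nc e * vn y <= c * vn y.
    by rewrite ler_wpM2r ?vn_ge0 //; apply: le_trans KE; rewrite ler_wpM2l // ltW.
  have E1 : y *m ((k%:R * e)%:M - jac D 0) =
      y *m ((k%:R * e)%:M - jac D e) + (y *m jac D e - y *m jac D 0).
    by rewrite !mulmxBr addrA subrK.
  have h4 := vnD (y *m ((k%:R * e)%:M - jac D e)) (y *m jac D e - y *m jac D 0).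
  by rewrite -E1 in h4; move: h1 h2 h3 h4; rewrite /c; clear; lra.
pose f := sol F D sg.
have f_size e z := @sol_size _ _ _ _ _ _ r0 K0 D_lin D_bnd D_lip F_quad F_lip F_00r
  _ _ _ _ _ S0_le resolvent c0 q0 sg0 size small1 small2 e z.
have f_ode e z := @sol_ode _ _ _ _ _ _ r0 K0 D_lin D_bnd D_lip F_quad F_lip F_00r
  _ _ _ _ _ S0_le resolvent c0 q0 sg0 size small1 small2 e z.
have f_joint e z j := @sol_joint _ _ _ _ _ _ r0 K0 D_lin D_bnd D_lip F_quad F_lip F_00r
  _ _ _ _ _ S0_le resolvent c0 q0 sg0 size small1 small2 e z j.
have f_lim z := @sol_lim _ _ _ _ _ _ r0 K0 D_lin D_bnd D_lip F_quad F_lip F_00r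
  _ _ _ _ _ S0_le resolvent c0 q0 sg0 size small1 small2 z S00.
have f_z0 := @sol0 _ _ _ _ _ _ r0 K0 D_lin D_bnd D_lip F_quad F_lip F_00r
  _ _ _ _ _ S0_le resolvent c0 q0 sg0 size small1 small2 0 S00.
(* The threshold 3 (n + 1) q lies strictly above the bound 2 (n + 1) q for [sol], which is what
   contradicts an intermediate value. *)
have f_uniq g := @reduced_global _ _ _ _ _ _ r0 K0 D_lin D_bnd D_lip F_quad F_lip F_00r
  _ _ _ _ _ S0_le resolvent c0 q0 sg0 size small1 small2 g (3 * n.+1%:R * q) S00.
rewrite -/f in f_size f_ode f_joint f_lim f_z0 f_uniq.
have gE : gamma0 / 2 / 2 = gamma0 / 4 by field.
have gpi4 : 0 <= gamma0 / 2 / 2 <= pi.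
  rewrite gE divr_ge0 ?(ltW gamma0_gt0) //=; apply: le_trans gpi.
  by rewrite ler_wpM2l ?(ltW gamma0_gt0) // lef_pV2 ?posrE // ler_nat.
have sector_S0 e : sector (gamma0 / 2) E e -> S0 e.
  by move=> /(sector_cone _ _ gpi4)[h1 h2]; split; apply: ltW => //; rewrite /kap -gE.
have sz_U e z : S0 e -> nc z < sg -> U (e, z, f e z).
  by move=> He zs; apply: (Hs _ _).1; exact: lt_trans (f_size e z He zs) rs.
have discE z : disc sg z <-> nc z < sg by rewrite /disc /= lt_norm_nc.
exists (gamma0 / 2), E, sg; split=> //; first by rewrite divr_gt0.
exists f; split.
  split; last first.
    move=> e z /sector_S0 He /discE zs; split; first exact: sz_U.
    have [p' [Hp <-]] := f_ode e z He zs.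
    by rewrite (differentiable_derive1 Hp).2.
  split.
    rewrite openE => -[e z] [/= /(sector_near gpi4)[d1 d10 H1] /discE zs].
    have d2 : 0 < Num.min d1 (sg - nc z) by rewrite lt_min d10 subr_gt0.
    apply/nbhs_nc; exists (Num.min d1 (sg - nc z)) => //.
    move=> [e' z'] [/= /ball_nc h1 /ball_nc h2]; move: h1 h2.
    rewrite !lt_min => /andP[h1 _] /andP[_ h2]; split=> /=; first exact: H1.
    apply/discE; rewrite -(ltrD2r (- nc z)).
    by apply: le_lt_trans h2; exact: ncBl.
  move=> [e z] [/= /(sector_near gpi4)[d d0 Hd] /discE zs].
  apply: differentiable_joint => j; apply: f_joint => //.
  by exists d => // e' /Hd/sector_S0.
exists (f 0); split.
- split=> //.
    split; first exact: open_disc.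
    move=> z /discE zs; have [p' [Hp _]] := f_ode 0 z S00 zs.
    exact: (differentiable_derive1 Hp).1.
  move=> z /discE zs; split; first exact: sz_U.
  by have [p' [_ <-]] := f_ode 0 z S00 zs; rewrite mul0r scale0r.
- move=> g [[_ gd] g0 gF] z /discE zs.
  apply: (f_uniq g) => //.
  + by rewrite ltr_pM2r // ltr_pM2r ?ltr_nat.
  + by move=> z' /discE/gd; exact: differentiable_vn_cont.
  + by move=> z' /discE/gF[].
move=> z /discE zs; apply/within_cvgP => eps eps0.
have e2 : 0 < eps / 2 by rewrite divr_gt0.
have [d d0 Hd] := f_lim z zs _ e2.
exists d => // e /sector_S0 He; rewrite subr0 => ed j.
have -> : f e z 0 j - f 0 z 0 j = (f e z - f 0 z) 0 j.
  by rewrite [RHS]mxE [X in _ = _ + X]mxE.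
apply: le_lt_trans (le_trans (nc_le_vn _ j) (Hd e He ed)) _.
by rewrite ltr_pdivrMr // ltr_pMr // ltr1n.
Qed.
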